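(* Let $c\in\mathbb{C}$, and let $f$ be a meromorphic function (in $\mathbb{C}$) of finite order such that $\Delta_c f\not\equiv 0$. Let $q\ge 2$, and let $a_1(z),\ldots,a_q(z)$ be distinct meromorphic periodic functions with period $c$ such that $a_k\in\mathcal{S}(f)$ for all $k=1,\ldots,q$. Then $$m(r,f)+\sum_{k=1}^q m\left(r,\frac{1}{f-a_k}\right)\le 2T(r,f)-N_{pair}(r,f)+S(r,f),$$ where $$N_{pair}(r,f):=2N(r,f)-N(r,\Delta_c f)+N\left(r,\frac{1}{\Delta_c f}\right)$$ and the exceptional set associated with $S(r,f)$ is of at most finite logarithmic measure.
   Context: Standard Nevanlinna notation is used: $m(r,\cdot)$ is the proximity function, $N(r,\cdot)$ the integrated counting function of poles (counting multiplicities) and $T(r,\cdot)$ the characteristic function of a meromorphic function in $\mathbb{C}$. ''Periodic with period $c$'' means $a(z+c)\equiv a(z)$; constants are included. $\Delta_c f:=f(z+c)-f(z)$. A set $E\subset(0,\infty)$ has finite logarithmic measure if $\int_E \frac{dr}{r}<\infty$ (as usual, $E$ is considered for large $r$). $\mathcal{S}(f)$ is the set of all meromorphic functions $g$ such that $T(r,g)=o(T(r,f))$ as $r\to\infty$ outside of a set of finite logarithmic measure. $S(r,f)$ denotes any quantity that is $o(T(r,f))$ as $r\to\infty$ outside of a set of finite logarithmic measure. *)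

(* Defs.v *)
From HB Require Import structures.
From mathcomp Require Import all_boot all_order all_algebra.
From mathcomp Require Import all_classical all_reals all_analysis.
From mathcomp Require Import complex.

Set Implicit Arguments.
Unset Strict Implicit.
Unset Printing Implicit Defensive.

Import Order.TTheory GRing.Theory Num.Theory numFieldNormedType.Exports.

Local Open Scope classical_set_scope.
Local Open Scope ring_scope.
Local Open Scope complex_scope.

(* The complex plane as a normed space over itself, so that [derivable f z 1]
   is complex differentiability. *)
Notation Cplane R := (R[i]^o).

Section Meromorphic.
Context {R : realType}.
Local Notation C := (Cplane R).
Implicit Types (f g : C -> C) (z c : C).

Definition holomorphic_at f z := \forall w \near z, derivable f w 1.

(* A meromorphic function is represented by a total function C -> C whose
   values on a closed discrete set (in particular at the poles) carry no
   meaning: only the germs on punctured neighbourhoods are constrained. *)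
Definition meromorphic f := forall z : C, exists (n : nat) (g : C -> C),
  holomorphic_at g z /\ \forall w \near z^', f w = g w / (w - z) ^+ n.

(* Equality of meromorphic functions, i.e. equality of total representatives
   outside a closed discrete set. *)
Definition mero_eq f g := forall z : C, \forall w \near z^', f w = g w.

Definition mero_periodic c f := mero_eq (fun z => f (z + c)) f.

Definition difference c f : C -> C := fun z => f (z + c) - f z.

(* For n > 0 this says that z is a pole of multiplicity n. *)
Definition pole_of_mult f z (n : nat) := exists g : C -> C,
  [/\ holomorphic_at g z, g z != 0 &
      \forall w \near z^', f w = g w / (w - z) ^+ n].

(* Such an n is unique; the default value 0 is taken exactly when f has a zero
   at z (after removing the singularity) or vanishes identically near z. *)
Definition pole_mult f z : nat := xget 0%N (pole_of_mult f z).

End Meromorphic.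

Section Nevanlinna.
Context {R : realType}.
Local Notation C := (Cplane R).
Local Notation mu := (@lebesgue_measure R).
Implicit Types (f g : C -> C) (r t : R).

Definition logp (x : R) : R := Num.max 0 (ln x).

Definition circle_pt r t : C := (r * cos t) +i* (r * sin t).

Definition proximity f r : R :=
  (2 * pi)^-1 *
    \int[mu]_(t in `[0, 2 * pi]) logp (Normc.normc (f (circle_pt r t))).

(* The unintegrated counting function n(r, f). The sum is over the finite set
   of those z in the closed disc that have a non-zero term. *)
Definition pole_count f r : R :=
  \sum_(z \in [set z : C | Normc.normc z <= r]) ((pole_mult f z)%:R : R).

Definition integrated_counting f r : R :=
  \int[mu]_(t in `]0, r]) ((pole_count f t - pole_count f 0) / t) +
  pole_count f 0 * ln r.

Definition characteristic f r : R := proximity f r + integrated_counting f r.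

Definition growth_order f : \bar R :=
  limf_esup (fun r : R => (logp (characteristic f r) / ln r)%:E)
            (pinfty_nbhs R).

Definition finite_order f := (growth_order f < +oo)%E.

Definition finite_log_measure (E : set R) :=
  [/\ E `<=` `]0, +oo[%classic, measurable E &
      (\int[mu]_(t in E) (t^-1)%:E < +oo)%E].

(* h(r) = o(T(r, f)) outside a set of finite logarithmic measure; this is the
   relation S(r, f). *)
Definition small_quantity f (h : R -> R) :=
  exists2 E : set R, finite_log_measure E &
    forall eps : R, 0 < eps -> \forall r \near +oo, ~ E r ->
      `|h r| <= eps * `|characteristic f r|.

Definition small_function f : set (C -> C) :=
  [set g | meromorphic g /\ small_quantity f (characteristic g)].

Definition N_pair (c : C) f r : R :=
  2 * integrated_counting f r - integrated_counting (difference c f) r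
  + integrated_counting (fun z => (difference c f z)^-1) r.

End Nevanlinna.

(* Main.v *)
Require Import Defs.
From HB Require Import structures.
From mathcomp Require Import all_boot all_order all_algebra.
From mathcomp Require Import all_classical all_reals all_analysis.
From mathcomp Require Import measurable_realfun complex ring lra.

(** The proof is the classical one. Put D = f(z + c) - f(z). At a point where
    D and all the f - a_k are finite and non-zero, let k be an index for which
    |f - a_k| is smallest. For j <> k the triangle inequality gives |f - a_j|
    >= |a_j - a_k| / 2, while 1 / (f - a_k) = (1 / D) (D / (f - a_k)).
    Averaging over a circle bounds the sum of the m(r, 1/(f - a_k)) by m(r,
    1/D), plus the sum of the m(r, D/(f - a_k)), plus the m(r, 1/(a_i - a_j))
    (sum_logp_inv_le, second_main_estimate). The first main theorem turns m(r,
    1/D) into m(r, D) + N(r, D) - N(r, 1/D) + O(1), and m(r, D) <= m(r, f) +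
    m(r, D/f). As 2 T(r, f) - N_pair(r, f) is 2 m(r, f) + N(r, D) - N(r, 1/D),
    it remains to see that the error terms are S(r, f). For the a_i - a_j this
    is the first main theorem once more.

    For m(r, D/(f - a)) put g = f - a. As a has period c, D/g is g(z + c)/g(z)
    - 1 and the lemma on the difference quotient applies: m(r, g(z + c)/g(z))
    is small compared with T(r, f) when f has finite order. It is proved here
    quantitatively. On a disc of radius rho + 1, g is a zero-free holomorphic
    h times a product of powers of the z - a over the zeros and poles a. For h
    the Poisson formula bounds the variation of log |h| over the distance |c|
    (poisson_diff). The factor at a contributes at most log(1 + |c|/|z - a|) +
    log(1 + |c|/|z + c - a|), whose mean over the circle is O(r^(-1/2))
    whatever the position of a (avg_ln1). Altogether m(r, g(z + c)/g(z)) is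
    controlled by the characteristic of g at rho and by the number of zeros
    and poles in the disc of radius rho + 1, hence by the counting functions
    at a still larger radius (difference_estimate).

    To come back to the radius r one needs radii rho and R that exceed r by a
    bounded factor at most, that are not too close to r, and at which the
    characteristic T is hardly larger than T(r). With x = r^(1/16), a radius s
    in [r + x^12, 2^16 r] with T(s) <= x T(r) exists for every r off a set of
    finite logarithmic measure (moderate_growth): the bad radii of a block
    [2^(16 j), 2^(16 (j + 1))) at which T lies between two consecutive powers
    of 2^j are within one short interval, and T being bounded by a power of r,
    there is a bounded number of levels. The argument only compares values of
    T at radii taken from a given set. Applying it twice gives a bound
    O(T(r)/x) (quotient_small).

    The freedom to choose that set is used to restrict everything to radii r
    for which no zero, pole or other exceptional point of the finitely many
    functions in play lies on the circle |z| = r. The remaining radii form a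
    countable set, which is absorbed in the exceptional set (generic_radii).
    So all integrands are continuous. The complex analysis rests on one
    theorem, Goursat's for rectangles (goursat): transported by the
    exponential map, it says that the mean of a holomorphic function over a
    circle does not depend on the radius. From this follow Cauchy's formula,
    Taylor expansions, logarithms of zero-free functions, and Jensen's
    formula. *)

Import Order.TTheory GRing.Theory Num.Theory numFieldNormedType.Exports.

Set Implicit Arguments.
Unset Strict Implicit.
Unset Printing Implicit Defensive.

Local Open Scope classical_set_scope.
Local Open Scope ring_scope.

Local Notation nrm := Normc.normc.
Local Notation Rp := complex.Re.
Local Notation Ip := complex.Im.

(** * The complex modulus, limits and derivatives *)

Section Plane.
Context {R : realType}.
Local Notation C := (Cplane R).
Implicit Types (z w : C) (r s : R).

Lemma normcE z : `|z| = (nrm z)%:C%C :> R[i]. Proof. by case: z. Qed.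

Lemma nrm_ge0 z : 0 <= nrm z.
Proof. by rewrite -(@ler0c R) -normcE. Qed.

Lemma nrm_eq0 z : (nrm z == 0) = (z == 0).
Proof.
by apply/eqP/eqP => [/Normc.eq0_normc//|->]; rewrite Normc.normc0.
Qed.

Lemma nrm_gt0 z : (0 < nrm z) = (z != 0).
Proof. by rewrite lt0r nrm_eq0 nrm_ge0 andbT. Qed.

Lemma nrm0 : nrm (0 : C) = 0. Proof. exact: Normc.normc0. Qed.
Lemma nrm1 : nrm (1 : C) = 1. Proof. exact: Normc.normc1. Qed.
Lemma nrmM z w : nrm (z * w) = nrm z * nrm w. Proof. exact: Normc.normcM. Qed.
Lemma nrmV z : nrm (z^-1) = (nrm z)^-1. Proof. exact: Normc.normcV. Qed.
Lemma nrmN z : nrm (- z) = nrm z. Proof. exact: normcN. Qed.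
Lemma nrmD z w : nrm (z + w) <= nrm z + nrm w. Proof. exact: le_normcD. Qed.
Lemma nrmB z w : nrm (z - w) <= nrm z + nrm w.
Proof. by rewrite -(nrmN w) nrmD. Qed.
Lemma nrmBC z w : nrm (z - w) = nrm (w - z).
Proof. by rewrite -nrmN opprB. Qed.
Lemma nrmX z n : nrm (z ^+ n) = nrm z ^+ n.
Proof.
by elim: n => [|n IH]; rewrite ?expr0 ?nrm1// !exprS nrmM IH.
Qed.
Lemma nrm_lerB z w : nrm z - nrm w <= nrm (z - w).
Proof. by rewrite lerBlDr (le_trans _ (nrmD _ _))// subrK. Qed.

Lemma nrm_real r : nrm (r%:C%C : C) = `|r|.
Proof. by apply: (@complexI R); rewrite -normcE normc_def /= expr0n addr0 sqrtr_sqr. Qed.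

Lemma nrm_sqr z : nrm z ^+ 2 = Rp z ^+ 2 + Ip z ^+ 2.
Proof. by case: z => a b /=; rewrite sqr_sqrtr// addr_ge0// sqr_ge0. Qed.

Lemma normRp_le z : `|Rp z| <= nrm z.
Proof.
rewrite -(@ler_pXn2r _ 2) ?nnegrE ?nrm_ge0//.
by rewrite nrm_sqr real_normK ?num_real// lerDl sqr_ge0.
Qed.

Lemma normIp_le z : `|Ip z| <= nrm z.
Proof.
rewrite -(@ler_pXn2r _ 2) ?nnegrE ?nrm_ge0//.
by rewrite nrm_sqr real_normK ?num_real// lerDr sqr_ge0.
Qed.

Lemma nrm_leD z : nrm z <= `|Rp z| + `|Ip z|.
Proof.
rewrite -(@ler_pXn2r _ 2) ?nnegrE ?nrm_ge0 ?addr_ge0//.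
rewrite nrm_sqr sqrrD !real_normK ?num_real// lerD2r lerDl.
by rewrite mulrn_wge0// mulr_ge0.
Qed.

Lemma nearCP z (P : C -> Prop) : (\forall w \near z, P w) <->
  exists2 d : R, 0 < d & forall w, nrm (w - z) < d -> P w.
Proof.
rewrite -nbhs_nearE -nbhs_ballE; split.
  move=> [e /= e0 he]; move: e0; rewrite ltcE => /andP[/eqP /= e2 e1].
  have eE : e = (Rp e)%:C%C by case: e e2 {he e1} => a b /= ->.
  exists (Rp e) => // w wz; apply: he.
  by rewrite -ball_normE /= distrC normcE eE ltcR.
move=> [d d0 hd]; exists (d%:C%C); first by rewrite /= ltcR.
by move=> w; rewrite -ball_normE /= distrC normcE ltcR; exact: hd.
Qed.

Lemma nearC'P z (P : C -> Prop) : (\forall w \near z^', P w) <->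
  exists2 d : R, 0 < d & forall w, w != z -> nrm (w - z) < d -> P w.
Proof.
rewrite near_withinE; split=> [/nearCP|] -[d d0 hd]; [|apply/nearCP]; exists d => //.
  by move=> w wz wd; exact: hd.
by move=> w wd wz; exact: hd.
Qed.

Lemma nearRP (x : R) (P : R -> Prop) : (\forall y \near x, P y) <->
  exists2 d : R, 0 < d & forall y, `|y - x| < d -> P y.
Proof.
rewrite -nbhs_nearE -nbhs_ballE; split => -[e /= e0 he]; exists e => // y.
  by move=> h; apply: he; rewrite -ball_normE /= distrC.
by rewrite -ball_normE /= distrC; exact: he.
Qed.

Lemma cvgCP (T : Type) (F : set_system T) {FF : Filter F} (f : T -> C) (l : C) :
  (f x @[x --> F] --> l) <->
  (forall e : R, 0 < e -> \forall x \near F, nrm (f x - l) < e).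
Proof.
split.
  move=> /cvgrPdist_lt h e e0; near=> x.
  rewrite nrmBC -ltcR -normcE; near: x.
  by apply: h; rewrite ltcR.
move=> h; apply/cvgrPdist_lt => e; rewrite ltcE => /andP[/eqP /= e2 e1].
have eE : e = (Rp e)%:C%C by case: e e2 {e1} => a b /= ->.
near=> x; rewrite distrC normcE eE ltcR; near: x; exact: h.
Unshelve. all: by end_near. Qed.

Lemma cvgRP (T : Type) (F : set_system T) {FF : Filter F} (f : T -> R) (l : R) :
  (f x @[x --> F] --> l) <->
  (forall e : R, 0 < e -> \forall x \near F, `|f x - l| < e).
Proof.
split.
  by move=> /cvgrPdist_lt h e e0; near=> x; rewrite distrC; near: x; exact: h.
move=> h; apply/cvgrPdist_lt => e e0.
by near=> x; rewrite distrC; near: x; exact: h.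
Unshelve. all: by end_near. Qed.

Lemma cvgRp (T : Type) (F : set_system T) {FF : Filter F} (f : T -> C) (l : C) :
  f x @[x --> F] --> l -> Rp (f x) @[x --> F] --> Rp l.
Proof.
move=> /cvgCP h; apply/cvgRP => e e0; apply: filterS (h _ e0) => x.
by apply: le_lt_trans; rewrite -raddfB/= normRp_le.
Qed.

Lemma cvgIp (T : Type) (F : set_system T) {FF : Filter F} (f : T -> C) (l : C) :
  f x @[x --> F] --> l -> Ip (f x) @[x --> F] --> Ip l.
Proof.
move=> /cvgCP h; apply/cvgRP => e e0; apply: filterS (h _ e0) => x.
by apply: le_lt_trans; rewrite -raddfB/= normIp_le.
Qed.

Lemma cvgnrm (T : Type) (F : set_system T) {FF : Filter F} (f : T -> C) (l : C) :
  f x @[x --> F] --> l -> nrm (f x) @[x --> F] --> nrm l.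
Proof.
move=> /cvgCP h; apply/cvgRP => e e0; apply: filterS (h _ e0) => x.
apply: le_lt_trans; rewrite ler_norml nrm_lerB andbT lerNl opprB.
by rewrite nrmBC nrm_lerB.
Qed.

Lemma cvgcomplex (T : Type) (F : set_system T) {FF : Filter F} (f g : T -> R) (a b : R) :
  f x @[x --> F] --> a -> g x @[x --> F] --> b ->
  ((f x +i* g x)%C : C) @[x --> F] --> ((a +i* b)%C : C).
Proof.
move=> /cvgRP hf /cvgRP hg; apply/cvgCP => e e0.
have e2 : 0 < e / 2 by rewrite divr_gt0.
near=> x; apply: le_lt_trans (nrm_leD _) _ => /=.
rewrite [e]splitr ltrD//; near: x; [exact: hf|exact: hg].
Unshelve. all: by end_near. Qed.

Lemma nrmJ z : nrm (z^*)%C = nrm z.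
Proof. by case: z => a b /=; rewrite sqrrN. Qed.

Lemma cvgconj (T : Type) (F : set_system T) {FF : Filter F} (f : T -> C) (l : C) :
  f x @[x --> F] --> l -> ((f x)^*%C : C) @[x --> F] --> (l^*%C : C).
Proof.
move=> /cvgCP h; apply/cvgCP => e e0; apply: filterS (h _ e0) => x.
by rewrite -rmorphB/= nrmJ.
Qed.

(** Complex differentiability in the first order form f(w + h) = f(w) + L h +
    o(h), which composes and perturbs more easily than the difference
    quotient. *)
Definition cdiff (f : C -> C) w (L : C) := forall e : R, 0 < e ->
  exists2 d : R, 0 < d & forall h, nrm h < d ->
    nrm (f (w + h) - f w - L * h) <= e * nrm h.

Lemma cdiffP (f : C -> C) w (L : C) : is_derive w (1 : C) f L <-> cdiff f w L.
Proof.
split=> [[df <-] e e0|h].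
  move: df => /cvg_ex [l hl].
  have lE : 'D_1 f w = l by apply/cvg_lim.
  move/cvgCP: hl => /(_ _ e0) /nearC'P [d d0 hd].
  exists d => // k kd; have [->|k0] := eqVneq k 0.
    by rewrite addr0 subrr mulr0 subrr nrm0 mulr0.
  have := hd k k0; rewrite subr0 => /(_ kd) /ltW.
  have -> : k *: 1 = k by rewrite /GRing.scale /= mulr1.
  have -> : f (w + k) - f w - 'D_1 f w * k = (k^-1 *: (f (k + w) - f w) - l) * k.
    by rewrite lE mulrBl /GRing.scale /= mulrAC mulVf// mul1r addrC [w + k]addrC addrC.
  by rewrite nrmM => ?; rewrite ler_wpM2r ?nrm_ge0.
have H : (fun k : C => k^-1 *: (f (k *: 1 + w) - f w)) @ 0^' --> L.
  apply/cvgCP => e e0; have e2 : 0 < e / 2 by rewrite divr_gt0.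
  apply/nearC'P; have [d d0 hd] := h _ e2; exists d => // k k0; rewrite subr0 => kd.
  have -> : k *: 1 = k by rewrite /GRing.scale /= mulr1.
  have -> : k^-1 *: (f (k + w) - f w) - L = (f (w + k) - f w - L * k) / k.
    by rewrite mulrBl mulfK// /GRing.scale /= mulrC [w + k]addrC.
  rewrite nrmM nrmV ltr_pdivrMr ?nrm_gt0//; apply: le_lt_trans (hd _ kd) _.
  by rewrite ltr_pM2r ?nrm_gt0// ltr_pdivrMr// ltr_pMr// ltr1n.
apply: DeriveDef; first by apply/cvg_ex; exists L.
exact/cvg_lim.
Qed.

Lemma cdiff_derivable (f : C -> C) w L : cdiff f w L -> derivable f w (1 : C).
Proof. by move=> /cdiffP[]. Qed.

Lemma derivable_cdiff (f : C -> C) w : derivable f w (1 : C) -> cdiff f w ('D_1 f w).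
Proof. by move=> ?; apply/cdiffP; exact/derivableP. Qed.

Lemma derivable_cont (f : C -> C) w : derivable f w (1 : C) -> {for w, continuous f}.
Proof. by move=> /derivable1_diffP /differentiable_continuous. Qed.

Lemma nrm_circle_pt r t : nrm (circle_pt r t : C) = `|r|.
Proof.
rewrite /circle_pt; apply/eqP; rewrite -(@eqrXn2 _ 2) ?nrm_ge0// nrm_sqr /=.
by rewrite !exprMn -mulrDr cos2Dsin2 mulr1 real_normK ?num_real.
Qed.

Lemma circle_pt_cont2 (T : Type) (F : set_system T) {FF : Filter F}
    (f g : T -> R) (a b : R) :
  f x @[x --> F] --> a -> g x @[x --> F] --> b ->
  (circle_pt (f x) (g x) : C) @[x --> F] --> (circle_pt a b : C).
Proof.
move=> fa gb; apply: cvgcomplex; apply: cvgM => //.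
  by apply: (continuous_cvg _ _ gb); exact: continuous_cos.
by apply: (continuous_cvg _ _ gb); exact: continuous_sin.
Qed.

Lemma circle_pt_cont r t : {for t, continuous (circle_pt r : R -> C)}.
Proof. by apply: circle_pt_cont2; [exact: cvg_cst|exact: cvg_id]. Qed.

Lemma circle_pt2pi r : circle_pt r (2 * pi) = circle_pt r 0.
Proof. by rewrite /circle_pt mulr_natl cos2pi sin2pi cos0 sin0. Qed.

(** The range [-pi, pi] is that of the principal argument, which the arc
    cosine produces up to sign. *)
Lemma circle_ptE z : exists2 t, - pi <= t <= pi & z = circle_pt (nrm z) t.
Proof.
have pi0 := pi_ge0 R.
have [->|z0] := eqVneq z 0.
  by exists 0; rewrite ?oppr_le0 ?pi0// nrm0 /circle_pt !mul0r.
have n0 : nrm z != 0 by rewrite nrm_eq0.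
have h : (Rp z / nrm z) ^+ 2 + (Ip z / nrm z) ^+ 2 = 1.
  by rewrite !expr_div_n -mulrDl -nrm_sqr divff// expf_neq0.
have hx : -1 <= Rp z / nrm z <= 1.
  rewrite -ler_norml -(@ler_pXn2r _ 2) ?nnegrE// real_normK ?num_real//.
  by rewrite expr1n -h lerDl sqr_ge0.
have s2 : (sin (acos (Rp z / nrm z))) ^+ 2 = (Ip z / nrm z) ^+ 2.
  by rewrite sin2cos2 acosK// -h addrC addKr.
have zE : z = (Rp z +i* Ip z)%C by case: z {z0 n0 h hx s2}.
have a0 := acos_ge0 hx; have a1 := acos_lepi hx.
move/eqP: s2; rewrite eqf_sqr => /orP[]/eqP s2.
  exists (acos (Rp z / nrm z)); first by rewrite a1 andbT (le_trans _ a0)// oppr_le0.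
  rewrite /circle_pt s2 acosK//.
  by rewrite ![nrm z * _]mulrC !divfK.
exists (- acos (Rp z / nrm z)); first by rewrite lerN2 a1 (le_trans _ pi0)// oppr_le0.
rewrite /circle_pt cosN sinN s2 acosK// opprK.
by rewrite ![nrm z * _]mulrC !divfK.
Qed.

End Plane.

(** * Integrals over real segments *)

Section RealIntegrals.
Context {R : realType}.
Local Notation C := (Cplane R).
Local Notation mu := (@lebesgue_measure R).
Implicit Types (a b : R) (phi psi : R -> R).

Definition cont_on (T : topologicalType) a b (phi : R -> T) :=
  forall t, a <= t <= b -> {for t, continuous phi}.

Definition rint a b phi : R := \int[mu]_(t in `[a, b]) phi t.

Lemma cont_on_within (T : topologicalType) a b (phi : R -> T) :
  cont_on a b phi -> {within `[a, b], continuous phi}.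
Proof.
move=> h; apply: continuous_in_subspaceT => x; rewrite inE /= in_itv/=.
exact: h.
Qed.

Lemma rint_integrable a b phi : cont_on a b phi ->
  mu.-integrable `[a, b] (EFin \o phi).
Proof.
move=> h; apply: continuous_compact_integrable; first exact: segment_compact.
exact: cont_on_within.
Qed.

Lemma eq_rint a b phi psi : (forall t, a <= t <= b -> phi t = psi t) ->
  rint a b phi = rint a b psi.
Proof. by move=> h; apply: eq_Rintegral => t; rewrite inE/= in_itv/= => /h. Qed.

Lemma rintD a b phi psi : cont_on a b phi -> cont_on a b psi ->
  rint a b (fun t => phi t + psi t) = rint a b phi + rint a b psi.
Proof. by move=> h1 h2; apply: RintegralD => //; exact: rint_integrable. Qed.

Lemma rintB a b phi psi : cont_on a b phi -> cont_on a b psi ->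
  rint a b (fun t => phi t - psi t) = rint a b phi - rint a b psi.
Proof. by move=> h1 h2; apply: RintegralB => //; exact: rint_integrable. Qed.

Lemma rintZ a b k phi : cont_on a b phi ->
  rint a b (fun t => k * phi t) = k * rint a b phi.
Proof. by move=> h1; apply: RintegralZl => //; exact: rint_integrable. Qed.

Lemma rint_cst a b k : a <= b -> rint a b (fun=> k) = k * (b - a).
Proof.
move=> ab; rewrite /rint Rintegral_cst//=; congr (_ * _).
by rewrite lebesgue_measure_itv/= lte_fin; case: ltgtP ab => // ->; rewrite subrr.
Qed.

Lemma rint_le a b phi psi : cont_on a b phi -> cont_on a b psi ->
  (forall t, a <= t <= b -> phi t <= psi t) -> rint a b phi <= rint a b psi.
Proof.
move=> h1 h2 h.
by apply: (le_Rintegral _ (rint_integrable h1) (rint_integrable h2)).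
Qed.

Lemma rint_ge0 a b phi : (forall t, a <= t <= b -> 0 <= phi t) -> 0 <= rint a b phi.
Proof. by move=> h; apply: Rintegral_ge0 => t /=; rewrite in_itv/=; exact: h. Qed.

Lemma cont_cst_on (T : topologicalType) a b (k : T) : cont_on a b (fun=> k : T).
Proof. by move=> t _; exact: cvg_cst. Qed.

(** This is how the integrals over the sides of a small rectangle are compared
    with those of the linear part of the integrand. *)
Lemma rint_near a b phi k B : a <= b -> cont_on a b phi ->
  (forall t, a <= t <= b -> `|phi t - k| <= B) ->
  `|rint a b phi - k * (b - a)| <= B * (b - a).
Proof.
move=> ab cphi h; rewrite ler_norml; apply/andP; split.
  rewrite lerBrDr -mulNr -mulrDl -rint_cst//; apply: rint_le => //.
    exact: cont_cst_on.
  by move=> t /h; rewrite ler_norml => /andP[+ _]; rewrite lerBrDr.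
rewrite lerBlDr -mulrDl -rint_cst//; apply: rint_le => //.
  exact: cont_cst_on.
by move=> t /h; rewrite ler_norml => /andP[_]; rewrite lerBlDr.
Qed.

Lemma rint_split a m b phi : a <= m <= b -> cont_on a b phi ->
  rint a b phi = rint a m phi + rint m b phi.
Proof.
move=> /andP[am mb] h; have := @Rintegral_itvB R phi (BLeft a) (BRight b) m.
move=> /(_ (rint_integrable h)); rewrite !bnd_simp => /(_ am mb) H.
have -> : rint m b phi = \int[mu]_(x in `]m, b]) phi x.
  rewrite /rint Rintegral_itv_obnd_cbnd//.
  apply: integrableS (rint_integrable h) => //.
  by move=> t /=; rewrite !in_itv/= => /andP[/ltW h1 ->]; rewrite (le_trans am).
by rewrite -H /rint addrC subrK.
Qed.

Lemma rint_pt a phi : rint a a phi = 0.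
Proof. by rewrite /rint set_itv1 Rintegral_set1. Qed.

Lemma rint_FTC a b (F : R -> R) phi : a <= b -> cont_on a b phi ->
  (forall t, a <= t <= b -> is_derive t 1 F (phi t)) ->
  rint a b phi = F b - F a.
Proof.
rewrite le_eqVlt => /predU1P[<- _ _|ab cphi dF].
  by rewrite rint_pt subrr.
have dF' t : a <= t <= b -> derivable F t 1 by move=> /dF[].
have cF t : a <= t <= b -> {for t, continuous F}.
  by move=> /dF' /derivable1_diffP /differentiable_continuous.
rewrite /rint /Rintegral (@continuous_FTC2 _ phi F)//.
- exact: cont_on_within.
- split.
  + by move=> t; rewrite in_itv/= => /andP[/ltW h1 /ltW h2]; apply: dF'; rewrite h1.
  + by apply: cvg_at_right_filter; apply: cF; rewrite lexx ltW.
  + by apply: cvg_at_left_filter; apply: cF; rewrite lexx ltW.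
- move=> t; rewrite in_itv/= => /andP[/ltW h1 /ltW h2]; rewrite derive1E.
  have h3 : a <= t <= b by rewrite h1.
  by have [_ ->] := dF t h3.
Qed.

(** Integrals of complex functions are taken componentwise. *)
Definition cint a b (phi : R -> C) : C :=
  (rint a b (fun t => Rp (phi t)) +i* rint a b (fun t => Ip (phi t)))%C.

Lemma cont_Rp a b (phi : R -> C) : cont_on a b phi -> cont_on a b (fun t => Rp (phi t)).
Proof. by move=> h t /h; exact: cvgRp. Qed.
Lemma cont_Ip a b (phi : R -> C) : cont_on a b phi -> cont_on a b (fun t => Ip (phi t)).
Proof. by move=> h t /h; exact: cvgIp. Qed.
Lemma cont_nrm a b (phi : R -> C) : cont_on a b phi -> cont_on a b (fun t => nrm (phi t)).
Proof. by move=> h t /h; exact: cvgnrm. Qed.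
Lemma cont_add a b (phi psi : R -> C) : cont_on a b phi -> cont_on a b psi ->
  cont_on a b (fun t => phi t + psi t : C).
Proof. by move=> h1 h2 t tab; apply: cvgD; [exact: h1|exact: h2]. Qed.
Lemma cont_mul a b (phi psi : R -> C) : cont_on a b phi -> cont_on a b psi ->
  cont_on a b (fun t => phi t * psi t : C).
Proof. by move=> h1 h2 t tab; apply: cvgM; [exact: h1|exact: h2]. Qed.
Lemma cont_opp a b (phi : R -> C) : cont_on a b phi -> cont_on a b (fun t => - phi t : C).
Proof. by move=> h1 t tab; apply: cvgN; exact: h1. Qed.

Lemma complexP (z w : C) : Rp z = Rp w -> Ip z = Ip w -> z = w.
Proof. by case: z w => a b [c d] /= -> ->. Qed.

Lemma RpM (z w : C) : Rp (z * w) = Rp z * Rp w - Ip z * Ip w.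
Proof. by case: z w => a b [c d]. Qed.
Lemma IpM (z w : C) : Ip (z * w) = Rp z * Ip w + Ip z * Rp w.
Proof. by case: z w => a b [c d]. Qed.
Lemma RpD (z w : C) : Rp (z + w) = Rp z + Rp w.
Proof. by case: z w => a b [c d]. Qed.
Lemma IpD (z w : C) : Ip (z + w) = Ip z + Ip w.
Proof. by case: z w => a b [c d]. Qed.

Lemma Ip_cint a b (phi : R -> C) : Ip (cint a b phi) = rint a b (fun t => Ip (phi t)).
Proof. by []. Qed.

Lemma RpJ (z : C) : Rp (z^*)%C = Rp z. Proof. by case: z. Qed.
Lemma IpJ (z : C) : Ip (z^*)%C = - Ip z. Proof. by case: z. Qed.

Lemma eq_cint a b (phi psi : R -> C) : (forall t, a <= t <= b -> phi t = psi t) ->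
  cint a b phi = cint a b psi.
Proof.
by move=> h; rewrite /cint; congr Complex; apply: eq_rint => t /h ->.
Qed.

Lemma cintD a b (phi psi : R -> C) : cont_on a b phi -> cont_on a b psi ->
  cint a b (fun t => phi t + psi t) = cint a b phi + cint a b psi.
Proof.
move=> h1 h2; apply: complexP; rewrite ?RpD ?IpD /cint/=.
  by rewrite -rintD; [apply: eq_rint => t _; rewrite RpD|exact: cont_Rp..].
by rewrite -rintD; [apply: eq_rint => t _; rewrite IpD|exact: cont_Ip..].
Qed.

Lemma cintZ a b (k : C) (phi : R -> C) : cont_on a b phi ->
  cint a b (fun t => k * phi t) = k * cint a b phi.
Proof.
move=> h; have h1 := cont_Rp h; have h2 := cont_Ip h.
have hz j psi : cont_on a b psi -> cont_on a b (fun t => j * psi t).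
  by move=> hp t tab; apply: cvgM; [exact: cvg_cst|exact: hp].
apply: complexP; rewrite ?RpM ?IpM /cint/=.
  rewrite -!rintZ// -rintB; [|exact: hz..].
  by apply: eq_rint => t _; rewrite RpM.
rewrite -!rintZ// -rintD; [|exact: hz..].
by apply: eq_rint => t _; rewrite IpM.
Qed.

Lemma cintB a b (phi psi : R -> C) : cont_on a b phi -> cont_on a b psi ->
  cint a b (fun t => phi t - psi t) = cint a b phi - cint a b psi.
Proof.
move=> h1 h2; rewrite (cintD h1 (cont_opp h2)).
congr (_ + _); rewrite -[RHS]mulN1r -cintZ//.
by apply: eq_cint => t _; rewrite mulN1r.
Qed.

Lemma cint_conj a b (phi : R -> C) : cont_on a b phi ->
  cint a b (fun t => (phi t)^*%C : C) = ((cint a b phi)^*)%C.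
Proof.
move=> h.
have e1 : rint a b (fun t => Rp (phi t)^*%C) = rint a b (fun t => Rp (phi t)).
  by apply: eq_rint => t _; rewrite RpJ.
have e2 : rint a b (fun t => Ip (phi t)^*%C) = - rint a b (fun t => Ip (phi t)).
  rewrite -mulN1r -rintZ; last exact: cont_Ip.
  by apply: eq_rint => t _; rewrite IpJ mulN1r.
by rewrite /cint e1 e2.
Qed.

(** The factor 2, which comes from estimating real and imaginary parts
    separately, is harmless for all the uses below. *)
Lemma cint_norm a b (phi : R -> C) : cont_on a b phi ->
  nrm (cint a b phi) <= 2 * rint a b (fun t => nrm (phi t)).
Proof.
move=> h; apply: le_trans (nrm_leD _) _; rewrite mulr2n mulrDl !mul1r.
have hn := cont_nrm h.
have cR := cont_Rp h; have cI := cont_Ip h.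
have cn (psi : R -> R) : cont_on a b psi -> cont_on a b (fun t => `|psi t|).
  by move=> hp t tab; apply: cvg_norm; exact: hp.
apply: lerD; (apply: le_trans; first by apply: le_normr_Rintegral => //;
  exact: rint_integrable); apply: rint_le => //; try exact: cn.
- by move=> t _; exact: normRp_le.
- by move=> t _; exact: normIp_le.
Qed.

Lemma cint_bound a b (phi : R -> C) B : a <= b -> cont_on a b phi ->
  (forall t, a <= t <= b -> nrm (phi t) <= B) ->
  nrm (cint a b phi) <= 2 * (B * (b - a)).
Proof.
move=> ab h hB; apply: le_trans (cint_norm h) _; rewrite ler_wpM2l//.
rewrite -rint_cst//; apply: rint_le => //; first exact: cont_nrm.
exact: cont_cst_on.
Qed.

Lemma cint_cst a b (k : C) : a <= b -> cint a b (fun=> k) = k * ((b - a)%:C)%C.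
Proof.
by move=> ab; apply: complexP; rewrite ?RpM ?IpM /cint/= !rint_cst// mulr0 ?subr0 ?add0r.
Qed.

End RealIntegrals.

(** * Bisection of rectangles *)

Section Bisection.
Context {R : realType}.
Implicit Types (a b c d x y : R).

Let rect := (R * R * (R * R))%type.

(** Compactness of a rectangle, as an induction principle: a property of
    rectangles that is inherited when two rectangles are glued along a side,
    and that holds for the small rectangles around any point with the
    proportions of the big one, holds for the big one. Otherwise repeated
    halving leaves at each stage a quarter without the property, and the
    quarters shrink to a point. Besides Goursat's theorem it yields the
    finiteness of closed discrete subsets of a disc, and identity theorems
    along segments. *)
Lemma bisection (P : R -> R -> R -> R -> Prop) a b c d :
  a <= b -> c <= d ->
  (forall a' m b' c' d', a <= a' -> a' <= m <= b' -> b' <= b ->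
     c <= c' -> c' <= d' -> d' <= d ->
     P a' m c' d' -> P m b' c' d' -> P a' b' c' d') ->
  (forall a' b' c' m d', a <= a' -> a' <= b' -> b' <= b ->
     c <= c' -> c' <= m <= d' -> d' <= d ->
     P a' b' c' m -> P a' b' m d' -> P a' b' c' d') ->
  (forall x y, a <= x <= b -> c <= y <= d -> exists2 e : R, 0 < e &
     forall a' b' c' d', a <= a' -> a' <= x <= b' -> b' <= b ->
       c <= c' -> c' <= y <= d' -> d' <= d ->
       b' - a' < e -> d' - c' < e ->
       (b' - a') * (d - c) = (d' - c') * (b - a) -> P a' b' c' d') ->
  P a b c d.
Proof.
move=> ab cd Hx Hy Hloc; apply: contrapT => nP.
pose Q (u : rect) := let: (a', b', (c', d')) := u in P a' b' c' d'.
pose sub (u v : rect) := [/\ v.1.1 <= u.1.1, u.1.2 <= v.1.2, v.2.1 <= u.2.1 & u.2.2 <= v.2.2].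
pose half (u v : rect) := u.1.2 - u.1.1 = (v.1.2 - v.1.1) / 2 /\
  u.2.2 - u.2.1 = (v.2.2 - v.2.1) / 2.
pose good (u : rect) := [/\ ~ Q u, u.1.1 <= u.1.2, u.2.1 <= u.2.2 & sub u (a, b, (c, d))].
have step (u : rect) : {v | good u -> [/\ good v, sub v u & half v u]}.
  apply: cid; have [gu|] := EM (good u); last by exists u.
  suff [v h] : exists v, [/\ good v, sub v u & half v u] by exists v.
  move: u gu => [[a' b'] [c' d']] [/= nQ ab' cd' [/= h1 h2 h3 h4]].
  apply: contrapT => /forallNP nv.
  pose m := (a' + b') / 2; pose n := (c' + d') / 2.
  have am : a' <= m <= b' by rewrite /m; apply/andP; split; lra.
  have cn : c' <= n <= d' by rewrite /n; apply/andP; split; lra.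
  have ma : m - a' = (b' - a') / 2 by rewrite /m; field.
  have mb : b' - m = (b' - a') / 2 by rewrite /m; field.
  have nc : n - c' = (d' - c') / 2 by rewrite /n; field.
  have nd : d' - n = (d' - c') / 2 by rewrite /n; field.
  move/andP: (am) => [am1 am2]; move/andP: (cn) => [cn1 cn2].
  have key a1 b1 c1 d1 : a' <= a1 -> b1 <= b' -> c' <= c1 -> d1 <= d' ->
      b1 - a1 = (b' - a') / 2 -> d1 - c1 = (d' - c') / 2 -> P a1 b1 c1 d1.
    move=> k1 k2 k3 k4 k5 k6; apply: contrapT => nP1.
    apply: (nv (a1, b1, (c1, d1))); split; split => //=; try lra.
    by split => /=; lra.
  apply: nQ; apply: (Hx a' m b') => //.
    apply: (Hy _ _ c' n d') => //; [exact: le_trans am2 h2|exact: key..].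
  apply: (Hy _ _ c' n d') => //; [exact: le_trans h1 am1|exact: key..].
(* the nested rectangles; their corners converge by completeness *)
pose s := fix s n : rect := if n is n'.+1 then projT1 (step (s n')) else (a, b, (c, d)).
have gs n : good (s n).
  elim: n => [|n IH]; first by split => //; split => /=.
  by rewrite /=; case: (step (s n)) => v /= /(_ IH) [].
have ss n : sub (s n.+1) (s n).
  by rewrite [s n.+1]/=; case: (step (s n)) => v /= /(_ (gs n)) [].
have hs n : half (s n.+1) (s n).
  by rewrite [s n.+1]/=; case: (step (s n)) => v /= /(_ (gs n)) [].
have sub_refl u : sub u u by split.
have sub_trans u v w : sub u v -> sub v w -> sub u w.
  by move=> [? ? ? ?] [? ? ? ?]; split; lra.
have sn n k : sub (s (n + k)%N) (s n).
  by elim: k => [|k IH]; [rewrite addn0|rewrite addnS; apply: sub_trans (ss _) IH].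
have wid n : (s n).1.2 - (s n).1.1 = (b - a) / 2 ^+ n /\
    (s n).2.2 - (s n).2.1 = (d - c) / 2 ^+ n.
  elim: n => [|n [IH1 IH2]]; first by rewrite expr0 !divr1.
  have [-> ->] := hs n; rewrite IH1 IH2 exprS invfM; split; rewrite -!mulrA; congr (_ * _);
  by rewrite mulrC.
have le12 n m : (s n).1.1 <= (s m).1.2 /\ (s n).2.1 <= (s m).2.2.
  have [nm|/ltnW nm] := leqP n m.
    have [h1 h2 h3 h4] := sn n (m - n)%N; move: h1 h2 h3 h4; rewrite subnKC// => h1 h2 h3 h4.
    have [_ k1 k2 _] := gs m; split; lra.
  have [h1 h2 h3 h4] := sn m (n - m)%N; move: h1 h2 h3 h4; rewrite subnKC// => h1 h2 h3 h4.
  have [_ k1 k2 _] := gs n; split; lra.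
pose X := [set (s n).1.1 | n in setT]; pose Y := [set (s n).2.1 | n in setT].
have X0 : X !=set0 by exists (s 0%N).1.1, 0%N.
have Y0 : Y !=set0 by exists (s 0%N).2.1, 0%N.
have Xn n : (s n).1.1 <= sup X <= (s n).1.2.
  apply/andP; split.
    apply: ub_le_sup; last by exists n.
    by exists (s 0%N).1.2 => _ [m _ <-]; have [] := le12 m 0%N.
  by apply: ge_sup => // _ [m _ <-]; have [] := le12 m n.
have Yn n : (s n).2.1 <= sup Y <= (s n).2.2.
  apply/andP; split.
    apply: ub_le_sup; last by exists n.
    by exists (s 0%N).2.2 => _ [m _ <-]; have [] := le12 m 0%N.
  by apply: ge_sup => // _ [m _ <-]; have [] := le12 m n.
have [e e0 he] := Hloc (sup X) (sup Y) (Xn 0%N) (Yn 0%N).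
have small w : 0 <= w -> exists N, forall n, (N <= n)%N -> w / 2 ^+ n < e.
  move=> w0; have we : 0 <= w / e by rewrite divr_ge0// ltW.
  exists (Num.bound (w / e)) => n Nn.
  rewrite ltr_pdivrMr ?exprn_gt0// mulrC -ltr_pdivrMr//.
  apply: lt_le_trans (archi_boundP we) _; rewrite -natrX ler_nat.
  by apply: leq_trans Nn _; exact/ltnW/ltn_expl.
have [N1 hN1] := small (b - a) ltac:(lra).
have [N2 hN2] := small (d - c) ltac:(lra).
pose n := maxn N1 N2.
have [w1 w2] := wid n; have [nQ g1 g2 [/= g3 g4 g5 g6]] := gs n.
have xn := Xn n; have yn := Yn n.
apply: nQ; case E : (s n) => [[a' b'] [c' d']]; rewrite E /= in w1 w2 g3 g4 g5 g6 xn yn.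
apply: he => //.
- by rewrite w1 hN1// leq_maxl.
- by rewrite w2 hN2// leq_maxr.
- by rewrite w1 w2; ring.
Qed.

End Bisection.

(** * Goursat's theorem *)

Section Goursat.
Context {R : realType}.
Implicit Types (a b c d x y : R).

(** U and V are the real and imaginary parts of a complex function of x + i y,
    and the hypothesis is its complex differentiability with derivative A + i
    B. The left-hand side is the imaginary part of the integral along the
    boundary. A function that is linear up to an error e contributes at most e
    times the area on a small rectangle of fixed proportions, and such bounds
    add up under subdivision. *)
Lemma goursat (U V : R -> R -> R) a b c d : a < b -> c < d ->
  (forall x y, a <= x <= b -> c <= y <= d -> exists A B : R, forall e : R, 0 < e ->
    exists2 r : R, 0 < r & forall x' y', `|x' - x| < r -> `|y' - y| < r ->
     `|U x' y' - U x y - (A * (x' - x) - B * (y' - y))| <= e * (`|x' - x| + `|y' - y|) /\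
     `|V x' y' - V x y - (B * (x' - x) + A * (y' - y))| <= e * (`|x' - x| + `|y' - y|)) ->
  rint c d (U b) - rint c d (U a) + rint a b (V ^~ c) - rint a b (V ^~ d) = 0.
Proof.
move=> ab cd H.
have cont (f : R -> R) (x K : R) : (exists2 r : R, 0 < r & forall x', `|x' - x| < r ->
    `|f x' - f x| <= K * `|x' - x|) -> {for x, continuous f}.
  move=> [r r0 h]; apply/cvgRP => e e0; apply/nearRP.
  have K1 : 0 < `|K| + 1 by rewrite ltr_wpDl.
  exists (Num.min r (e / (`|K| + 1))); first by rewrite lt_min r0 divr_gt0.
  move=> y; rewrite lt_min => /andP[yr ye]; apply: le_lt_trans (h _ yr) _.
  apply: (@le_lt_trans _ _ ((`|K| + 1) * `|y - x|)).
    by rewrite ler_wpM2r// (le_trans (ler_norm _))// lerDl.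
  by rewrite mulrC -ltr_pdivlMr.
have cU x y : a <= x <= b -> c <= y <= d -> {for y, continuous (U x)}.
  move=> hx hy; have [A [B h]] := H _ _ hx hy; have [r r0 hr] := h 1 ltr01.
  apply: (cont _ _ (1 + `|B|)); exists r => // y' yr.
  have [] := hr x y'; rewrite ?subrr ?normr0// mulr0 !add0r mul1r => h1 _.
  rewrite mulrDl mul1r -normrM -[X in _ <= _ + X]normrN; apply: le_trans (lerD h1 (lexx _)).
  by apply: le_trans (ler_normD _ _); rewrite subrK.
have cV x y : a <= x <= b -> c <= y <= d -> {for x, continuous (V ^~ y)}.
  move=> hx hy; have [A [B h]] := H _ _ hx hy; have [r r0 hr] := h 1 ltr01.
  apply: (cont _ _ (1 + `|B|)); exists r => // y' yr.
  have [] := hr y' y; rewrite ?subrr ?normr0// !(mulr0, addr0) mul1r => _ h1.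
  rewrite mulrDl mul1r -normrM; apply: le_trans (lerD h1 (lexx _)).
  by apply: le_trans (ler_normD _ _); rewrite subrK.
pose I a b c d := rint c d (U b) - rint c d (U a) + rint a b (V ^~ c) - rint a b (V ^~ d).
suff main (e : R) : 0 < e -> `|I a b c d| <= e * ((b - a) * (d - c)).
  rewrite -/(I a b c d); apply/eqP; rewrite -normr_le0; apply/ler_addgt0Pl => e e0.
  have S0 : 0 < (b - a) * (d - c) by rewrite mulr_gt0// subr_gt0.
  by rewrite addr0; apply: le_trans (main (e / ((b - a) * (d - c))) _) _;
    rewrite ?divr_gt0// divfK// gt_eqF.
move=> e0; apply: (@bisection R (fun a b c d => `|I a b c d| <= e * ((b - a) * (d - c))) a b c d);
  [exact: ltW..| | |].
- move=> a' m b' c' d' h1 h2 h3 h4 h5 h6 k1 k2.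
  have -> : I a' b' c' d' = I a' m c' d' + I m b' c' d'.
    rewrite /I (@rint_split _ a' m b' (V ^~ c'))//; last first.
      by move=> t ht; apply: cV; lra.
    rewrite (@rint_split _ a' m b' (V ^~ d'))//; last first.
      by move=> t ht; apply: cV; lra.
    by ring.
  apply: le_trans (ler_normD _ _) _; apply: le_trans (lerD k1 k2) _.
  by rewrite le_eqVlt; apply/orP; left; apply/eqP; ring.
- move=> a' b' c' m d' h1 h2 h3 h4 h5 h6 k1 k2.
  have -> : I a' b' c' d' = I a' b' c' m + I a' b' m d'.
    rewrite /I (@rint_split _ c' m d' (U a'))//; last first.
      by move=> t ht; apply: cU; lra.
    rewrite (@rint_split _ c' m d' (U b'))//; last first.
      by move=> t ht; apply: cU; lra.
    by ring.
  apply: le_trans (ler_normD _ _) _; apply: le_trans (lerD k1 k2) _.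
  by rewrite le_eqVlt; apply/orP; left; apply/eqP; ring.
move=> x y hx hy; have [A [B h]] := H _ _ hx hy.
(* e1 is chosen so that the errors on the four sides, 2 e1 (w + l)^2 in total,
   are at most e w l when l = k w *)
pose k := (d - c) / (b - a).
have k0 : 0 < k by rewrite divr_gt0// subr_gt0.
pose e1 := e * k / (4 * (1 + k) ^+ 2).
have e10 : 0 < e1.
  by rewrite divr_gt0// mulr_gt0// exprn_gt0// addr_gt0.
have [r r0 hr] := h _ e10; exists r => //.
move=> a' b' c' d' h1 h2 h3 h4 h5 h6 wr hr' ratio.
set w := b' - a' in wr ratio *; set l := d' - c' in hr' ratio *.
have lE : l = k * w.
  rewrite /k; apply: (@mulIf _ (b - a)); first by rewrite gt_eqF// subr_gt0.
  by rewrite -ratio mulrC; field; rewrite gt_eqF// subr_gt0.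
have w0 : 0 <= w by rewrite /w; lra.
have l0 : 0 <= l by rewrite /l; lra.
have est x' y' : a' <= x' <= b' -> c' <= y' <= d' ->
   `|U x' y' - U x y - (A * (x' - x) - B * (y' - y))| <= e1 * (w + l) /\
   `|V x' y' - V x y - (B * (x' - x) + A * (y' - y))| <= e1 * (w + l).
  move=> hx' hy'.
  have hh1 : `|x' - x| <= w by rewrite /w ler_norml; apply/andP; split; lra.
  have hh2 : `|y' - y| <= l by rewrite /l ler_norml; apply/andP; split; lra.
  have [E1 E2] := hr x' y' (le_lt_trans hh1 wr) (le_lt_trans hh2 hr').
  by split; (apply: le_trans; [exact: E1 || exact: E2|rewrite ler_pM2l// lerD]).
have inX t : a' <= t <= b' -> a <= t <= b.
  by move=> /andP[t1 t2]; rewrite (le_trans h1 t1) (le_trans t2 h3).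
have inY t : c' <= t <= d' -> c <= t <= d.
  by move=> /andP[t1 t2]; rewrite (le_trans h4 t1) (le_trans t2 h6).
have ab' : a' <= b' by rewrite -subr_ge0.
have cd' : c' <= d' by rewrite -subr_ge0.
have [xa xb] : a <= a' <= b /\ a <= b' <= b by split; apply: inX; rewrite lexx ab'.
have [yc yd] : c <= c' <= d /\ c <= d' <= d by split; apply: inY; rewrite lexx cd'.
have I1 : `|rint c' d' (U b') - rint c' d' (U a') - A * w * l| <= 2 * (e1 * (w + l)) * l.
  rewrite -rintB; [|by move=> t /inY; exact: cU xb|by move=> t /inY; exact: cU xa].
  apply: rint_near; first exact: cd'.
    by move=> t /inY ht; apply: cvgB; [exact: cU xb ht|exact: cU xa ht].
  move=> t ht; have [E1 _] := est b' t (introT andP (conj ab' (lexx _))) ht.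
  have [E2 _] := est a' t (introT andP (conj (lexx _) ab')) ht.
  have -> : U b' t - U a' t - A * w = (U b' t - U x y - (A * (b' - x) - B * (t - y))) -
     (U a' t - U x y - (A * (a' - x) - B * (t - y))) by rewrite /w; ring.
  by apply: le_trans (ler_normB _ _) _; lra.
have I2 : `|rint a' b' (V ^~ c') - rint a' b' (V ^~ d') - (- A * l) * w| <= 2 * (e1 * (w + l)) * w.
  rewrite -rintB; [|by move=> t /inX ht; exact: cV ht yc|by move=> t /inX ht; exact: cV ht yd].
  apply: rint_near; first exact: ab'.
    by move=> t /inX ht; apply: cvgB; [exact: cV ht yc|exact: cV ht yd].
  move=> t ht; have [_ E1] := est t c' ht (introT andP (conj (lexx _) cd')).
  have [_ E2] := est t d' ht (introT andP (conj cd' (lexx _))).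
  have -> : V t c' - V t d' - - A * l = (V t c' - V x y - (B * (t - x) + A * (c' - y))) -
     (V t d' - V x y - (B * (t - x) + A * (d' - y))) by rewrite /l; ring.
  by apply: le_trans (ler_normB _ _) _; lra.
have -> : I a' b' c' d' = (rint c' d' (U b') - rint c' d' (U a') - A * w * l) +
   (rint a' b' (V ^~ c') - rint a' b' (V ^~ d') - (- A * l) * w) by rewrite /I; ring.
apply: le_trans (ler_normD _ _) _; apply: le_trans (lerD I1 I2) _.
have -> : 2 * (e1 * (w + l)) * l + 2 * (e1 * (w + l)) * w = 2 * e1 * (w + l) ^+ 2 by ring.
rewrite lE.
have -> : 2 * e1 * (w + k * w) ^+ 2 = e * (w * (k * w)) / 2.
  by rewrite /e1; field; rewrite gt_eqF// addr_gt0.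
by rewrite ler_pdivrMr// ler_peMr ?ler1n// mulr_ge0 ?(ltW e0)// mulr_ge0// mulr_ge0// ltW.
Qed.

End Goursat.

(** * Holomorphic functions and the exponential map *)

Section Holomorphic.
Context {R : realType}.
Local Notation C := (Cplane R).
Implicit Types (z w : C) (f g : C -> C).

Definition hol f z := derivable f z (1 : C).

Lemma hol_cont f z : hol f z -> {for z, continuous f}.
Proof. exact: derivable_cont. Qed.

Lemma hol_cst (k : C) z : hol (fun=> k) z.
Proof. exact: derivable_cst. Qed.

Lemma hol_id z : hol (fun w => w) z.
Proof. exact: derivable_id. Qed.

Arguments hol_cst : clear implicits.
Arguments hol_id : clear implicits.

Lemma holD f g z : hol f z -> hol g z -> hol (fun w => f w + g w) z.
Proof. exact: derivableD. Qed.

Lemma holB f g z : hol f z -> hol g z -> hol (fun w => f w - g w) z.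
Proof. exact: derivableB. Qed.

Lemma holM f g z : hol f z -> hol g z -> hol (fun w => f w * g w) z.
Proof. exact: derivableM. Qed.

Lemma holV f z : f z != 0 -> hol f z -> hol (fun w => (f w)^-1) z.
Proof. exact: derivableV. Qed.

Lemma holX f n z : hol f z -> hol (fun w => f w ^+ n) z.
Proof.
move=> h; elim: n => [|n IH].
  have -> : (fun w => f w ^+ 0) = (fun=> (1 : C)) by apply/funext => w; exact: expr0.
  exact: hol_cst.
have -> : (fun w => f w ^+ n.+1) = (fun w => f w * f w ^+ n).
  by apply/funext => w; exact: exprS.
exact: holM.
Qed.

Lemma hol_sub (a : C) z : hol (fun w => w - a) z.
Proof. by apply: holB; [exact: hol_id|exact: hol_cst]. Qed.

Lemma hol_subX (a : C) n z : hol (fun w => (w - a) ^+ n) z.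
Proof. by apply: holX; exact: hol_sub. Qed.

Lemma cdiff_comp f g w (L M : C) : cdiff g w M -> cdiff f (g w) L ->
  cdiff (fun u => f (g u)) w (L * M).
Proof.
move=> hg hf e e0.
have K0 : 0 < nrm L + nrm M + 1 by rewrite ltr_wpDl// addr_ge0// nrm_ge0.
pose e1 := Num.min 1 (e / (nrm L + nrm M + 1)).
have e10 : 0 < e1 by rewrite lt_min ltr01 divr_gt0.
have [d1 d10 h1] := hg _ e10; have [d2 d20 h2] := hf _ e10.
have M1 : 0 < nrm M + 1 by rewrite ltr_wpDl// nrm_ge0.
exists (Num.min d1 (d2 / (nrm M + 1))); first by rewrite lt_min d10 divr_gt0.
move=> h; rewrite lt_min => /andP[hd1 hd2].
have E1 := h1 _ hd1; set k := g (w + h) - g w in E1 *.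
have kh : nrm k <= (nrm M + 1) * nrm h.
  have -> : k = (k - M * h) + M * h by rewrite subrK.
  apply: le_trans (nrmD _ _) _; rewrite mulrDl mul1r nrmM [X in _ <= X]addrC lerD2r.
  apply: le_trans E1 _; rewrite ler_piMl ?nrm_ge0// /e1.
  by rewrite ge_min lexx.
have kd : nrm k < d2.
  by apply: le_lt_trans kh _; rewrite mulrC -ltr_pdivlMr.
have E2 := h2 _ kd; rewrite [g w + k]addrC subrK in E2.
have -> : f (g (w + h)) - f (g w) - L * M * h =
    (f (g (w + h)) - f (g w) - L * k) + L * (k - M * h).
  by ring.
apply: le_trans (nrmD _ _) _; rewrite nrmM.
apply: (@le_trans _ _ (e1 * ((nrm M + 1) * nrm h) + nrm L * (e1 * nrm h))).
  apply: lerD; first by apply: le_trans E2 _; rewrite ler_wpM2l// ltW.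
  by rewrite ler_wpM2l// nrm_ge0.
have -> : e1 * ((nrm M + 1) * nrm h) + nrm L * (e1 * nrm h) =
  e1 * (nrm L + nrm M + 1) * nrm h by ring.
rewrite ler_wpM2r ?nrm_ge0// -ler_pdivlMr//.
by rewrite /e1 ge_min lexx orbT.
Qed.

Lemma hol_comp f g z : hol g z -> hol f (g z) -> hol (fun u => f (g u)) z.
Proof.
move=> /derivable_cdiff hg /derivable_cdiff hf.
exact: cdiff_derivable (cdiff_comp hg hf).
Qed.

Lemma cdiff_near f g w (L : C) : (\forall u \near w, f u = g u) ->
  cdiff f w L -> cdiff g w L.
Proof.
move=> /nearCP [r r0 fg] hf e e0; have [d d0 hd] := hf _ e0.
exists (Num.min r d); first by rewrite lt_min r0.
move=> h; rewrite lt_min => /andP[hr hd']; rewrite -!fg ?subrr ?nrm0//; first exact: hd.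
by rewrite addrC addKr.
Qed.

Lemma hol_near f g w : (\forall u \near w, f u = g u) -> hol f w -> hol g w.
Proof. by move=> h /derivable_cdiff /(cdiff_near h); exact: cdiff_derivable. Qed.

Definition rdiff (f : R -> R) x l := forall e : R, 0 < e ->
  exists2 d : R, 0 < d & forall h, `|h| < d ->
    `|f (x + h) - f x - l * h| <= e * `|h|.

Lemma rdiffP (f : R -> R) x l : is_derive x (1 : R) f l <-> rdiff f x l.
Proof.
split=> [[df <-] e e0|h].
  move: df => /cvg_ex [l' hl].
  have lE : 'D_1 f x = l' by apply/cvg_lim.
  move/cvgRP: hl => /(_ _ e0); rewrite near_withinE => /nearRP [d d0 hd].
  exists d => // k kd; have [->|k0] := eqVneq k 0.
    by rewrite addr0 subrr mulr0 subrr normr0 mulr0.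
  have := hd k; rewrite subr0 => /(_ kd k0) /ltW.
  have -> : k *: 1 = k by rewrite /GRing.scale /= mulr1.
  have -> : f (x + k) - f x - 'D_1 f x * k = (k^-1 *: (f (k + x) - f x) - l') * k.
    by rewrite lE mulrBl /GRing.scale /= mulrAC mulVf// mul1r addrC [x + k]addrC addrC.
  by rewrite normrM => ?; rewrite ler_wpM2r.
have H : (fun k : R => k^-1 *: (f (k *: 1 + x) - f x)) @ 0^' --> l.
  apply/cvgRP => e e0; have e2 : 0 < e / 2 by rewrite divr_gt0.
  rewrite near_withinE; apply/nearRP; have [d d0 hd] := h _ e2; exists d => // k; rewrite subr0 => kd k0.
  have -> : k *: 1 = k by rewrite /GRing.scale /= mulr1.
  have -> : k^-1 *: (f (k + x) - f x) - l = (f (x + k) - f x - l * k) / k.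
    by rewrite mulrBl mulfK// /GRing.scale /= mulrC [x + k]addrC.
  rewrite normrM normfV ltr_pdivrMr ?normr_gt0//; apply: le_lt_trans (hd _ kd) _.
  by rewrite ltr_pM2r ?normr_gt0// ltr_pdivrMr// ltr_pMr// ltr1n.
apply: DeriveDef; first by apply/cvg_ex; exists l.
exact/cvg_lim.
Qed.

Lemma RpB (z w : C) : Rp (z - w) = Rp z - Rp w.
Proof. by case: z w => a b [c d]. Qed.
Lemma IpB (z w : C) : Ip (z - w) = Ip z - Ip w.
Proof. by case: z w => a b [c d]. Qed.
Lemma RpZ (a : R) (z : C) : Rp (a%:C%C * z) = a * Rp z.
Proof. by case: z => c d /=; rewrite mul0r subr0. Qed.
Lemma IpZ (a : R) (z : C) : Ip (a%:C%C * z) = a * Ip z.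
Proof. by case: z => c d /=; rewrite mul0r addr0. Qed.

(** Real parts suffice: the imaginary part of f is the real part of -i f. *)
Lemma rdiff_line_Rp f a v (t : R) (L : C) : cdiff f (a + t%:C%C * v) L ->
  rdiff (fun t : R => Rp (f (a + t%:C%C * v))) t (Rp (L * v)).
Proof.
move=> hf e e0; have v1 : 0 < nrm v + 1 by rewrite ltr_wpDl// nrm_ge0.
have [d d0 hd] := hf (e / (nrm v + 1)) (divr_gt0 e0 v1).
exists (d / (nrm v + 1)); first by rewrite divr_gt0.
move=> h hh; have hv : nrm (h%:C%C * v : C) <= `|h| * (nrm v + 1).
  by rewrite nrmM nrm_real ler_wpM2l// lerDl.
have := hd (h%:C%C * v); rewrite -RpB [Rp (L * v) * h]mulrC -RpZ -RpB.
have -> : a + (t + h)%:C%C * v = a + t%:C%C * v + h%:C%C * v.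
  by rewrite rmorphD/= mulrDl addrA.
move=> H; apply: le_trans (normRp_le _) _.
have -> : h%:C%C * (L * v) = L * (h%:C%C * v) :> C by rewrite mulrCA.
apply: le_trans (H _) _; first by apply: le_lt_trans hv _; rewrite -ltr_pdivlMr.
apply: (@le_trans _ _ (e / (nrm v + 1) * (`|h| * (nrm v + 1)))).
  by rewrite ler_wpM2l// ltW// divr_gt0.
by rewrite mulrCA divfK ?gt_eqF// mulrC.
Qed.

(** The exponential is built from the parametrization of circles, so that
    horizontal and vertical lines correspond to rays and circles without any
    conversion. *)
Definition cexp (u : C) : C := circle_pt (expR (Rp u)) (Ip u).

Lemma cexpD u v : cexp (u + v) = cexp u * cexp v.
Proof.
case: u v => a b [c d]; rewrite /cexp /circle_pt /= expRD cosD sinD.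
by apply: complexP => /=; ring.
Qed.

Lemma cexp0 : cexp 0 = 1.
Proof. by rewrite /cexp /circle_pt /= expR0 cos0 sin0 mulr1 mulr0. Qed.

Lemma nrm_cexp u : nrm (cexp u) = expR (Rp u).
Proof. by rewrite nrm_circle_pt ger0_norm// expR_ge0. Qed.

(** With h = x + i y, expand exp x = 1 + x + al, cos y = 1 + be, sin y = y +
    ga, where al, be, ga are of size e1 |h|, and collect the error terms. *)
Lemma cdiff_cexp0 : cdiff cexp 0 1.
Proof.
move=> e e0.
have [e1 [e10 e11 e1e]] : exists e1 : R, [/\ 0 < e1, e1 <= 1 & e1 <= e / 10].
  by exists (Num.min 1 (e / 10)); rewrite lt_min !ge_min ltr01 !lexx orbT divr_gt0.
have /rdiffP/(_ _ e10)[d1 d10 h1] := @is_derive_expR R 0.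
have /rdiffP/(_ _ e10)[d2 d20 h2] := @is_derive_cos R 0.
have /rdiffP/(_ _ e10)[d3 d30 h3] := @is_derive_sin R 0.
exists (Num.min (Num.min d1 d2) (Num.min d3 e1)).
  by rewrite !lt_min d10 d20 d30 e10.
move=> h; rewrite !lt_min => /andP[/andP[hd1 hd2] /andP[hd3 hd4]].
have hR := normRp_le h; have hI := normIp_le h; have hn := nrm_ge0 h.
have := h1 _ (le_lt_trans hR hd1); have := h2 _ (le_lt_trans hI hd2).
have := h3 _ (le_lt_trans hI hd3).
rewrite !(add0r, cos0, sin0, expR0, oppr0, mul0r, addr0, mul1r, cexp0).
move=> A3 A2 A1.
apply: le_trans (nrm_leD _) _; rewrite !(RpB, IpB) /cexp /circle_pt /=.
set x := Rp h in A1 hR *; set y := Ip h in A2 A3 hI *.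
set al := expR x - 1 - x in A1; set be := cos y - 1 in A2.
set ga := sin y - y in A3.
have -> : expR x * cos y - 1 - x = al + be * (1 + x + al) by rewrite /al /be; ring.
have -> : expR x * sin y - 0 - y = (x + al) * y + (1 + x + al) * ga.
  by rewrite /al /ga; ring.
have xe : `|x| <= e1 by apply: le_trans hR (ltW hd4).
have ye : `|y| <= e1 by apply: le_trans hI (ltW hd4).
have al1 : `|al| <= e1 * nrm h by apply: le_trans A1 _; rewrite ler_pM2l.
have be1 : `|be| <= e1 * nrm h by apply: le_trans A2 _; rewrite ler_pM2l.
have ga1 : `|ga| <= e1 * nrm h by apply: le_trans A3 _; rewrite ler_pM2l.
have he : nrm h <= 1 by apply: le_trans (ltW hd4) _.
have al2 : `|al| <= e1 by apply: le_trans al1 _; rewrite ler_piMr// ltW.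
have k1 : `|1 + x + al| <= 3.
  apply: le_trans (ler_normD _ _) _; apply: le_trans (lerD (ler_normD _ _) (lexx _)) _.
  by rewrite normr1; lra.
have k2 : `|x + al| <= 2 * e1 by apply: le_trans (ler_normD _ _) _; lra.
apply: (@le_trans _ _ (9 * e1 * nrm h)); last first.
  by rewrite ler_wpM2r//; lra.
have t1 : `|al + be * (1 + x + al)| <= e1 * nrm h + e1 * nrm h * 3.
  apply: le_trans (ler_normD _ _) _; rewrite normrM lerD//.
  by apply: ler_pM.
have t2 : `|(x + al) * y + (1 + x + al) * ga| <= 2 * e1 * nrm h + 3 * (e1 * nrm h).
  apply: le_trans (ler_normD _ _) _; rewrite !normrM.
  by apply: lerD; apply: ler_pM.
by apply: le_trans (lerD t1 t2) _; lra.
Qed.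

Lemma cdiff_cexp u : cdiff cexp u (cexp u).
Proof.
move=> e e0; have c0 : 0 < nrm (cexp u) by rewrite nrm_cexp expR_gt0.
have [d d0 hd] := cdiff_cexp0 (divr_gt0 e0 c0).
exists d => // h /hd; rewrite cexp0 add0r mul1r => H.
have -> : cexp (u + h) - cexp u - cexp u * h = cexp u * (cexp h - 1 - h).
  by rewrite cexpD; ring.
by rewrite nrmM mulrC -ler_pdivlMr// mulrAC.
Qed.

End Holomorphic.
Arguments hol_cst {R} k z.
Arguments hol_id {R} z.

(** * Means over circles and Cauchy's formula *)

Section CircleAverages.
Context {R : realType}.
Local Notation C := (Cplane R).
Implicit Types (z w : C) (r s : R).

Definition cont_circ (T : topologicalType) (F : C -> T) r :=
  forall z, nrm z = r -> {for z, continuous F}.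

(** Mean values over the circle of radius r centred at 0, for real and for
    complex functions. The value at radius 0 is the value at the centre. *)
Definition avg (F : C -> R) r : R :=
  (2 * pi)^-1 * rint 0 (2 * pi) (fun t => F (circle_pt r t)).

Definition cavg (F : C -> C) r : C :=
  (((2 * pi)^-1)%:C)%C * cint 0 (2 * pi) (fun t => F (circle_pt r t)).

Lemma twopi_gt0 : 0 < 2 * pi :> R. Proof. by rewrite mulr_gt0// pi_gt0. Qed.
Lemma twopi_ge0 : 0 <= 2 * pi :> R. Proof. exact: ltW twopi_gt0. Qed.
Hint Resolve twopi_gt0 twopi_ge0 : core.

Lemma cont_circ_on (T : topologicalType) (F : C -> T) r a b : 0 <= r ->
  cont_circ F r -> cont_on a b (fun t => F (circle_pt r t)).
Proof.
move=> r0 h t _; apply: continuous_comp; first exact: circle_pt_cont.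
by apply: h; rewrite nrm_circle_pt ger0_norm.
Qed.

Lemma cont_circ_cst (T : topologicalType) (k : T) r : cont_circ (fun=> k) r.
Proof. by move=> z _; exact: cst_continuous. Qed.

Lemma contM (F G : C -> C) z : {for z, continuous F} -> {for z, continuous G} ->
  {for z, continuous (fun z => F z * G z : C)}.
Proof. by move=> a b; exact: (cvgM a b). Qed.

Lemma cont_circM (F G : C -> C) r : cont_circ F r -> cont_circ G r ->
  cont_circ (fun z => F z * G z : C) r.
Proof. by move=> a b z zr; apply: contM; [exact: a|exact: b]. Qed.

Lemma cont_circZ (k : C) (F : C -> C) r : cont_circ F r ->
  cont_circ (fun z => k * F z : C) r.
Proof. by apply: cont_circM; exact: cont_circ_cst. Qed.

Lemma cont_circ_hol (F : C -> C) r : (forall z, nrm z = r -> hol F z) -> cont_circ F r.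
Proof. by move=> h z /h; exact: hol_cont. Qed.

Section fixr.
Variable r : R.
Hypothesis r0 : 0 <= r.

Lemma eq_avg (F G : C -> R) : (forall z, nrm z = r -> F z = G z) -> avg F r = avg G r.
Proof.
move=> h; congr (_ * _); apply: eq_rint => t _; apply: h.
by rewrite nrm_circle_pt ger0_norm.
Qed.

Lemma avgD (F G : C -> R) : cont_circ F r -> cont_circ G r ->
  avg (fun z => F z + G z) r = avg F r + avg G r.
Proof. by move=> h1 h2; rewrite /avg rintD ?mulrDr//; exact: cont_circ_on. Qed.

Lemma avgZ (F : C -> R) k : cont_circ F r ->
  avg (fun z => k * F z) r = k * avg F r.
Proof. by move=> h1; rewrite /avg rintZ; [exact: mulrCA|exact: cont_circ_on]. Qed.

Lemma avgB (F G : C -> R) : cont_circ F r -> cont_circ G r ->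
  avg (fun z => F z - G z) r = avg F r - avg G r.
Proof. by move=> h1 h2; rewrite /avg rintB ?mulrBr//; exact: cont_circ_on. Qed.

Lemma avg_cst (k : R) : avg (fun=> k) r = k.
Proof. by rewrite /avg rint_cst// subr0 mulrCA mulVf ?mulr1// gt_eqF. Qed.

Lemma avg_le (F G : C -> R) : cont_circ F r -> cont_circ G r ->
  (forall z, nrm z = r -> F z <= G z) -> avg F r <= avg G r.
Proof.
move=> h1 h2 h; rewrite ler_pM2l ?invr_gt0//; apply: rint_le; try exact: cont_circ_on.
by move=> t _; apply: h; rewrite nrm_circle_pt ger0_norm.
Qed.

Lemma avg_ge0 (F : C -> R) : (forall z, nrm z = r -> 0 <= F z) -> 0 <= avg F r.
Proof.
move=> h; rewrite mulr_ge0 ?invr_ge0//; apply: rint_ge0 => t _; apply: h.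
by rewrite nrm_circle_pt ger0_norm.
Qed.

Lemma cont_circ_sum (I : Type) (s : seq I) (F : I -> C -> R) :
  (forall i, cont_circ (F i) r) -> cont_circ (fun z => \sum_(i <- s) F i z) r.
Proof.
move=> h; elim: s => [|i s IH] z zr.
  have -> : (fun z => \sum_(i <- [::]) F i z) = (fun=> 0).
    by apply/funext => u; rewrite big_nil.
  exact: cst_continuous.
have -> : (fun z => \sum_(i <- i :: s) F i z) = (fun z => F i z + \sum_(i <- s) F i z).
  by apply/funext => u; rewrite big_cons.
have a := h i z zr; have b := IH z zr; exact: (cvgD a b).
Qed.

Lemma avg_sum (I : Type) (s : seq I) (F : I -> C -> R) :
  (forall i, cont_circ (F i) r) ->
  avg (fun z => \sum_(i <- s) F i z) r = \sum_(i <- s) avg (F i) r.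
Proof.
move=> h; elim: s => [|i s IH].
  rewrite big_nil -[RHS]avg_cst; apply: eq_avg => z _; by rewrite big_nil.
rewrite big_cons -IH -avgD//; last exact: cont_circ_sum.
by apply: eq_avg => z _; rewrite big_cons.
Qed.

Lemma eq_cavg (F G : C -> C) : (forall z, nrm z = r -> F z = G z) -> cavg F r = cavg G r.
Proof.
move=> h; congr (_ * _); apply: eq_cint => t _; apply: h.
by rewrite nrm_circle_pt ger0_norm.
Qed.

Lemma cavgD (F G : C -> C) : cont_circ F r -> cont_circ G r ->
  cavg (fun z => F z + G z) r = cavg F r + cavg G r.
Proof. by move=> h1 h2; rewrite /cavg cintD ?mulrDr//; exact: cont_circ_on. Qed.

Lemma cavgB (F G : C -> C) : cont_circ F r -> cont_circ G r ->
  cavg (fun z => F z - G z) r = cavg F r - cavg G r.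
Proof. by move=> h1 h2; rewrite /cavg cintB ?mulrBr//; exact: cont_circ_on. Qed.

Lemma cavgZ (F : C -> C) (k : C) : cont_circ F r ->
  cavg (fun z => k * F z) r = k * cavg F r.
Proof.
by move=> h1; rewrite /cavg (cintZ k (cont_circ_on r0 h1)); exact: mulrCA.
Qed.

Lemma cavg_cst (k : C) : cavg (fun=> k) r = k.
Proof.
rewrite /cavg cint_cst// subr0 mulrCA -rmorphM/= mulVf ?mulr1// gt_eqF//.
Qed.

Lemma Rp_cavg (F : C -> C) : Rp (cavg F r) = avg (fun z => Rp (F z)) r.
Proof. by rewrite /cavg RpZ. Qed.

Lemma cavg_conj (F : C -> C) : cont_circ F r ->
  cavg (fun z => (F z)^*%C) r = ((cavg F r)^*)%C.
Proof.
move=> h; rewrite /cavg (cint_conj (cont_circ_on r0 h)).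
set u := cint _ _ _; case: u => a b /=.
by apply: complexP => /=; rewrite ?oppr0; ring.
Qed.

Lemma cavg_norm (F : C -> C) : cont_circ F r ->
  nrm (cavg F r) <= 2 * avg (fun z => nrm (F z)) r.
Proof.
move=> h; rewrite /cavg nrmM nrm_real ger0_norm ?invr_ge0// mulrCA.
by rewrite ler_pM2l ?invr_gt0//; apply: cint_norm; exact: cont_circ_on.
Qed.

Lemma cavg_bound (F : C -> C) B : cont_circ F r ->
  (forall z, nrm z = r -> nrm (F z) <= B) -> nrm (cavg F r) <= 2 * B.
Proof.
move=> h hB; apply: le_trans (cavg_norm h) _; rewrite ler_pM2l// -[leRHS]avg_cst.
apply: avg_le => //; last exact: cont_circ_cst.
by move=> z /h cz; exact: (cvgnrm cz).
Qed.
End fixr.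

Lemma cavg0 (F : C -> C) : cavg F 0 = F 0.
Proof.
rewrite -[RHS](cavg_cst 0); apply: eq_cavg => // z /eqP; rewrite nrm_eq0.
by move=> /eqP ->.
Qed.

(** In the coordinate u = log z the annulus becomes a rectangle of height 2 pi
    whose horizontal sides carry the same values, so that Goursat's theorem
    compares the two vertical sides. *)
Lemma avg_annulus (F : C -> C) s1 s2 : 0 < s1 -> s1 < s2 ->
  (forall z, s1 <= nrm z <= s2 -> hol F z) ->
  avg (fun z => Rp (F z)) s1 = avg (fun z => Rp (F z)) s2.
Proof.
move=> s10 s12 hF; have s20 := lt_trans s10 s12.
pose G u := F (cexp u).
pose U x y := Rp (F (circle_pt (expR x) y)); pose V x y := Ip (F (circle_pt (expR x) y)).
have l12 : ln s1 < ln s2 by rewrite ltr_ln.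
have := @goursat R U V (ln s1) (ln s2) 0 (2 * pi) l12 twopi_gt0.
rewrite /U /V !lnK//.
have -> : rint (ln s1) (ln s2) (fun x => Ip (F (circle_pt (expR x) (2 * pi)))) =
    rint (ln s1) (ln s2) (fun x => Ip (F (circle_pt (expR x) 0))).
  by apply: eq_rint => t _; rewrite circle_pt2pi.
rewrite addrK => H; apply/eqP; rewrite eq_sym -subr_eq0 /avg -mulrBr H ?mulr0//.
move=> x y hx hy.
have hz : hol F (cexp (x +i* y)%C).
  apply: hF; rewrite nrm_cexp /=; case/andP: hx => h1 h2.
  by rewrite -[s1]lnK// -[s2]lnK// !ler_expR h1 h2.
have [L hL] : exists L, cdiff G (x +i* y)%C L.
  exists ('D_1 F (cexp (x +i* y)%C) * cexp (x +i* y)%C).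
  exact: cdiff_comp (@cdiff_cexp R _) (derivable_cdiff hz).
exists (Rp L), (Ip L) => e e0; have [d d0 hd] := hL _ e0.
exists (d / 2); first by rewrite divr_gt0.
move=> x' y' hx' hy'.
have hn : nrm ((x' - x) +i* (y' - y))%C <= `|x' - x| + `|y' - y| := nrm_leD _.
have := hd ((x' - x) +i* (y' - y))%C.
have -> : ((x +i* y)%C : C) + ((x' - x) +i* (y' - y))%C = (x' +i* y')%C.
  by apply: complexP => /=; ring.
move=> /(_ (le_lt_trans hn _)) H1.
have {}H1 := H1 ltac:(lra).
have {}H1 := le_trans H1 (ler_wpM2l (ltW e0) hn).
split.
  by apply: le_trans H1; apply: le_trans (normRp_le _); rewrite !RpB RpM.
by apply: le_trans H1; apply: le_trans (normIp_le _); rewrite !IpB IpM /= [X in _ - X]addrC.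
Qed.

Lemma cavg_annulus (F : C -> C) s1 s2 : 0 < s1 -> s1 < s2 ->
  (forall z, s1 <= nrm z <= s2 -> hol F z) -> cavg F s1 = cavg F s2.
Proof.
move=> s10 s12 hF; apply: complexP; first by rewrite !Rp_cavg; exact: avg_annulus.
(* opaque, so that - i does not reduce inside the integrals *)
have [k kE] : exists k : C, k = (- 'i)%C by exists (- 'i)%C.
have E s : Ip (cavg F s) = avg (fun z => Rp (k * F z)) s.
  rewrite /cavg IpZ; congr (_ * _); apply: eq_rint => t _.
  by rewrite RpM kE /=; ring.
rewrite (E s1) (E s2); apply: (@avg_annulus (fun z => k * F z) s1 s2 s10 s12).
by move=> z /hF hz; exact: (holM (hol_cst k z) hz).
Qed.

(** Uniformity in the angle is compactness of [0, 2 pi] applied to the joint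
    continuity of the parametrization in radius and angle. *)
Lemma circ_unif (F : C -> C) s (e : R) : 0 <= s -> 0 < e -> cont_circ F s ->
  exists2 d : R, 0 < d & forall s', `|s' - s| < d -> forall t, 0 <= t <= 2 * pi ->
    nrm (F (circle_pt s' t) - F (circle_pt s t)) <= e.
Proof.
move=> s0 e0 cF; have /compact_near_coveringP K := @segment_compact R 0 (2 * pi).
have := K R (nbhs s) (fun s' t => nrm (F (circle_pt s' t) - F (circle_pt s t)) <= e) _.
case.
  move=> t _; have e2 : 0 < e / 2 by rewrite divr_gt0.
  have cz : {for circle_pt s t, continuous F}.
    by apply: cF; rewrite nrm_circle_pt ger0_norm.
  have A1 : (circle_pt p.2 p.1 : C) @[p --> (t, s)] --> (circle_pt s t : C).
    by apply: circle_pt_cont2; [exact: cvg_snd|exact: cvg_fst].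
  have B1 : (circle_pt s p.1 : C) @[p --> (t, s)] --> (circle_pt s t : C).
    by apply: circle_pt_cont2; [exact: cvg_cst|exact: cvg_fst].
  have A := cvg_comp _ _ A1 cz; have B := cvg_comp _ _ B1 cz.
  move/cvgCP : A => /(_ _ e2) A; move/cvgCP : B => /(_ _ e2) B.
  near=> p.
  have -> : F (circle_pt p.2 p.1) - F (circle_pt s p.1) = (F (circle_pt p.2 p.1) - F (circle_pt s t)) -
    (F (circle_pt s p.1) - F (circle_pt s t)) by ring.
  apply: le_trans (nrmB _ _) _; rewrite [e]splitr; apply/ltW/ltrD; near: p; [exact: A|exact: B].
move=> d /= d0 hd; exists d => // s' hs t ht; apply: hd.
  by rewrite /= distrC.
by rewrite /= in_itv/=.
Unshelve. all: by end_near. Qed.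

Lemma cavg_cont (F : C -> C) s (e : R) : 0 <= s -> 0 < e -> cont_circ F s ->
  exists2 d : R, 0 < d & forall s', 0 <= s' -> `|s' - s| < d -> cont_circ F s' ->
    nrm (cavg F s' - cavg F s) <= e.
Proof.
move=> s0 e0 cF; have e2 : 0 < e / 2 by rewrite divr_gt0.
have [d d0 hd] := circ_unif s0 e2 cF; exists d => // s' s'0 ss cF'.
rewrite /cavg -mulrBr -cintB; [|exact: cont_circ_on..].
rewrite nrmM nrm_real ger0_norm ?invr_ge0// ler_pdivrMl//.
apply: le_trans (cint_bound _ _ (hd _ ss)) _ => //.
  by apply: cont_add; [exact: cont_circ_on|apply: cont_opp; exact: cont_circ_on].
by rewrite subr0 le_eqVlt; apply/orP; left; apply/eqP; field.
Qed.

Lemma nrm_eps (z w : C) : (forall e : R, 0 < e -> nrm (z - w) <= e) -> z = w.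
Proof.
move=> h; apply/eqP; rewrite -subr_eq0 -nrm_eq0 eq_le nrm_ge0 andbT.
by apply/ler_addgt0Pl => e /h; rewrite addr0.
Qed.

(** A point w where F is only known to be continuous does no harm, wherever it
    lies: the mean is constant below and above the radius |w| and it is a
    continuous function of the radius. *)
Lemma cavg_center (F : C -> C) s w : 0 <= s ->
  (forall z, nrm z <= s -> {for z, continuous F}) ->
  (forall z, nrm z <= s -> z != w -> hol F z) ->
  cavg F s = F 0.
Proof.
move=> s0 cF hF.
have cc r : r <= s -> cont_circ F r by move=> rs z zr; apply: cF; rewrite zr.
have off r1 r2 : 0 < r1 -> r1 < r2 -> r2 <= s -> ~ (r1 <= nrm w <= r2) ->
    cavg F r1 = cavg F r2.
  move=> r10 r12 r2s nw; apply: cavg_annulus => // z /andP[h1 h2]; apply: hF.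
    exact: le_trans h2 _.
  by apply/eqP => zw; apply: nw; rewrite -zw h1 h2.
have low r2 : 0 < nrm w -> nrm w < r2 -> r2 <= s -> cavg F (nrm w) = cavg F r2.
  move=> w0 wr rs; apply: nrm_eps => e e0.
  have [d d0 hd] := cavg_cont (ltW w0) e0 (cc (nrm w) (le_trans (ltW wr) rs)).
  pose r1 := Num.min (nrm w + d / 2) r2.
  have r1w : nrm w < r1 by rewrite lt_min wr andbT ltrDl divr_gt0.
  have r12 : r1 <= r2 by rewrite ge_min lexx orbT.
  have -> : cavg F r2 = cavg F r1.
    move: r12; rewrite le_eqVlt => /predU1P[->//|r12].
    by apply/esym/off => //; [lra|move=> /andP[]; lra].
  rewrite nrmBC; apply: hd; [lra| |by apply: cc; lra].
  by rewrite gtr0_norm ?subr_gt0// /r1 ltrBlDl gt_min ltrD2l; apply/orP; left; lra.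
have up r1 : 0 < r1 -> r1 < nrm w -> nrm w <= s -> cavg F r1 = cavg F (nrm w).
  move=> r10 rw ws; apply: nrm_eps => e e0.
  have [d d0 hd] := cavg_cont (nrm_ge0 w) e0 (cc _ ws).
  pose r2 := Num.max (nrm w - d / 2) r1.
  have r2w : r2 < nrm w by rewrite gt_max rw andbT; lra.
  have r12 : r1 <= r2 by rewrite le_max lexx orbT.
  have -> : cavg F r1 = cavg F r2.
    move: r12; rewrite le_eqVlt => /predU1P[<-//|r12].
    by apply: off => //; [lra|move=> /andP[]; lra].
  apply: hd; [lra| |by apply: cc; lra].
  rewrite distrC gtr0_norm ?subr_gt0// /r2 ltrBlDr -ltrBlDl lt_max.
  by apply/orP; left; lra.
have all r1 r2 : 0 < r1 -> r1 < r2 -> r2 <= s -> cavg F r1 = cavg F r2.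
  move=> r10 r12 r2s; have [h1|h1] := ltP (nrm w) r1.
    by apply: off => //; move=> /andP[]; lra.
  have [h2|h2] := ltP r2 (nrm w).
    by apply: off => //; move=> /andP[]; lra.
  have w0 : 0 < nrm w by lra.
  transitivity (cavg F (nrm w)).
    by move: h1; rewrite le_eqVlt => /predU1P[->//|h1]; apply: up => //; lra.
  by move: h2; rewrite le_eqVlt => /predU1P[->//|h2]; apply: low.
rewrite -cavg0; move: s0; rewrite le_eqVlt => /predU1P[<-//|s0].
apply: nrm_eps => e e0.
have [d d0 hd] := cavg_cont (lexx 0) e0 (cc 0 (ltW s0)).
pose r1 := Num.min (d / 2) s.
have r10 : 0 < r1 by rewrite lt_min s0 divr_gt0.
have -> : cavg F s = cavg F r1.
  have : r1 <= s by rewrite ge_min lexx orbT.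
  by rewrite le_eqVlt => /predU1P[->//|r1s]; apply/esym/all.
apply: hd; [exact: ltW| |by apply: cc; rewrite ge_min lexx orbT].
by rewrite subr0 gtr0_norm// gt_min; apply/orP; left; lra.
Qed.

Lemma mean_value (F : C -> C) s : 0 <= s -> (forall z, nrm z <= s -> hol F z) ->
  cavg F s = F 0.
Proof.
move=> s0 h; apply: (@cavg_center F s 0 s0) => z zs; first exact: hol_cont (h _ zs).
by move=> _; exact: (h z zs).
Qed.

Lemma nrm_lt_neq z w r : nrm z = r -> nrm w < r -> z - w != 0.
Proof.
by move=> zr wr; rewrite subr_eq0; apply/eqP => zw; move: wr; rewrite -zr zw ltxx.
Qed.

Lemma conj_mul z : z * z^*%C = ((nrm z ^+ 2)%:C)%C.
Proof.
rewrite nrm_sqr; case: z => a b; apply: complexP => /=; ring.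
Qed.

(** The pole of this function is the reflection of w in the circle of radius
    s, which lies outside the closed disc. *)
Lemma hol_reflected s w z : nrm w < s -> nrm z <= s ->
  hol (fun z => (((s ^+ 2)%:C)%C - w^*%C * z)^-1) z.
Proof.
move=> ws zs; have s0 : 0 < s by apply: le_lt_trans ws; exact: nrm_ge0.
apply: holV; last by apply: holB; [exact: hol_cst|apply: holM; [exact: hol_cst|exact: hol_id]].
rewrite -nrm_gt0; apply: lt_le_trans (nrm_lerB _ _).
rewrite nrm_real nrmM nrmJ ger0_norm ?sqr_ge0// subr_gt0 expr2.
apply: (@le_lt_trans _ _ (nrm w * s)); first by rewrite ler_wpM2l// nrm_ge0.
by rewrite ltr_pM2r.
Qed.

(** On the circle |z| = s the conjugate of z / (z - w) coincides with the
    function s^2 / (s^2 - w^* z), which is holomorphic on the closed disc with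
    value 1 at the centre. *)
Lemma cauchy_kernel s w : nrm w < s -> cavg (fun z => z / (z - w)) s = 1.
Proof.
move=> ws; have s0 : 0 < s by apply: le_lt_trans ws; exact: nrm_ge0.
have h z : nrm z <= s -> hol (fun z => ((s ^+ 2)%:C)%C / (((s ^+ 2)%:C)%C - w^*%C * z)) z.
  by move=> zs; apply: holM; [exact: hol_cst|exact: hol_reflected].
have M := mean_value (ltW s0) h.
rewrite mulr0 subr0 divff in M; last first.
  by rewrite -nrm_eq0 nrm_real normr_eq0 expf_neq0// gt_eqF.
have -> : 1 = (1 : C)^*%C by rewrite conjc1.
rewrite -[in RHS]M -cavg_conj; [|exact: ltW|by move=> z zs; apply: hol_cont; apply: h; rewrite zs].
apply: eq_cavg; first exact: ltW.
move=> z zs; rewrite -zs -conj_mul rmorphM/= conjc_inv rmorphB/= !rmorphM/= !conjcK.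
have z0 : z != 0 by rewrite -nrm_gt0 zs.
have zw := nrm_lt_neq zs ws.
have zz : z^*%C != 0 by rewrite -nrm_eq0 nrmJ nrm_eq0.
have -> : z^*%C * z - w * z^*%C = (z - w) * z^*%C by ring.
by field; rewrite zz.
Qed.

(** The function z (g z - g w) / (z - w) vanishes at 0 and is continuous at w,
    so its mean is 0. Splitting the quotient leaves the mean of z / (z -
    w). *)
Lemma cauchy_formula (g : C -> C) s w : nrm w < s -> (forall z, nrm z <= s -> hol g z) ->
  g w = cavg (fun z => g z * (z / (z - w))) s.
Proof.
move=> ws hg; have s0 : 0 <= s by apply/ltW/(le_lt_trans _ ws)/nrm_ge0.
have hw := derivable_cdiff (hg _ (ltW ws)).
move: ('D_1 g w : C) hw => L hw.
(* the removable singularity at w is filled with the derivative L *)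
pose F z := if z == w then w * L else z * ((g z - g w) / (z - w)).
have Fn z : z != w -> F z = z * ((g z - g w) / (z - w)).
  by rewrite /F => /negbTE ->.
have hF z : nrm z <= s -> z != w -> hol F z.
  move=> zs zw; apply: (@hol_near _ (fun z => z * ((g z - g w) / (z - w)))).
    apply/nearCP; exists (nrm (z - w)); first by rewrite nrm_gt0 subr_eq0.
    move=> u uz; rewrite Fn//; apply/eqP => uw; move: uz.
    by rewrite uw nrmBC ltxx.
  apply: holM; first exact: hol_id.
  apply: holM; first by apply: holB; [exact: hg|exact: hol_cst].
  apply: holV; first by rewrite subr_eq0.
  exact: hol_sub.
have cF z : nrm z <= s -> {for z, continuous F}.
  move=> zs; have [->|zw] := eqVneq z w; last by apply: hol_cont; exact: hF.
  suff H : (if z == w then L else (g z - g w) / (z - w)) @[z --> w] --> L.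
    have FE : F = (fun z => z * (if z == w then L else (g z - g w) / (z - w))).
      by apply/funext => u; rewrite /F; case: eqP => // ->.
    by rewrite FE /prop_for /continuous_at eqxx; exact: (cvgM (@cvg_id _ (nbhs w)) H).
  apply: (proj2 (@cvgCP R C (nbhs w) _ _ L)) => e e0.
  have [d d0 hd] := hw (e / 2) ltac:(lra).
  apply/nearCP; exists d => // u ud; have [_|uw] := eqVneq u w.
    by rewrite subrr nrm0.
  have uw0 : u - w != 0 by rewrite subr_eq0.
  have H := hd (u - w) ud; have {}H : nrm (g u - g w - L * (u - w)) <= e / 2 * nrm (u - w).
    by move: H; have -> : w + (u - w) = u by ring.
  have -> : (g u - g w) / (u - w) - L = (g u - g w - L * (u - w)) / (u - w).
    by field.
  rewrite nrmM nrmV ltr_pdivrMr ?nrm_gt0//; apply: le_lt_trans H _.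
  by rewrite ltr_pM2r ?nrm_gt0//; lra.
have := cavg_center s0 cF hF.
have -> : F 0 = 0 by rewrite /F; case: eqP => [<-|_]; rewrite mul0r.
have c1 : cont_circ (fun z => z / (z - w)) s.
  move=> z zs; apply: hol_cont; apply: holM; first exact: hol_id.
  apply: holV; first exact: nrm_lt_neq zs ws.
  exact: hol_sub.
have c2 : cont_circ (fun z => g z * (z / (z - w))) s.
  apply: cont_circM c1; apply: cont_circ_hol => z zs.
  by apply: hg; rewrite zs.
have -> : cavg F s = cavg (fun z => g z * (z / (z - w)) - g w * (z / (z - w))) s.
  apply: eq_cavg => // z zs; rewrite Fn; last by rewrite -subr_eq0 (nrm_lt_neq zs ws).
  by ring.
rewrite (cavgB s0 c2 (cont_circZ (k := g w) c1)) (cavgZ s0 _ c1) cauchy_kernel// mulr1.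
by move=> /eqP; rewrite subr_eq0 => /eqP.
Qed.

End CircleAverages.
Arguments cont_circ_cst {R T} k r.

(** * Cauchy transforms and Taylor expansions *)

Section CauchyTransform.
Context {R : realType}.
Local Notation C := (Cplane R).
Implicit Types (z w : C) (r s : R).

Lemma circ_bounded (F : C -> R) s : 0 <= s -> cont_circ F s ->
  exists2 B, 0 <= B & forall z, nrm z = s -> F z <= B.
Proof.
move=> s0 cF; have pp : - pi <= pi :> R by rewrite ge0_cp// pi_ge0.
have [t _ ht] := EVT_max pp (cont_on_within (@cont_circ_on R _ F s (-pi) pi s0 cF)).
exists `|F (circle_pt s t)| => // z zs; have [u hu ->] := circle_ptE z.
rewrite zs; apply: le_trans (ler_norm _); apply: ht.
by rewrite in_itv.
Qed.

Lemma circ_bounded_nrm (F : C -> C) s : 0 <= s -> cont_circ F s ->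
  exists2 B, 0 <= B & forall z, nrm z = s -> nrm (F z) <= B.
Proof.
by move=> s0 cF; apply: circ_bounded => // z zs; exact: (cvgnrm (cF z zs)).
Qed.

(** Differentiation under the integral sign; the quadratic bound on the
    remainder replaces any uniform continuity argument. *)
Lemma cint_param a b (K : R -> C -> C) (K' : R -> C) w (r M : R) : a <= b -> 0 < r ->
  (forall h, nrm h < r -> cont_on a b (fun t => K t (w + h))) -> cont_on a b K' ->
  (forall t h, a <= t <= b -> nrm h < r ->
     nrm (K t (w + h) - K t w - h * K' t) <= M * nrm h ^+ 2) ->
  cdiff (fun w => cint a b (fun t => K t w)) w (cint a b K').
Proof.
move=> ab r0 cK cK' H e e0.
have cK0 : cont_on a b (fun t => K t w).
  by have := cK 0; rewrite nrm0 addr0; apply.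
have M0 : 0 < 2 * (b - a) * `|M| + 1.
  by rewrite ltr_wpDl// mulr_ge0// mulr_ge0// subr_ge0.
exists (Num.min r (e / (2 * (b - a) * `|M| + 1))); first by rewrite lt_min r0 divr_gt0.
move=> h; rewrite lt_min => /andP[hr he].
rewrite -(cintB (cK _ hr) cK0).
have c1 : cont_on a b (fun t => h * K' t : C).
  exact: (cont_mul (@cont_cst_on R _ a b (h : C)) cK').
have c2 := cont_add (cK _ hr) (cont_opp cK0).
rewrite [_ * h]mulrC -(cintZ h cK') -(cintB c2 c1).
apply: (@le_trans _ _ (2 * (`|M| * nrm h ^+ 2 * (b - a)))).
  apply: (cint_bound ab (cont_add c2 (cont_opp c1))).
  move=> t ht; apply: le_trans (H _ _ ht hr) _.
  by rewrite ler_wpM2r ?sqr_ge0// ler_norm.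
have -> : 2 * (`|M| * nrm h ^+ 2 * (b - a)) = (2 * (b - a) * `|M|) * nrm h * nrm h by ring.
rewrite ler_wpM2r ?nrm_ge0//.
have hn := nrm_ge0 h.
apply: (@le_trans _ _ ((2 * (b - a) * `|M| + 1) * nrm h)).
  by rewrite ler_wpM2r// lerDl.
by rewrite mulrC -ler_pdivlMr// ltW.
Qed.

Lemma cavg_param (K : C -> C -> C) (K' : C -> C) s w (r M : R) : 0 <= s -> 0 < r ->
  (forall h, nrm h < r -> cont_circ (fun z => K z (w + h)) s) -> cont_circ K' s ->
  (forall z h, nrm z = s -> nrm h < r ->
     nrm (K z (w + h) - K z w - h * K' z) <= M * nrm h ^+ 2) ->
  cdiff (fun w => cavg (fun z => K z w) s) w (cavg K' s).
Proof.
move=> s0 r0 cK cK' H.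
have D := @cint_param 0 (2 * pi) (fun t => K (circle_pt s t)) (fun t => K' (circle_pt s t)) w r M
  (@twopi_ge0 R) r0 (fun h hr => @cont_circ_on R _ _ s _ _ s0 (cK h hr)) (@cont_circ_on R _ _ s _ _ s0 cK').
have {}D : cdiff (fun w => cint 0 (2 * pi) (fun t => K (circle_pt s t) w)) w
    (cint 0 (2 * pi) (fun t => K' (circle_pt s t))).
  by apply: D => t h _ hr; apply: H => //; rewrite nrm_circle_pt ger0_norm.
move=> e e0; have [d d0 hd] := D _ e0; exists d => // h /hd.
rewrite /cavg; move: (cint _ _ _) (cint _ _ _) (cint _ _ _) => x y u.
set k : C := (((2 * pi)^-1)%:C)%C.
have -> : k * u - k * y - k * x * h = k * (u - y - x * h) by ring.
rewrite nrmM => H1; apply: le_trans H1.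
rewrite -[leRHS]mul1r ler_wpM2r ?nrm_ge0// /k nrm_real ger0_norm ?invr_ge0 ?twopi_ge0//.
rewrite invf_le1 ?twopi_gt0//; have := @pi_ge2 R; lra.
Qed.

Lemma nrm_quot (a b c d : C) :
  nrm (a * b / (c * d)) = nrm a * nrm b / (nrm c * nrm d).
Proof. by rewrite nrmM nrmM nrmV nrmM. Qed.

Section transform.
Variables (phi : C -> C) (s : R).
Hypotheses (s0 : 0 < s) (cphi : cont_circ phi s).

(** The Cauchy transform of phi, up to the constant 2 pi i, and the expected
    formula for its derivative. The measure is the angular one, so Cauchy's
    formula has phi(z) = g(z) z. *)
Definition cauchy_tr w := cavg (fun z => phi z / (z - w)) s.
Definition cauchy_tr2 w := cavg (fun z => phi z / (z - w) ^+ 2) s.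

Lemma cont_ker n w : nrm w < s -> cont_circ (fun z => phi z / (z - w) ^+ n) s.
Proof.
move=> ws; apply: (cont_circM cphi); apply: cont_circ_hol => z zs.
apply: holV; first by rewrite expf_neq0// (nrm_lt_neq zs ws).
exact: hol_subX.
Qed.

Lemma cont_ker1 w : nrm w < s -> cont_circ (fun z => phi z / (z - w)) s.
Proof. by move=> ws; exact: (cont_ker (n := 1) ws). Qed.

Lemma ker_dist z w s1 : nrm z = s -> nrm w <= s1 -> s1 < s ->
  (s - s1 <= nrm (z - w)) * (z - w != 0).
Proof.
move=> zs ws s1s; have h : s - s1 <= nrm (z - w).
  by apply: le_trans (nrm_lerB _ _); rewrite zs lerD2l lerN2.
by split => //; rewrite -nrm_gt0 (lt_le_trans _ h)// subr_gt0.
Qed.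

Variable B : R.
Hypothesis (hB : forall z, nrm z = s -> nrm (phi z) <= B).

(** By direct computation the remainder is phi(z) h^2 / ((z - w)^2 (z - w -
    h)). *)
Lemma ker_quad z w h s1 : nrm z = s -> s1 < s -> nrm w <= s1 -> nrm (w + h) <= s1 ->
  nrm (phi z / (z - (w + h)) - phi z / (z - w) - h * (phi z / (z - w) ^+ 2))
  <= B / (s - s1) ^+ 3 * nrm h ^+ 2.
Proof.
move=> zs s1s ws ws'.
have [d1 n1] := ker_dist zs ws s1s; have [d2 n2] := ker_dist zs ws' s1s.
have ss : 0 < s - s1 by rewrite subr_gt0.
have -> : phi z / (z - (w + h)) - phi z / (z - w) - h * (phi z / (z - w) ^+ 2) =
  phi z * h ^+ 2 / ((z - w) ^+ 2 * (z - (w + h))) by field; rewrite n1 n2.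
rewrite nrm_quot !nrmX mulrAC ler_wpM2r ?sqr_ge0//.
rewrite ler_pM ?nrm_ge0 ?hB// ?invr_ge0 ?mulr_ge0 ?exprn_ge0 ?nrm_ge0//.
rewrite lef_pV2 ?posrE ?mulr_gt0 ?exprn_gt0 ?nrm_gt0//.
rewrite exprSr ler_pM ?exprn_ge0 ?(ltW ss)//.
by rewrite ler_pXn2r ?nnegrE ?(ltW ss) ?nrm_ge0.
Qed.

Lemma ctr_quad w h s1 : s1 < s -> nrm w <= s1 -> nrm (w + h) <= s1 ->
  nrm (cauchy_tr (w + h) - cauchy_tr w - h * cauchy_tr2 w) <= 2 * (B / (s - s1) ^+ 3 * nrm h ^+ 2).
Proof.
move=> s1s ws ws'; have ss := ltW s0.
have c1 := cont_ker1 (le_lt_trans ws s1s); have c2 := cont_ker1 (le_lt_trans ws' s1s).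
have c3 := cont_ker (n := 2) (le_lt_trans ws s1s).
have c4 := cont_circZ (k := h) c3.
have c5 : cont_circ (fun z => phi z / (z - (w + h)) - phi z / (z - w) : C) s.
  by move=> z zs; exact: (cvgB (c2 z zs) (c1 z zs)).
rewrite /cauchy_tr /cauchy_tr2 -(cavgZ ss h c3) -(cavgB ss c2 c1) -(cavgB ss c5 c4).
apply: cavg_bound; [by []| |].
  by move=> z zs; exact: (cvgB (cvgB (c2 z zs) (c1 z zs)) (c4 z zs)).
by move=> z zs; apply: ker_quad.
Qed.

Lemma ctr2_bound w s1 : s1 < s -> nrm w <= s1 ->
  nrm (cauchy_tr2 w) <= 2 * (B / (s - s1) ^+ 2).
Proof.
move=> s1s ws; apply: cavg_bound; [exact: ltW|exact: cont_ker (le_lt_trans ws s1s)|].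
have ss : 0 < s - s1 by rewrite subr_gt0.
move=> z zs; have [d1 n1] := ker_dist zs ws s1s.
rewrite nrmM nrmV nrmX ler_pM ?nrm_ge0 ?hB// ?invr_ge0 ?exprn_ge0 ?nrm_ge0//.
rewrite lef_pV2 ?posrE ?exprn_gt0 ?nrm_gt0//.
by rewrite ler_pXn2r ?nnegrE ?(ltW ss) ?nrm_ge0.
Qed.

Lemma cdiff_ctr w : nrm w < s -> cdiff cauchy_tr w (cauchy_tr2 w).
Proof.
move=> ws; pose s1 := (nrm w + s) / 2.
have s1s : s1 < s by rewrite /s1; lra.
have ws1 : nrm w < s1 by rewrite /s1; lra.
have hs h : nrm h < s1 - nrm w -> nrm (w + h) <= s1.
  by move=> hh; apply: le_trans (nrmD _ _) _; lra.
apply: (@cavg_param (fun z w => phi z / (z - w)) _ s w (s1 - nrm w) (B / (s - s1) ^+ 3)).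
- exact: ltW.
- by rewrite subr_gt0.
- by move=> h /hs hh; apply: cont_ker1; exact: le_lt_trans hh s1s.
- exact: cont_ker.
- by move=> z h zs /hs hh; apply: ker_quad => //; exact: ltW.
Qed.

(** Same computation one order higher. The numerator 3 (z - w) - 2 h is at
    most 10 s. *)
Lemma hol_ctr2 w : nrm w < s -> hol cauchy_tr2 w.
Proof.
move=> ws; pose s1 := (nrm w + s) / 2.
have s1s : s1 < s by rewrite /s1; lra.
have ws1 : nrm w < s1 by rewrite /s1; lra.
have ss : 0 < s - s1 by rewrite subr_gt0.
have hs h : nrm h < s1 - nrm w -> nrm (w + h) <= s1.
  by move=> hh; apply: le_trans (nrmD _ _) _; lra.
apply: cdiff_derivable; apply: (@cavg_param (fun z w => phi z / (z - w) ^+ 2)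
  (fun z => 2 * (phi z / (z - w) ^+ 3)) s w (s1 - nrm w) (B * (3 * (2 * s) + 2 * (2 * s)) / (s - s1) ^+ 5)).
- exact: ltW.
- by rewrite subr_gt0.
- by move=> h /hs hh; apply: cont_ker; exact: le_lt_trans hh s1s.
- apply: cont_circZ; exact: cont_ker.
- move=> z h zs hh'; have hh := hs _ hh'.
have [d1 n1] := ker_dist zs (ltW ws1) s1s; have [d2 n2] := ker_dist zs hh s1s.
have -> : phi z / (z - (w + h)) ^+ 2 - phi z / (z - w) ^+ 2 - h * (2 * (phi z / (z - w) ^+ 3)) =
  phi z * (3 * (z - w) - 2 * h) * h ^+ 2 / ((z - w) ^+ 3 * (z - (w + h)) ^+ 2) by field; rewrite n1 n2.
rewrite nrm_quot !nrmX mulrAC ler_wpM2r ?sqr_ge0//.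
rewrite ler_pM ?mulr_ge0 ?nrm_ge0 ?hB// ?invr_ge0 ?mulr_ge0 ?exprn_ge0 ?nrm_ge0//.
  rewrite nrmM ler_pM ?nrm_ge0 ?hB//; apply: le_trans (nrmB _ _) _.
  have n2' : nrm (2 : C) = 2 by rewrite -[2](rmorph_nat (real_complex R)) nrm_real ger0_norm.
  have n3' : nrm (3 : C) = 3 by rewrite -[3](rmorph_nat (real_complex R)) nrm_real ger0_norm.
  rewrite !nrmM n2' n3'; apply: lerD; rewrite ler_wpM2l//.
    by apply: le_trans (nrmB _ _) _; rewrite zs; lra.
  by apply: ltW (lt_le_trans hh' _); have := nrm_ge0 w; lra.
rewrite lef_pV2 ?posrE ?mulr_gt0 ?exprn_gt0 ?nrm_gt0//.
rewrite (_ : 5%N = (3 + 2)%N)// exprD ler_pM ?exprn_ge0 ?(ltW ss)//;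
by rewrite ler_pXn2r ?nnegrE ?(ltW ss) ?nrm_ge0.
Qed.
End transform.

Lemma hol_ctr phi s w : 0 < s -> cont_circ phi s -> nrm w < s -> hol (cauchy_tr phi s) w.
Proof.
move=> s0 c ws; have [B B0 hB] := circ_bounded_nrm (ltW s0) c.
exact: cdiff_derivable (cdiff_ctr s0 c hB ws).
Qed.

Section representation.
Variables (g : C -> C) (s : R).
Hypotheses (s0 : 0 < s) (hg : forall z, nrm z <= s -> hol g z).

Lemma cont_circ_gz : cont_circ (fun z => g z * z : C) s.
Proof.
apply: cont_circ_hol => z zs; apply: holM; last exact: hol_id.
by apply: hg; rewrite zs.
Qed.

Lemma cauchy_ctr w : nrm w < s -> g w = cauchy_tr (fun z => g z * z) s w.
Proof.
move=> ws; rewrite (cauchy_formula ws hg); apply: eq_cavg; first exact: ltW.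
by move=> z zs; rewrite mulrA.
Qed.

Lemma near_ball w r : nrm w < r -> \forall u \near w, nrm u < r.
Proof.
move=> wr; apply/nearCP; exists (r - nrm w); first by rewrite subr_gt0.
move=> u ur; have -> : u = (u - w) + w by rewrite subrK.
by apply: le_lt_trans (nrmD _ _) _; rewrite -ltrBrDr.
Qed.

(** Cauchy's formula writes g as a Cauchy transform. The bounds are uniform on
    smaller discs, which is the form in which they serve under an integral
    sign. *)
Lemma hol_deriv : exists g' : C -> C,
  (forall w, nrm w < s -> cdiff g w (g' w) /\ hol g' w) /\
  (forall s1, s1 < s -> exists2 M, 0 <= M & forall w h, nrm w <= s1 -> nrm (w + h) <= s1 ->
     nrm (g' w) <= M /\ nrm (g (w + h) - g w - h * g' w) <= M * nrm h ^+ 2).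
Proof.
have c := cont_circ_gz; have [B B0 hB] := circ_bounded_nrm (ltW s0) c.
exists (cauchy_tr2 (fun z => g z * z) s); split.
  move=> w ws; split; last exact: (hol_ctr2 s0 c hB ws).
  apply: cdiff_near (cdiff_ctr s0 c hB ws).
  have := near_ball ws; apply: filterS => u us; apply/esym; exact: cauchy_ctr.
move=> s1 s1s; have ss : 0 < s - s1 by rewrite subr_gt0.
have p1 : 0 <= 2 * (B / (s - s1) ^+ 2) by rewrite mulr_ge0// divr_ge0// exprn_ge0 ?ltW.
have p2 : 0 <= 2 * (B / (s - s1) ^+ 3) by rewrite mulr_ge0// divr_ge0// exprn_ge0 ?ltW.
exists (2 * (B / (s - s1) ^+ 2) + 2 * (B / (s - s1) ^+ 3)); first by rewrite addr_ge0.
move=> w h ws ws'; split.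
  by apply: le_trans (ctr2_bound s0 c hB s1s ws) _; rewrite lerDl.
rewrite !cauchy_ctr; try exact: le_lt_trans s1s.
apply: le_trans (ctr_quad s0 c hB s1s ws ws') _.
by rewrite mulrA ler_wpM2r ?sqr_ge0// lerDr.
Qed.

(** The n-th Taylor remainder of g divided by w^n, as a Cauchy integral; its
    value at 0 is the n-th Taylor coefficient. *)
Definition taylor n : C -> C := cauchy_tr (fun z => g z * z * z ^- n) s.

Lemma cont_taylor n : cont_circ (fun z => g z * z * z ^- n : C) s.
Proof.
apply: cont_circM; first exact: cont_circ_gz.
apply: cont_circ_hol => z zs; apply: holV.
  by rewrite expf_neq0// -nrm_gt0 zs.
by apply: holX; exact: hol_id.
Qed.

Lemma hol_taylor n w : nrm w < s -> hol (taylor n) w.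
Proof. by apply: hol_ctr => //; exact: cont_taylor. Qed.

Lemma taylor0 w : nrm w < s -> taylor 0 w = g w.
Proof.
move=> ws; rewrite (cauchy_ctr ws); apply: eq_cavg; first exact: ltW.
by move=> z zs; rewrite expr0 invr1 mulr1.
Qed.

Lemma taylorS n w : nrm w < s -> taylor n w = taylor n 0 + w * taylor n.+1 w.
Proof.
move=> ws; have ss := ltW s0; rewrite /taylor /cauchy_tr.
have ws0 : nrm (0 : C) < s by rewrite nrm0.
have c1 : cont_circ (fun z => g z * z / z ^+ n / (z - 0)) s.
  by apply: cont_ker1 ws0; exact: cont_taylor.
have c2 : cont_circ (fun z => g z * z / z ^+ n.+1 / (z - w)) s.
  by apply: cont_ker1 ws; exact: cont_taylor.
have c3 := cont_circZ (k := w) c2.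
rewrite -(cavgZ ss w c2) -(cavgD ss c1 c3).
apply: eq_cavg => // z zs; have z0 : z != 0 by rewrite -nrm_gt0 zs.
have zw := nrm_lt_neq zs ws.
rewrite exprS subr0 invfM; move: (z ^- n) (g z) => u v.
by field; rewrite z0 zw.
Qed.

Lemma taylor_bound : exists2 K, 0 <= K & forall n w, nrm w <= s / 2 ->
  nrm (taylor n w) <= K / s ^+ n.
Proof.
have c := cont_circ_gz; have [B B0 hB] := circ_bounded_nrm (ltW s0) c.
exists (2 * (B * (s / 2)^-1)); first by rewrite mulr_ge0// mulr_ge0// invr_ge0 divr_ge0 ?ltW.
move=> n w ws; have s1s : s / 2 < s by move: s0; lra.
have -> : 2 * (B * (s / 2)^-1) / s ^+ n = 2 * (B * (s / 2)^-1 / s ^+ n) by rewrite !mulrA.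
apply: cavg_bound; first exact: ltW.
  by apply: cont_ker1; [exact: cont_taylor|exact: le_lt_trans ws s1s].
move=> z zs; have [d1 n1] := ker_dist zs ws s1s.
rewrite nrmM nrmM !nrmV nrmX zs mulrAC ler_wpM2r ?invr_ge0 ?exprn_ge0 ?(ltW s0)//.
rewrite ler_pM ?nrm_ge0 ?invr_ge0 ?hB ?nrm_ge0//.
rewrite lef_pV2 ?posrE ?divr_gt0 ?nrm_gt0//.
by apply: le_trans d1; move: s0; lra.
Qed.

(** If all Taylor coefficients vanish then g(w) is w^n times the n-th
    remainder for all n, and this tends to 0 where |w| <= s / 4. Otherwise the
    first non-zero coefficient is the order of the zero at the origin. *)
Lemma hol_order : (forall w, nrm w <= s / 4 -> g w = 0) \/
  exists n, taylor n 0 != 0 /\ forall w, nrm w < s -> g w = w ^+ n * taylor n w.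
Proof.
have pre n : (forall k, (k < n)%N -> taylor k 0 = 0) ->
    forall w, nrm w < s -> g w = w ^+ n * taylor n w.
  elim: n => [_ w ws|n IH h w ws]; first by rewrite expr0 mul1r taylor0.
  rewrite IH//; last by move=> k kn; apply: h; exact: ltnW.
  by rewrite taylorS// h// add0r exprSr mulrA.
have [H|] := pselect (forall n, taylor n 0 = 0).
  left => w ws; have [K K0 hK] := taylor_bound.
  have ws2 : nrm w < s by move: s0; lra.
  apply/eqP; rewrite -nrm_eq0 eq_le nrm_ge0 andbT; apply/ler_addgt0Pl => e e0.
  rewrite addr0.
  have q n : nrm (g w) <= K / 2 ^+ n.
    rewrite (pre n (fun k _ => H k) w ws2) nrmM nrmX.
    have ws3 : nrm w <= s / 2 by move: s0; lra.
    apply: le_trans (ler_wpM2l _ (hK n w ws3)) _; first by rewrite exprn_ge0// nrm_ge0.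
    rewrite mulrCA ler_wpM2l// ler_pdivrMr ?exprn_gt0// mulrC -expr_div_n.
    by rewrite lerXn2r ?nnegrE ?nrm_ge0//; move: s0; lra.
  have Ke : 0 <= K / e by rewrite divr_ge0// ltW.
  apply: le_trans (q (Num.bound (K / e))) _.
  rewrite ler_pdivrMr ?exprn_gt0// mulrC -ler_pdivrMr//.
  apply: ltW (lt_le_trans (archi_boundP Ke) _).
  by rewrite -natrX ler_nat ltnW// ltn_expl.
move=> /existsNP [n hn]; right.
have ex : exists n, taylor n 0 != 0 by exists n; apply/eqP.
exists (ex_minn ex); case: ex_minnP => m hm hmin; split => //.
apply: pre => k km; apply/eqP; apply: contraT => hk.
by have := hmin _ hk; rewrite leqNgt km.
Qed.

End representation.
End CauchyTransform.

(** * Logarithms of zero-free functions *)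

Section Logarithm.
Context {R : realType}.
Local Notation C := (Cplane R).
Implicit Types (z w : C) (r s : R).

Lemma cont_line (F : C -> C) a v (t : R) : {for (a + t%:C%C * v : C), continuous F} ->
  {for t, continuous (fun t : R => F (a + t%:C%C * v))}.
Proof.
move=> h; apply: (cvg_comp (fun t : R => (a + t%:C%C * v : C)) F _ h).
apply: (proj2 (@cvgCP R R (nbhs t) _ _ _)) => e e0.
have v1 : 0 < nrm v + 1 by rewrite ltr_wpDl// nrm_ge0.
apply/nearRP; exists (e / (nrm v + 1)); first by rewrite divr_gt0.
move=> u ut; have -> : a + u%:C%C * v - (a + t%:C%C * v) = (u - t)%:C%C * v.
  by rewrite rmorphB/=; ring.
rewrite nrmM nrm_real; apply: le_lt_trans (_ : `|u - t| * (nrm v + 1) < e).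
  by rewrite ler_wpM2l// lerDl.
by rewrite -ltr_pdivlMr.
Qed.

Lemma cdiffM (f g : C -> C) w (L M : C) : cdiff f w L -> cdiff g w M ->
  cdiff (fun u => f u * g u) w (L * g w + f w * M).
Proof.
move=> /cdiffP hf /cdiffP hg; apply/cdiffP.
have := is_deriveM hf hg; rewrite /GRing.scale /=.
by rewrite addrC [g w * L]mulrC.
Qed.

Lemma cdiffN (f : C -> C) w (L : C) : cdiff f w L -> cdiff (fun u => - f u) w (- L).
Proof. by move=> /cdiffP hf; apply/cdiffP; exact: is_deriveN. Qed.

Lemma IpE (z : C) : Ip z = Rp (- (z * 'i%C)).
Proof. by case: z => a b /=; ring. Qed.

Lemma cint_FTC (F : C -> C) (F' : R -> C) (a v : C) :
  (forall t : R, 0 <= t <= 1 -> cdiff F (a + t%:C%C * v) (F' t)) ->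
  cont_on 0 1 (fun t => F' t * v : C) ->
  cint 0 1 (fun t => F' t * v) = F (a + v) - F a.
Proof.
move=> dF cF.
have e0 : a = a + (0 : R)%:C%C * v by rewrite mul0r addr0.
have e1 : a + v = a + (1 : R)%:C%C * v by rewrite mul1r.
have [k kE] : exists k : C, k = - 'i%C by exists (- 'i%C).
apply: complexP.
  rewrite RpB [in X in _ - X]e0 e1.
  apply: (@rint_FTC _ _ _ (fun t : R => Rp (F (a + t%:C%C * v)))) => //.
    exact: cont_Rp.
  by move=> t ht; apply/rdiffP; apply: rdiff_line_Rp; exact: dF.
have IE (z : C) : Ip z = Rp (k * z) by rewrite IpE kE mulNr mulrC.
rewrite IpB !IE [in X in _ - X]e0 e1 -IE Ip_cint.
have -> : rint 0 1 (fun t => Ip (F' t * v)) = rint 0 1 (fun t => Rp ((k * F' t) * v)).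
  by apply: eq_rint => t _; rewrite IE mulrA.
apply: (@rint_FTC _ _ _ (fun t : R => Rp (k * F (a + t%:C%C * v)))) => //.
  have -> : (fun t => Rp (k * F' t * v)) = (fun t => Ip (F' t * v)).
    by apply/funext => t; rewrite IE mulrA.
  exact: cont_Ip.
move=> t ht; apply/rdiffP.
apply: (@rdiff_line_Rp _ (fun z => k * F z) a v t (k * F' t)).
have -> : k * F' t = 0 * F (a + t%:C%C * v) + k * F' t by rewrite mul0r add0r.
apply: (@cdiffM (fun=> k) F _ 0 (F' t)) (dF t ht).
by apply/cdiffP; exact: is_derive_cst.
Qed.

Lemma nrm_tw (t : R) w : 0 <= t <= 1 -> nrm (t%:C%C * w : C) <= nrm w.
Proof.
by move=> /andP[t0 t1]; rewrite nrmM nrm_real ger0_norm// ler_piMl// nrm_ge0.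
Qed.

(** A primitive on a disc is the integral of psi along the radius. Its
    derivative is computed under the integral sign, and psi(t w) + t w psi'(t
    w) is the t-derivative of t psi(t w). *)
Lemma primitive (psi : C -> C) s : 0 < s -> (forall z, nrm z <= s -> hol psi z) ->
  exists2 L : C -> C, L 0 = 0 & forall w, nrm w < s -> cdiff L w (psi w).
Proof.
move=> s0 hpsi; have [psi' [h1 h2]] := hol_deriv s0 hpsi.
exists (fun w => cint 0 1 (fun t : R => w * psi (t%:C%C * w))).
  rewrite (_ : (fun t : R => 0 * psi (t%:C%C * 0)) = (fun=> 0)); last first.
    by apply/funext => t; rewrite mul0r.
  by rewrite cint_cst// mul0r.
move=> w ws; pose s1 := (nrm w + s) / 2.
have s1s : s1 < s by rewrite /s1; lra.
have ws1 : nrm w < s1 by rewrite /s1; lra.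
have [M M0 hM] := h2 s1 s1s.
have hs h : nrm h < s1 - nrm w -> nrm (w + h) <= s1.
  by move=> hh; apply: le_trans (nrmD _ _) _; lra.
have cl (F : C -> C) u : (forall z, nrm z < s -> hol F z) -> nrm u < s ->
    cont_on 0 1 (fun t : R => F (t%:C%C * u)).
  move=> hF us t ht.
  have -> : (fun t : R => F (t%:C%C * u)) = (fun t : R => F (0 + t%:C%C * u)).
    by apply/funext => x; rewrite add0r.
  apply: cont_line; rewrite add0r; apply: hol_cont; apply: hF.
  exact: le_lt_trans (nrm_tw _ ht) us.
have cid : cont_on 0 1 (fun t : R => t%:C%C : C).
  move=> t _; apply: (@cvgcomplex R R (nbhs t) _ id (fun=> 0)); first exact: cvg_id.
  exact: cvg_cst.
have cK u : nrm u < s -> cont_on 0 1 (fun t : R => u * psi (t%:C%C * u) : C).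
  move=> us; apply: (cont_mul (@cont_cst_on R _ 0 1 (u : C))).
  by apply: cl => // z zs; apply: hpsi; exact: ltW.
have cK' : cont_on 0 1 (fun t : R => psi (t%:C%C * w) + t%:C%C * w * psi' (t%:C%C * w) : C).
  apply: cont_add.
    by apply: cl => // z zs; apply: hpsi; exact: ltW.
  apply: cont_mul; first exact: cont_mul cid (@cont_cst_on R _ 0 1 (w : C)).
  by apply: cl => // z zs; have [] := h1 z zs.
have <- : cint 0 1 (fun t : R => psi (t%:C%C * w) + t%:C%C * w * psi' (t%:C%C * w)) = psi w.
  have := @cint_FTC (fun z => z * psi (z * w))
    (fun t : R => psi (t%:C%C * w) + t%:C%C * w * psi' (t%:C%C * w)) 0 1.
  rewrite add0r !mul1r mul0r subr0 => <-.
  - by apply: eq_cint => t _; rewrite mulr1.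
  - move=> t ht; rewrite add0r mulr1.
    have tws : nrm (t%:C%C * w : C) < s by exact: le_lt_trans (nrm_tw _ ht) ws.
    have [d1 _] := h1 _ tws.
    have d2 : cdiff (fun z : C => z * w) (t%:C%C) w.
      have := cdiffM (proj1 (cdiffP _ _ _) (is_derive_id (t%:C%C : C) 1))
        (proj1 (cdiffP _ _ _) (is_derive_cst (w : C) (t%:C%C : C) 1)).
      by rewrite mul1r mulr0 addr0.
    have := cdiffM (proj1 (cdiffP _ _ _) (is_derive_id (t%:C%C : C) 1))
       (cdiff_comp d2 d1).
    by rewrite mul1r [psi' _ * w]mulrC mulrA.
  - have -> : (fun t : R => (psi (t%:C%C * w) + t%:C%C * w * psi' (t%:C%C * w)) * 1 : C) =
      (fun t : R => psi (t%:C%C * w) + t%:C%C * w * psi' (t%:C%C * w)).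
      by apply/funext => t; rewrite mulr1.
    exact: cK'.
apply: (@cint_param R 0 1 (fun (t : R) w => w * psi (t%:C%C * w)) _ w (s1 - nrm w) (s1 * M + M)).
- exact: ler01.
- by rewrite subr_gt0.
- by move=> h /hs hh; apply: cK; exact: le_lt_trans hh s1s.
- exact: cK'.
move=> t h ht hh'; have hh := hs _ hh'.
have a1 : nrm (t%:C%C * w : C) <= s1 by exact: le_trans (nrm_tw _ ht) (ltW ws1).
have a2 : nrm (t%:C%C * w + t%:C%C * h : C) <= s1.
  by rewrite -mulrDr; exact: le_trans (nrm_tw _ ht) hh.
have [b1 b2] := hM _ _ a1 a2.
have -> : (w + h) * psi (t%:C%C * (w + h)) - w * psi (t%:C%C * w) -
    h * (psi (t%:C%C * w) + t%:C%C * w * psi' (t%:C%C * w)) =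
  (w + h) * (psi (t%:C%C * w + t%:C%C * h) - psi (t%:C%C * w) - t%:C%C * h * psi' (t%:C%C * w)) +
    t%:C%C * h * h * psi' (t%:C%C * w).
  by rewrite mulrDr; ring.
have th : nrm (t%:C%C * h : C) <= nrm h by exact: nrm_tw.
apply: le_trans (nrmD _ _) _; rewrite [leRHS]mulrDl; apply: lerD.
  rewrite nrmM -[leRHS]mulrA; apply: ler_pM => //; try exact: nrm_ge0.
  apply: le_trans b2 _; apply: ler_wpM2l => //.
  by rewrite lerXn2r ?nnegrE ?nrm_ge0.
rewrite 2!nrmM mulrC; apply: ler_pM => //; rewrite ?mulr_ge0 ?nrm_ge0//.
by rewrite expr2 ler_wpM2r// nrm_ge0.
Qed.

(** L is the primitive of h'/h, and h exp(-L) has derivative 0. *)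
Lemma holo_log (h : C -> C) s s1 : 0 < s1 -> s1 < s ->
  (forall z, nrm z <= s -> hol h z) -> (forall z, nrm z <= s -> h z != 0) ->
  exists L : C -> C, [/\ L 0 = 0, forall w, nrm w < s1 -> hol L w &
    forall w, nrm w < s1 -> h w = h 0 * cexp (L w)].
Proof.
move=> s10 s1s hh h0; have s0 := lt_trans s10 s1s.
have [h' [d1 _]] := hol_deriv s0 hh.
have hpsi z : nrm z <= s1 -> hol (fun z => h' z / h z) z.
  move=> zs; have zs' := le_lt_trans zs s1s; have [_ k] := d1 z zs'.
  apply: (holM k); apply: holV; first exact: h0 (ltW zs').
  exact: hh (ltW zs').
have [L L0 dL] := primitive s10 hpsi.
exists L; split => //.
  by move=> w /dL; exact: cdiff_derivable.
pose H z := h z * cexp (- L z).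
have dH z : nrm z < s1 -> cdiff H z 0.
  move=> zs; have zs' := lt_trans zs s1s; have [k _] := d1 z zs'.
  have := cdiffM k (cdiff_comp (cdiffN (dL _ zs)) (@cdiff_cexp R (- L z))).
  have -> : h' z * cexp (- L z) + h z * (cexp (- L z) * - (h' z / h z)) = 0.
    have hz : h z != 0 by exact: h0 (ltW zs').
    by field.
  by [].
move=> w ws.
have : cint 0 1 (fun t : R => (0 : C) * w) = H (0 + w) - H 0.
  apply: (@cint_FTC H (fun=> 0) 0 w).
    move=> t ht; apply: dH; rewrite add0r.
    exact: le_lt_trans (nrm_tw _ ht) ws.
  by rewrite mul0r; exact: cont_cst_on.
rewrite mul0r cint_cst// mul0r add0r => /esym/eqP; rewrite subr_eq0 => /eqP HE.
have HH : h w = H w * cexp (L w).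
  by rewrite /H -mulrA -cexpD addNr cexp0 mulr1.
by rewrite HH HE /H L0 oppr0 cexp0 mulr1.
Qed.

Section zerofree.
Variables (h : C -> C) (rho : R).
Hypothesis hh : forall z, nrm z < rho -> hol h z.
Hypothesis h0 : forall z, nrm z < rho -> h z != 0.

Lemma cont_ln_nrm (F : C -> C) z : {for z, continuous F} -> F z != 0 ->
  {for z, continuous (fun z => ln (nrm (F z)))}.
Proof.
move=> cF Fz; apply: (cvg_comp (fun z => nrm (F z)) (@ln R) (cvgnrm cF)).
by apply: continuous_ln; rewrite nrm_gt0.
Qed.

(** Two radii between s and rho leave room for the derivative of h and for L
    to be holomorphic on the whole closed disc of radius s. *)
Lemma zerofree_log s : 0 < s -> s < rho -> exists L : C -> C,
  [/\ L 0 = 0, forall w, nrm w <= s -> hol L w &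
      forall w, nrm w <= s -> ln (nrm (h w)) = ln (nrm (h 0)) + Rp (L w)].
Proof.
move=> s0 sr; pose s1 := s + (rho - s) / 3; pose s2 := s + (rho - s) / 3 * 2.
have ss1 : s < s1 by rewrite /s1; lra.
have s12 : s1 < s2 by rewrite /s1 /s2; lra.
have s2r : s2 < rho by rewrite /s2; lra.
have [] := @holo_log h s2 s1 (lt_trans s0 ss1) s12.
- by move=> z zs; apply: hh; exact: le_lt_trans zs s2r.
- by move=> z zs; apply: h0; exact: le_lt_trans zs s2r.
move=> L [L0 hL hE]; exists L; split => //.
  by move=> w ws; apply: hL; exact: le_lt_trans ws ss1.
move=> w ws; have ws1 : nrm w < s1 by exact: le_lt_trans ws ss1.
have z0 : nrm (0 : C) < rho by rewrite nrm0; lra.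
rewrite [in LHS]hE// nrmM lnM ?posrE ?nrm_gt0 ?h0//; last first.
  by rewrite -nrm_gt0 nrm_cexp expR_gt0.
by rewrite nrm_cexp expRK.
Qed.

(** The logarithm of |h| is the real part of a holomorphic function, whose
    mean is its central value. *)
Lemma jensen_zerofree s : 0 <= s -> s < rho ->
  avg (fun z => ln (nrm (h z))) s = ln (nrm (h 0)).
Proof.
rewrite le_eqVlt => /predU1P[<-|s0] sr.
  rewrite -[RHS](@avg_cst R 0); apply: eq_avg => // z /eqP.
  by rewrite nrm_eq0 => /eqP ->.
have [L [L0 hL hE]] := zerofree_log s0 sr.
have cL : cont_circ L s by apply: cont_circ_hol => z zs; apply: hL; rewrite zs.
have -> : avg (fun z => ln (nrm (h z))) s = avg (fun z => ln (nrm (h 0)) + Rp (L z)) s.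
  by apply: eq_avg; [exact: ltW|move=> z zs; apply: hE; rewrite zs].
rewrite avgD; [|exact: ltW|exact: cont_circ_cst|by move=> z zs; exact: (cvgRp (cL z zs))].
by rewrite avg_cst -Rp_cavg (mean_value (ltW s0) hL) L0 addr0.
Qed.

(** The Schwarz formula L(w) = mean of 2 Re L(z) w / (z - w), for a
    holomorphic L with L(0) = 0, comes from Cauchy's formula because the mean
    of the conjugate of L against the same kernel vanishes. Differences of
    kernels are estimated directly, and constants may be added to Re L because
    the kernel has mean 0. *)
Lemma poisson_diff s r1 w1 w2 : 0 < s -> s < rho -> r1 < s ->
  nrm w1 <= r1 -> nrm w2 <= r1 ->
  `|ln (nrm (h w1)) - ln (nrm (h w2))| <=
    4 * s * nrm (w1 - w2) / (s - r1) ^+ 2 * avg (fun z => `|ln (nrm (h z))|) s.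
Proof.
move=> s0 sr r1s hw1 hw2; have ss := ltW s0.
have [L [L0 hL hE]] := zerofree_log s0 sr.
pose u z : C := (ln (nrm (h z)))%:C%C.
have cL : cont_circ L s by apply: cont_circ_hol => z zs; apply: hL; rewrite zs.
have clh : cont_circ (fun z => ln (nrm (h z))) s.
  move=> z zs; apply: cont_ln_nrm; first by apply: hol_cont; apply: hh; rewrite zs.
  by apply: h0; rewrite zs.
have cu : cont_circ u s.
  by move=> z zs; exact: (@cvgcomplex R C (nbhs z) _ (fun z => ln (nrm (h z))) (fun=> 0) _ _ (clh z zs) (cvg_cst _)).
have ker w : nrm w <= r1 -> cont_circ (fun z => w / (z - w)) s.
  move=> wr; apply: cont_circ_hol => z zs; apply: holM; first exact: hol_cst.
  apply: holV; first by rewrite (nrm_lt_neq zs)// (le_lt_trans wr).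
  exact: hol_sub.
have ker0 w : nrm w <= r1 -> cavg (fun z => w / (z - w)) s = 0.
  move=> wr; have ws := le_lt_trans wr r1s.
  have -> : cavg (fun z => w / (z - w)) s = cavg (fun z => z / (z - w) - 1) s.
    apply: eq_cavg => // z zs; have zw := nrm_lt_neq zs ws; by field.
  have kz : cont_circ (fun z => z / (z - w)) s.
    apply: cont_circ_hol => z zs; apply: holM; first exact: hol_id.
    apply: holV; first exact: (nrm_lt_neq zs ws).
    exact: hol_sub.
  have k1 : cont_circ (fun=> 1 : C) s by exact: cont_circ_cst.
  by rewrite (cavgB ss kz k1) cauchy_kernel// cavg_cst subrr.
have rep w : nrm w <= r1 -> L w = cavg (fun z => 2 * u z * (w / (z - w))) s.
  move=> wr; have ws := le_lt_trans wr r1s; have kw := ker w wr.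
  have E1 : L w = cavg (fun z => L z * (w / (z - w))) s.
    rewrite (cauchy_formula ws hL).
    have -> : cavg (fun z => L z * (z / (z - w))) s = cavg (fun z => L z + L z * (w / (z - w))) s.
      apply: eq_cavg => // z zs; have zw := nrm_lt_neq zs ws; by field.
    by rewrite (cavgD ss cL (cont_circM cL kw)) (mean_value ss hL) L0 add0r.
  have cLJ : cont_circ (fun z => (L z)^*%C : C) s.
    by move=> z zs; exact: (cvgconj (cL z zs)).
  have E2 : cavg (fun z => (L z)^*%C * (w / (z - w))) s = 0.
    (* on the circle, the conjugate of w / (z - w) is w^* z / (s^2 - w^* z) *)
    pose G z := L z * (w^*%C * z / ((s ^+ 2)%:C%C - w^*%C * z)).
    have hG z : nrm z <= s -> hol G z.
      move=> zs; apply: holM; first exact: hL.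
      apply: holM; last exact: hol_reflected.
      by apply: holM; [exact: hol_cst|exact: hol_id].
    have cG : cont_circ G s by apply: cont_circ_hol => z zs; apply: hG; rewrite zs.
    have M := mean_value ss hG.
    rewrite /G L0 mul0r -/G in M.
    have -> : (0 : C) = 0^*%C by rewrite conjc0.
    rewrite -[in RHS]M -cavg_conj//; apply: eq_cavg => // z zs.
    have z0 : z != 0 by rewrite -nrm_gt0 zs.
    have zw := nrm_lt_neq zs ws.
    have zz : z^*%C != 0 by rewrite -nrm_eq0 nrmJ nrm_eq0.
    rewrite /G -zs -conj_mul rmorphM/= rmorphM/= rmorphM/= conjc_inv rmorphB/= !rmorphM/= !conjcK.
    have -> : z^*%C * z - w * z^*%C = (z - w) * z^*%C by ring.
    by field; rewrite zw zz.
  have c1 := cont_circM cL kw; have c2 := cont_circM cLJ kw.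
  pose b : C := (2 * ln (nrm (h 0)))%:C%C.
  have c3 : cont_circ (fun z => 2 * u z * (w / (z - w)) : C) s.
    exact: (cont_circM (cont_circZ (k := 2) cu) kw).
  have c4 := cont_circZ (k := b) kw.
  have -> : cavg (fun z => 2 * u z * (w / (z - w))) s =
      cavg (fun z => 2 * u z * (w / (z - w)) - b * (w / (z - w))) s.
    by rewrite (cavgB ss c3 c4) (cavgZ ss b kw) ker0// mulr0 subr0.
  rewrite E1 -[LHS]addr0 -E2 -(cavgD ss c1 c2).
  apply: eq_cavg => // z zs; rewrite -mulrDl -mulrBl; congr (_ * _).
  rewrite addcJ /b /u hE ?zs// rmorphD rmorphM/= rmorph_nat; ring.
have D : ln (nrm (h w1)) - ln (nrm (h w2)) = Rp (L w1 - L w2).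
  rewrite (hE _ (le_trans hw1 (ltW r1s))) (hE _ (le_trans hw2 (ltW r1s))) RpB; ring.
have k1 := ker w1 hw1; have k2 := ker w2 hw2.
have m1 := cont_circM (cont_circZ (k := 2) cu) k1.
have m2 := cont_circM (cont_circZ (k := 2) cu) k2.
rewrite D; apply: le_trans (normRp_le _) _.
rewrite (rep w1 hw1) (rep w2 hw2) -(cavgB ss m1 m2).
have m3 : cont_circ (fun z => 2 * u z * (w1 / (z - w1)) - 2 * u z * (w2 / (z - w2)) : C) s.
  by move=> z zs; exact: (cvgB (m1 z zs) (m2 z zs)).
apply: le_trans (cavg_norm ss m3) _.
pose K := 2 * s * nrm (w1 - w2) / (s - r1) ^+ 2.
have cau : cont_circ (fun z => `|ln (nrm (h z))|) s.
  by move=> z zs; exact: (cvg_norm (clh z zs)).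
have cKu : cont_circ (fun z => K * `|ln (nrm (h z))|) s.
  by move=> z zs; exact: (cvgM (cvg_cst K) (cau z zs)).
have m4 : cont_circ (fun z => nrm (2 * u z * (w1 / (z - w1)) - 2 * u z * (w2 / (z - w2)))) s.
  by move=> z zs; exact: (cvgnrm (m3 z zs)).
apply: (@le_trans _ _ (2 * (K * avg (fun z => `|ln (nrm (h z))|) s))); last first.
  by rewrite /K le_eqVlt; apply/orP; left; apply/eqP; ring.
rewrite ler_wpM2l// -(avgZ ss K cau); apply: (avg_le ss m4 cKu) => z zs.
have [d1 n1] := ker_dist zs hw1 r1s; have [d2 n2] := ker_dist zs hw2 r1s.
have n2' : nrm (2 : C) = 2 by rewrite -[2](rmorph_nat (real_complex R)) nrm_real ger0_norm.
have -> : 2 * u z * (w1 / (z - w1)) - 2 * u z * (w2 / (z - w2)) =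
   2 * u z * (z * (w1 - w2)) / ((z - w1) * (z - w2)) by field; rewrite n1 n2.
rewrite nrm_quot nrmM n2' nrmM zs nrm_real /K.
have -> : 2 * s * nrm (w1 - w2) / (s - r1) ^+ 2 * `|ln (nrm (h z))| =
  2 * `|ln (nrm (h z))| * (s * nrm (w1 - w2)) / (s - r1) ^+ 2 by ring.
have ss1 : 0 < s - r1 by rewrite subr_gt0.
rewrite ler_wpM2l ?mulr_ge0 ?nrm_ge0//.
rewrite lef_pV2 ?posrE ?mulr_gt0 ?exprn_gt0 ?nrm_gt0//.
by rewrite expr2; apply: ler_pM => //; exact: ltW.
Qed.

End zerofree.
End Logarithm.

(** * Generic points, orders, meromorphic functions *)

Section Generic.
Context {R : realType}.
Local Notation C := (Cplane R).
Implicit Types (z w c : C) (r s : R) (P Q : C -> Prop).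

(** The exceptional set is closed and discrete. *)
Definition generic P := forall z, \forall w \near z^', P w.

Lemma genericI P Q : generic P -> generic Q -> generic (fun z => P z /\ Q z).
Proof.
by move=> h1 h2 z; have := h1 z; have := h2 z; apply: filterS2 => w q p; split.
Qed.

Lemma generic_sub P Q : (forall z, P z -> Q z) -> generic P -> generic Q.
Proof. by move=> h1 h2 z; have := h2 z; apply: filterS => w; exact: h1. Qed.

Lemma near_punct_shift P c z : (\forall w \near (z + c)^', P w) ->
  \forall w \near z^', P (w + c).
Proof.
move=> /nearC'P[d d0 hd]; apply/nearC'P; exists d => // w wz wd.
apply: hd; first by apply: contra_neq wz; exact: addIr.
by have -> : w + c - (z + c) = w - z by ring.
Qed.

Lemma generic_shift P c : generic P -> generic (fun z => P (z + c)).
Proof. by move=> h z; exact: near_punct_shift. Qed.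

Lemma generic_all (n : nat) (P : 'I_n -> C -> Prop) : (forall i, generic (P i)) ->
  generic (fun z => forall i, P i z).
Proof.
move=> h z.
exact: (@filter_forall C 'I_n (fun i w => P i w) (z^') _ (fun i => h i z)).
Qed.

(** The property of rectangles to contain finitely many exceptional points
    passes to unions and holds locally. *)
Lemma generic_finite P r : generic P -> finite_set [set z | nrm z <= r /\ ~ P z].
Proof.
move=> gP; have [r0|r0] := ltP r 0.
  apply: (sub_finite_set _ (finite_set0 C)) => z [zr _].
  by have := nrm_ge0 z; rewrite leNgt (le_lt_trans zr).
pose B (a b c d : R) := [set z : C | [/\ a <= Rp z <= b, c <= Ip z <= d & ~ P z]].
suff H : finite_set (B (-r) r (-r) r).
  apply: sub_finite_set H => z [zr nP]; split => //.
    by rewrite -ler_norml; exact: le_trans (normRp_le z) zr.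
  by rewrite -ler_norml; exact: le_trans (normIp_le z) zr.
have rr : - r <= r by rewrite ge0_cp.
apply: (@bisection R (fun a b c d : R => finite_set (B a b c d)) (-r) r (-r) r rr rr).
- move=> a m b c d _ _ _ _ _ _ h1 h2.
  apply: (@sub_finite_set _ _ (B a m c d `|` B m b c d)); last by rewrite finite_setU.
  move=> z [/andP[k1 k2] k3 k4]; have [h|h] := leP (Rp z) m; [left|right]; split => //.
    by rewrite k1.
  by rewrite (ltW h).
- move=> a b c m d _ _ _ _ _ _ h1 h2.
  apply: (@sub_finite_set _ _ (B a b c m `|` B a b m d)); last by rewrite finite_setU.
  move=> z [k3 /andP[k1 k2] k4]; have [h|h] := leP (Ip z) m; [left|right]; split => //.
    by rewrite k1.
  by rewrite (ltW h).
move=> x y _ _; have /nearC'P[d d0 hd] := gP (x +i* y)%C.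
exists (d / 2); first by rewrite divr_gt0.
move=> a' b' c' d' _ hx _ _ hy _ w1 w2 _.
apply: (sub_finite_set _ (finite_set1 ((x +i* y)%C : C))) => z [h1 h2 nP] /=.
apply: contrapT => /eqP zxy; apply: nP; apply: hd => //.
apply: le_lt_trans (nrm_leD _) _; rewrite RpB IpB /=.
have e1 : `|Rp z - x| <= b' - a' by rewrite ler_norml; apply/andP; split; lra.
have e2 : `|Ip z - y| <= d' - c' by rewrite ler_norml; apply/andP; split; lra.
lra.
Qed.

Lemma generic_radii P : generic P -> countable [set r | exists z, nrm z = r /\ ~ P z].
Proof.
move=> gP; pose A n := [set nrm z | z in [set z | nrm z <= n%:R /\ ~ P z]].
have : countable (\bigcup_n A n).
  apply: bigcup_countable => // n _; apply: finite_set_countable.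
  by apply: finite_image; exact: generic_finite.
apply: sub_countable; apply: subset_card_le => r [z [zr nP]].
exists (Num.bound r) => //; exists z => //; split => //; rewrite zr; apply: ltW.
by apply: archi_boundP; rewrite -zr nrm_ge0.
Qed.

Lemma nearA z P : (forall w, P w) -> \forall w \near z, P w.
Proof. by move=> h; apply/nearCP; exists 1. Qed.

Lemma nearA' z P : (forall w, P w) -> \forall w \near z^', P w.
Proof. by move=> h; apply/nearC'P; exists 1. Qed.

Lemma near_open z P : (\forall w \near z, P w) -> \forall w \near z, \forall u \near w, P u.
Proof.
move=> /nearCP[d d0 hd]; apply/nearCP; exists d => // w wd; apply/nearCP.
exists (d - nrm (w - z)); first by rewrite subr_gt0.
move=> u ud; apply: hd; have -> : u - z = (u - w) + (w - z) by ring.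
by apply: le_lt_trans (nrmD _ _) _; rewrite -ltrBrDr.
Qed.

Lemma near_punct_open z P : (\forall w \near z^', P w) ->
  \forall w \near z^', \forall u \near w, P u.
Proof.
move=> /nearC'P[d d0 hd]; apply/nearC'P; exists d => // w wz wd; apply/nearCP.
exists (Num.min (nrm (w - z)) (d - nrm (w - z))).
  by rewrite lt_min nrm_gt0 subr_eq0 wz subr_gt0.
move=> u; rewrite lt_min => /andP[u1 u2]; apply: hd.
  by apply: contraTneq u1 => ->; rewrite nrmBC ltxx.
have -> : u - z = (u - w) + (w - z) by ring.
by apply: le_lt_trans (nrmD _ _) _; rewrite -ltrBrDr.
Qed.

Lemma near_punct z P : (\forall w \near z, P w) -> \forall w \near z^', P w.
Proof. by move=> /nearCP[d d0 hd]; apply/nearC'P; exists d => // w _; exact: hd. Qed.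

Lemma near_punct_pt z P : (\forall w \near z^', P w) -> P z -> \forall w \near z, P w.
Proof.
move=> /nearC'P[d d0 hd] Pz; apply/nearCP; exists d => // w wd.
by have [->//|wz] := eqVneq w z; exact: hd.
Qed.

Lemma punct_proper z : ProperFilter (z^').
Proof. exact: Proper_dnbhs_numFieldType. Qed.

Lemma punct_ex z P : (\forall w \near z^', P w) -> exists w, P w.
Proof. by move=> h; have [w hw] := @filter_ex _ _ (punct_proper z) _ h; exists w. Qed.

Lemma cont_punct_eq (F G : C -> C) z : {for z, continuous F} -> {for z, continuous G} ->
  (\forall w \near z^', F w = G w) -> F z = G z.
Proof.
move=> cF cG FG; apply: nrm_eps => e e0.
have e2 : 0 < e / 2 by rewrite divr_gt0.
have /cvgCP/(_ _ e2)/near_punct h1 := cF; have /cvgCP/(_ _ e2)/near_punct h2 := cG.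
have [w [[h3 h4] h5]] := punct_ex (filterI (filterI h1 h2) FG).
have -> : F z - G z = (G w - G z) - (F w - F z) by rewrite h5; ring.
by apply: le_trans (nrmB _ _) _; rewrite [e]splitr addrC; apply/ltW/ltrD.
Qed.
End Generic.

Section Order.
Context {R : realType}.
Local Notation C := (Cplane R).
Implicit Types (z w c v : C) (r s : R) (f g : C -> C) (m n : int).

Lemma exprnzE (x : C) (k : nat) : x ^ (- k%:Z) = (x ^+ k)^-1.
Proof. by rewrite -invr_expz. Qed.

(** f is v (w - z)^m to leading order at z; m is negative at poles. *)
Definition has_order f z m v := exists g : C -> C,
  [/\ holomorphic_at g z, g z = v, v != 0 &
      \forall w \near z^', f w = g w * (w - z) ^ m].

Lemma holat_hol g z : holomorphic_at g z -> hol g z.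
Proof. exact: nbhs_singleton. Qed.

Lemma holat_near f g z : (\forall w \near z, f w = g w) ->
  holomorphic_at f z -> holomorphic_at g z.
Proof.
move=> /near_open h1 h2; rewrite /holomorphic_at; near=> w.
by apply: (@hol_near R f g w); near: w.
Unshelve. all: by end_near. Qed.

Lemma holat_open g z : holomorphic_at g z -> \forall w \near z, holomorphic_at g w.
Proof. exact: near_open. Qed.

Lemma holatM f g z : holomorphic_at f z -> holomorphic_at g z ->
  holomorphic_at (fun w => f w * g w) z.
Proof. by apply: filterS2 => w; exact: holM. Qed.

Lemma holatB f g z : holomorphic_at f z -> holomorphic_at g z ->
  holomorphic_at (fun w => f w - g w) z.
Proof. by apply: filterS2 => w; exact: holB. Qed.

Lemma hol_neq0 g z : hol g z -> g z != 0 -> \forall w \near z, g w != 0.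
Proof.
move=> /hol_cont /cvgCP h gz; have n0 : 0 < nrm (g z) by rewrite nrm_gt0.
apply: filterS (h _ n0) => w; apply: contraTneq => ->.
by rewrite sub0r nrmN ltxx.
Qed.

Lemma holatV g z : g z != 0 -> holomorphic_at g z ->
  holomorphic_at (fun w => (g w)^-1) z.
Proof.
move=> gz hg; have := hol_neq0 (holat_hol hg) gz; rewrite /holomorphic_at.
by move: hg; apply: filterS2 => w h1 h2; exact: holV.
Qed.

Lemma holat_all g z : (forall w, hol g w) -> holomorphic_at g z.
Proof. by move=> h; apply: nearA => w; exact: h. Qed.

Lemma holat_cst (k : C) z : holomorphic_at (fun=> k) z.
Proof. by apply: holat_all => w; exact: hol_cst. Qed.

Lemma holat_subz (a : C) m z : z != a -> holomorphic_at (fun w => (w - a) ^ m) z.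
Proof.
move=> za; case: m => n.
  by apply: holat_all => w; exact: hol_subX.
rewrite NegzE; apply: (@holat_near (fun w => ((w - a) ^+ n.+1)^-1)).
  by apply: nearA => w; rewrite exprnzE.
apply: holatV; first by rewrite expf_neq0// subr_eq0.
by apply: holat_all => w; exact: hol_subX.
Qed.

Lemma near_punct_neq z : \forall w \near z^', w != z.
Proof. by apply/nearC'P; exists 1. Qed.

Lemma has_orderV f z m v : has_order f z m v -> has_order (fun w => (f w)^-1) z (- m) v^-1.
Proof.
move=> [f1 [h1 h2 h3 h4]]; exists (fun w => (f1 w)^-1); split.
- by apply: holatV => //; rewrite h2.
- by rewrite h2.
- by rewrite invr_neq0.
by apply: filterS h4 => w ->; rewrite invfM invr_expz.
Qed.

Lemma has_order_near f g z m v : (\forall w \near z^', f w = g w) ->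
  has_order f z m v -> has_order g z m v.
Proof.
move=> fg [f1 [h1 h2 h3 h4]]; exists f1; split => //.
by move: fg h4; apply: filterS2 => w -> ->.
Qed.

Lemma holat_shift g c z : holomorphic_at g (z + c) -> holomorphic_at (fun w => g (w + c)) z.
Proof.
move=> /nearCP[d d0 hd]; apply/nearCP; exists d; [exact: d0|move=> w wd].
apply: (@hol_comp R g (fun w => w + c)); first by apply: holD; [exact: hol_id|exact: hol_cst].
by apply: hd; have -> : w + c - (z + c) = w - z by ring.
Qed.

Lemma has_order_shift f c z m v : has_order f (z + c) m v ->
  has_order (fun w => f (w + c)) z m v.
Proof.
move=> [f1 [h1 h2 h3 h4]]; exists (fun w => f1 (w + c)); split; [|exact: h2|exact: h3|].
  exact: holat_shift.
by apply: filterS (near_punct_shift h4) => w ->; rewrite opprD addrACA subrr addr0.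
Qed.

Lemma has_order_uniq f z m n v u : has_order f z m v -> has_order f z n u -> m = n /\ v = u.
Proof.
wlog mn : m n v u / m <= n => [H h1 h2|].
  have [mn|/ltW nm] := leP m n; first exact: (H _ _ _ _ mn h1 h2).
  by have [-> ->] := H _ _ _ _ nm h2 h1.
move=> [f1 [h1 h2 h3 h4]] [g1 [k1 k2 k3 k4]].
have [k kE] : exists k : nat, n = m + k%:Z.
  by exists `|n - m|%N; rewrite gez0_abs ?subr_ge0// [RHS]addrC subrK.
have E : \forall w \near z^', f1 w = g1 w * (w - z) ^+ k.
  near=> w; have wz : w - z != 0 by rewrite subr_eq0; near: w; exact: near_punct_neq.
  have E0 : g1 w * ((w - z) ^ m * (w - z) ^ k) = f1 w * (w - z) ^ m.
    by rewrite -(near h4 w)// (near k4 w)// kE expfzDr.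
  apply: (@mulIf _ ((w - z) ^ m)); first by rewrite expfz_neq0.
  rewrite -E0; rewrite -mulrA; congr (_ * _); exact: mulrC.
have c1 : {for z, continuous f1} by exact/hol_cont/holat_hol.
have hk : hol (fun w => g1 w * (w - z) ^+ k) z.
  apply: holM; first exact: holat_hol.
  exact: hol_subX.
have := cont_punct_eq c1 (hol_cont hk) E; rewrite subrr h2 k2.
case: k {E hk} kE => [|k] kE; first by rewrite expr0 mulr1 kE addr0.
by rewrite expr0n mulr0 => /eqP v0; rewrite v0 in h3.
Unshelve. all: by end_near. Qed.

(** The local form at z of the order dichotomy at the origin. *)
Lemma holat_order g z : holomorphic_at g z ->
  (\forall w \near z, g w = 0) \/ exists (n : nat) v, has_order g z n%:Z v.
Proof.
move=> /nearCP[d d0 hd]; pose s := d / 2; have s0 : 0 < s by rewrite divr_gt0.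
have hg u : nrm u <= s -> hol (fun u => g (u + z)) u.
  move=> us; apply: (@hol_comp R g (fun w => w + z)).
    by apply: holD; [exact: hol_id|exact: hol_cst].
  apply: hd; have -> : u + z - z = u by ring.
  by apply: le_lt_trans us _; rewrite /s; lra.
have [h|[n [t0 hE]]] := hol_order s0 hg.
  left; apply/nearCP; exists (s / 4); first by rewrite divr_gt0.
  by move=> w /ltW /h; rewrite subrK.
right; exists n, (taylor (fun u => g (u + z)) s n 0).
exists (fun w => taylor (fun u => g (u + z)) s n (w - z)); split => //.
- apply/nearCP; exists s => // w ws.
  apply: (@hol_comp R _ (fun w => w - z)); first exact: hol_sub.
  exact: hol_taylor.
- by rewrite subrr.
- apply/nearC'P; exists s => // w _ ws.
  by have := hE _ ws; rewrite subrK => ->; rewrite mulrC.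
Qed.

Lemma mero_order f z : meromorphic f ->
  (\forall w \near z^', f w = 0) \/ exists m v, has_order f z m v.
Proof.
move=> /(_ z) [n [g [hg fE]]]; have [g0|[k [v hv]]] := holat_order hg.
  left; move/near_punct: g0 => g0; move: fE g0; apply: filterS2 => w -> ->.
  by rewrite mul0r.
right; exists (k%:Z - n%:Z), v; move: hv => [g1 [h1 h2 h3 h4]]; exists g1; split => //.
near=> w; have wz : w - z != 0 by rewrite subr_eq0; near: w; exact: near_punct_neq.
rewrite (near fE w)// (near h4 w)// expfzDr// exprnzE mulrA.
Unshelve. all: by end_near. Qed.

(** Meromorphic and not identically 0: every germ has an order. By the
    identity theorem nzm_nz it suffices that one of them has. *)
Definition nzm f := forall z, exists m v, has_order f z m v.

Lemma has_order_near_neq0 f z m v : has_order f z m v ->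
  \forall w \near z^', holomorphic_at f w /\ f w != 0.
Proof.
move=> [g [h1 h2 h3 h4]].
have gz : g z != 0 by rewrite h2.
have k1 := near_punct (holat_open h1); have k2 := near_punct (hol_neq0 (holat_hol h1) gz).
near=> w; have wz : w != z by near: w; exact: near_punct_neq.
have fw : \forall u \near w, g u * (u - z) ^ m = f u.
  by near: w; have := near_punct_open h4; apply: filterS => w; apply: filterS => u ->.
split; last first.
  rewrite (near h4 w)// mulf_neq0//; first by near: w.
  by rewrite expfz_neq0// subr_eq0.
apply: holat_near fw _; apply: holatM; last exact: holat_subz.
by near: w.
Unshelve. all: by end_near. Qed.

Definition reg f z := holomorphic_at f z /\ f z != 0.

Lemma nzm_reg f : nzm f -> generic (reg f).
Proof. by move=> h z; have [m [v hv]] := h z; exact: has_order_near_neq0 hv. Qed.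

Lemma reg_order f z : reg f z -> has_order f z 0 (f z).
Proof.
by move=> [h1 h2]; exists f; split => //; apply: nearA' => w; rewrite expr0z mulr1.
Qed.

(** The set of points near which f vanishes identically is open and so is its
    complement, by the order dichotomy. Bisection of the segment joining two
    points shows that it is empty or everything. *)
Lemma nzm_nz f : meromorphic f -> ~ mero_eq f (fun=> 0) -> nzm f.
Proof.
move=> mf nf; pose T z := \forall w \near z^', f w = 0.
suff H : forall z, ~ T z by move=> z; have [/H|] := mero_order z mf.
move=> z0 T0; apply: nf => z1; rewrite -/(T z1).
pose gam (t : R) : C := z0 + t%:C%C * (z1 - z0).
have loc z : exists2 d : R, 0 < d & forall w, nrm (w - z) < d -> (T w <-> T z).
  have [Tz|[m [v hv]]] := mero_order z mf.
    have := near_punct_open Tz => h.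
    have : \forall w \near z, T w.
      by apply: near_punct_pt => //; apply: filterS h => w; exact: near_punct.
    move=> /nearCP[d d0 hd]; exists d; [exact: d0|move=> w wd].
    by split=> _; [exact: Tz|exact: hd].
  have nT w : (\forall u \near w^', f u != 0) -> ~ T w.
    by move=> h Tw; have [u [/eqP h1 h2]] := punct_ex (filterI h Tw).
  have h1 : \forall w \near z^', f w != 0.
    by apply: filterS (has_order_near_neq0 hv) => w [].
  have : \forall w \near z, ~ T w.
    apply: near_punct_pt; last exact: nT.
    by apply: filterS (near_punct_open h1) => w hw; apply: nT; exact: near_punct.
  move=> /nearCP[d d0 hd]; exists d; [exact: d0|move=> w wd; have k1 := hd w wd].
  have k2 : ~ T z by apply: hd; rewrite subrr nrm0.
  by split=> H; [case: (k1 H)|case: (k2 H)].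
have : T (gam 0) <-> T (gam 1).
  apply: (@bisection R (fun a b _ _ => T (gam a) <-> T (gam b)) 0 1 0 0 ler01 (lexx 0)).
  - by move=> a m b _ _ _ _ _ _ _ _ -> .
  - by [].
  move=> x y _ _; have [d d0 hd] := loc (gam x).
  have k0 : 0 < nrm (z1 - z0) + 1 by rewrite ltr_wpDl// nrm_ge0.
  exists (d / (nrm (z1 - z0) + 1)); first by rewrite divr_gt0.
  move=> a b c' d' _ /andP[ax xb] _ _ _ _ ab _ _.
  have key t : a <= t <= b -> T (gam t) <-> T (gam x).
    move=> /andP[at' tb]; apply: hd.
    have -> : gam t - gam x = (t - x)%:C%C * (z1 - z0) by rewrite /gam rmorphB/=; ring.
    rewrite nrmM nrm_real.
    apply: (@le_lt_trans _ _ ((b - a) * (nrm (z1 - z0) + 1))); last by rewrite -ltr_pdivlMr.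
    rewrite ler_pM ?nrm_ge0// ?lerDl// ler_norml; apply/andP; split; lra.
  by rewrite key ?key// ?lexx ?(le_trans ax xb).
have -> : gam 0 = z0 by rewrite /gam mul0r addr0.
have -> : gam 1 = z1 by rewrite /gam mul1r addrC subrK.
by move=> <-.
Qed.

Lemma pole_of_multP f z (n : nat) : pole_of_mult f z n <-> exists v, has_order f z (- n%:Z) v.
Proof.
split=> [[g [h1 h2 h3]]|[v [g [h1 h2 h3 h4]]]].
  exists (g z), g; split => //; apply: filterS h3 => w ->.
  by rewrite exprnzE.
exists g; split => //; first by rewrite h2.
by apply: filterS h4 => w ->; rewrite exprnzE.
Qed.

Lemma pole_multE f z m v : has_order f z m v ->
  pole_mult f z = (if m <= 0 then `|m|%N else 0%N).
Proof.
move=> h; rewrite /pole_mult; case: xgetP => [n nE /pole_of_multP [u hu]|H].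
  have [mE _] := has_order_uniq h hu; rewrite mE oppr_le0.
  by rewrite abszN.
case: ifP => // m0; case: (H `|m|%N); apply/pole_of_multP; exists v.
by rewrite lez0_abs// opprK.
Qed.

Lemma pole_mult_real f z m v : has_order f z m v ->
  (pole_mult f z)%:R = Num.max (- m)%:~R 0 :> R.
Proof.
move=> /pole_multE ->; case: leP => m0; last first.
  by rewrite max_r// lerz0 oppr_le0 ltW.
by rewrite max_l ?ler0z ?oppr_ge0// natr_absz ler0_norm.
Qed.

Lemma pole_multB f z m v : has_order f z m v ->
  (pole_mult (fun w => (f w)^-1) z)%:R - (pole_mult f z)%:R = m%:~R :> R.
Proof.
move=> h; rewrite (pole_mult_real h) (pole_mult_real (has_orderV h)) opprK.
have [m0|m0] := leP 0 m.
  by rewrite max_l ?ler0z// max_r ?lerz0 ?oppr_le0// subr0.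
by rewrite max_r ?lerz0 ?(ltW m0)// max_l ?ler0z ?oppr_ge0 ?(ltW m0)// sub0r -mulrNz opprK.
Qed.

Lemma pole_mult_reg f z : reg f z -> pole_mult f z = 0%N.
Proof. by move=> /reg_order /pole_multE ->. Qed.

Lemma reg_inv f z : reg f z -> reg (fun w => (f w)^-1) z.
Proof. by move=> [h1 h2]; split; [exact: holatV|rewrite invr_eq0]. Qed.

Lemma nzm_inv f : nzm f -> nzm (fun w => (f w)^-1).
Proof. by move=> h z; have [m [v hv]] := h z; exists (- m), v^-1; exact: has_orderV. Qed.

Lemma nzm_shift c f : nzm f -> nzm (fun w => f (w + c)).
Proof. by move=> h z; have [m [v hv]] := h (z + c); exists m, v; exact: has_order_shift. Qed.

(** One computation for both the meromorphy of f - g and the sub-additivity of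
    pole multiplicities. *)
Lemma quotient_sub f g f1 g1 z (n k : nat) : holomorphic_at f1 z -> holomorphic_at g1 z ->
  (\forall w \near z^', f w = f1 w / (w - z) ^+ n) ->
  (\forall w \near z^', g w = g1 w / (w - z) ^+ k) ->
  exists h : C -> C, holomorphic_at h z /\
    \forall w \near z^', f w - g w = h w / (w - z) ^+ (n + k).
Proof.
move=> h1 k1 h2 k2; exists (fun w => f1 w * (w - z) ^+ k - g1 w * (w - z) ^+ n); split.
  have hp j : holomorphic_at (fun w => (w - z) ^+ j) z.
    by apply: holat_all => w; exact: hol_subX.
  exact: (holatB (holatM h1 (hp k)) (holatM k1 (hp n))).
near=> w; have wz : w - z != 0 by rewrite subr_eq0; near: w; exact: near_punct_neq.
rewrite (near h2 w)// (near k2 w)// exprD.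
have w1 : (w - z) ^+ n != 0 by rewrite expf_neq0.
have w2 : (w - z) ^+ k != 0 by rewrite expf_neq0.
by field; rewrite w1 w2.
Unshelve. all: by end_near. Qed.

Lemma mero_sub f g : meromorphic f -> meromorphic g -> meromorphic (fun w => f w - g w).
Proof.
move=> mf mg z; have [n [f1 [h1 h2]]] := mf z; have [k [g1 [k1 k2]]] := mg z.
by exists (n + k)%N; exact: quotient_sub h1 k1 h2 k2.
Qed.

Lemma mero_shift c f : meromorphic f -> meromorphic (fun w => f (w + c)).
Proof.
move=> mf z; have [n [g [h1 h2]]] := mf (z + c); exists n, (fun w => g (w + c)); split.
  exact: holat_shift.
by apply: filterS (near_punct_shift h2) => w ->; rewrite opprD addrACA subrr addr0.
Qed.

Lemma mero_cst (k : C) : meromorphic (fun=> k).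
Proof.
move=> z; exists 0%N, (fun=> k); split; first exact: holat_cst.
by apply: nearA' => w; rewrite expr0 divr1.
Qed.

Lemma mero_hol f : meromorphic f -> generic (holomorphic_at f).
Proof.
move=> mf z; have [n [g [h1 h2]]] := mf z.
have k1 := near_punct (holat_open h1).
near=> w; have wz : w != z by near: w; exact: near_punct_neq.
have fw : \forall u \near w, g u * (u - z) ^ (- n%:Z) = f u.
  near: w; have := near_punct_open h2; apply: filterS => w; apply: filterS => u ->.
  by rewrite exprnzE.
by apply: holat_near fw _; apply: holatM; [near: w|exact: holat_subz].
Unshelve. all: by end_near. Qed.

Lemma nzm_mero f : nzm f -> meromorphic f.
Proof.
move=> h z; have [m [v [g [h1 h2 h3 h4]]]] := h z.
case: m h4 => n h4.
  exists 0%N, (fun w => g w * (w - z) ^+ n); split.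
    apply: (holatM h1).
    by apply: holat_all => w; exact: hol_subX.
  by apply: filterS h4 => w ->; rewrite expr0 divr1.
by exists n.+1, g; split; [exact: h1|apply: filterS h4 => w ->].
Qed.

End Order.

(** * Counting functions *)

Section Counting.
Context {R : realType}.
Local Notation C := (Cplane R).
Local Notation mu := (@lebesgue_measure R).
Implicit Types (z w a : C) (r t b rho : R) (f g : C -> C).

(** The contribution to the integrated counting function of a single point a:
    the integral of dt / t from |a| to r, or log r at the origin. *)
Definition nu r a : R :=
  if a == 0 then ln r else if nrm a <= r then ln r - ln (nrm a) else 0.

Lemma step_patch b r : 0 < b ->
  ((fun t : R => if b <= t then t^-1 else 0) \_ `]0, r]) =
  ((fun t : R => t^-1) \_ `[b, r]).
Proof.
move=> b0; apply/funext => t; rewrite !patchE.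
have e1 : (t \in `]0, r]%classic) = (0 < t <= r).
  by apply/idP/idP; rewrite inE /= in_itv.
have e2 : (t \in `[b, r]%classic) = (b <= t <= r).
  by apply/idP/idP; rewrite inE /= in_itv.
rewrite e1 e2; case: (ltP 0 t) => h1 /=; last first.
  by rewrite (leNgt b t) (le_lt_trans h1 b0).
by case: (leP b t); case: (leP t r).
Qed.

Lemma cont_inv b r : 0 < b -> cont_on b r (fun t : R => t^-1).
Proof.
move=> b0 t /andP[bt _]; apply: inv_continuous.
by rewrite gt_eqF// (lt_le_trans b0 bt).
Qed.

Lemma step_integrable b r : 0 < b ->
  mu.-integrable `]0, r] (EFin \o (fun t : R => if b <= t then t^-1 else 0)).
Proof.
move=> b0; apply: (proj2 (integrable_mkcond _ _)) => //.
rewrite restrict_EFin step_patch// -restrict_EFin.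
apply: (proj1 (integrable_mkcond _ _)) => //.
by apply: rint_integrable; exact: cont_inv.
Qed.

Lemma step_integral b r : 0 < b ->
  \int[mu]_(t in `]0, r]) (if b <= t then t^-1 else 0) =
  if b <= r then ln r - ln b else 0.
Proof.
move=> b0; rewrite Rintegral_mkcond step_patch// -Rintegral_mkcond.
case: leP => br; last by rewrite set_itv_ge ?bnd_simp -?ltNge// Rintegral_set0.
apply: (@rint_FTC R b r (@ln R) (fun t => t^-1)) => //; first exact: cont_inv.
move=> t /andP[bt _]; apply: is_derive1_ln; exact: lt_le_trans bt.
Qed.

Lemma sum_integral (s : seq C) (k : C -> R) (F : C -> R -> R) (D : set R) :
  measurable D ->
  (forall a, a \in s -> mu.-integrable D (EFin \o F a)) ->
  mu.-integrable D (EFin \o (fun t => \sum_(a <- s) k a * F a t)) /\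
  \int[mu]_(t in D) (\sum_(a <- s) k a * F a t) =
  \sum_(a <- s) k a * \int[mu]_(t in D) F a t.
Proof.
move=> mD; elim: s => [|a s IH] h.
  rewrite big_nil; have -> : (fun t => \sum_(a <- [::]) k a * F a t) = (fun=> 0).
    by apply/funext => t; rewrite big_nil.
  split; last first.
    by rewrite /Rintegral integral0.
  exact: integrable0.
have [h1 h2] := IH (fun z zs => h z (mem_behead (s := a :: s) zs)).
have ha := h a (mem_head a s).
have hk : mu.-integrable D (EFin \o (fun t => k a * F a t)).
  have := @integrableZl _ _ R mu D mD (k a) _ ha.
  by apply: eq_integrable => // t _ /=; rewrite EFinM.
have E : (fun t => \sum_(z <- a :: s) k z * F z t) =
    (fun t => k a * F a t + \sum_(z <- s) k z * F z t).
  by apply/funext => t; rewrite big_cons.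
split.
  rewrite E; have := @integrableD _ _ R mu D mD _ _ hk h1.
  by apply: eq_integrable => // t _ /=; rewrite EFinD.
rewrite big_cons -h2 -RintegralZl// -RintegralD//.
by apply: eq_Rintegral => t _; rewrite big_cons.
Qed.

Lemma pole_count_sum f t rho (s : seq C) : uniq s -> t <= rho ->
  (forall a, nrm a <= rho -> pole_mult f a != 0%N -> a \in s) ->
  pole_count f t = \sum_(a <- s | nrm a <= t) (pole_mult f a)%:R.
Proof.
move=> us tr hs; rewrite /pole_count (fsbigE [seq a <- s | nrm a <= t]) ?filter_uniq//.
- rewrite big_filter_cond; apply: eq_bigl => a.
  rewrite andb_idr//.
  by move=> h; rewrite mem_set.
- by move=> a /=; rewrite mem_filter => /andP[].
- move=> a /= at'; rewrite mem_filter at'/= => nas.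
  by apply/eqP; rewrite pnatr_eq0; apply: contraNT nas; apply: hs; exact: le_trans tr.
Qed.

(** The step function t |-> n(t) - n(0) is integrated term by term. Any list s
    that contains the poles will do, so that different functions can share one
    list. *)
Lemma counting_sum f r (s : seq C) : 0 < r -> uniq s ->
  (forall a, nrm a <= r -> pole_mult f a != 0%N -> a \in s) ->
  integrated_counting f r = \sum_(a <- s) (pole_mult f a)%:R * nu r a.
Proof.
move=> r0 us hs; rewrite /integrated_counting.
pose s' := [seq a <- s | a != 0].
have n0 : pole_count f 0 = \sum_(a <- s | a == 0) (pole_mult f a)%:R.
  rewrite (pole_count_sum us (ltW r0) hs); apply: eq_bigl => a.
  by rewrite -nrm_eq0 eq_le nrm_ge0 andbT.
have -> : \int[mu]_(t in `]0, r]) ((pole_count f t - pole_count f 0) / t) =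
    \int[mu]_(t in `]0, r]) (\sum_(a <- s') (pole_mult f a)%:R *
      (if nrm a <= t then t^-1 else 0)).
  apply: eq_Rintegral => t; rewrite inE /= in_itv/= => /andP[t0 tr].
  rewrite n0 (pole_count_sum us tr hs) (bigID (fun a => a == 0))/=.
  have -> : \sum_(a <- s | (nrm a <= t) && (a == 0)) (pole_mult f a)%:R =
      \sum_(a <- s | a == 0) (pole_mult f a)%:R :> R.
    apply: eq_bigl => a; case: eqP => [->|_]; last by rewrite andbF.
    by rewrite nrm0 (ltW t0).
  rewrite [X in X - _]addrC addrK mulr_suml big_filter [RHS]big_mkcond/= [LHS]big_mkcond/=.
  by apply: eq_bigr => a _; case: eqP; case: leP; rewrite //= mulr0.
have [] := @sum_integral s' (fun a => (pole_mult f a)%:R)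
  (fun a t => if nrm a <= t then t^-1 else 0) `]0, r] (measurable_itv _).
  by move=> a; rewrite mem_filter => /andP[a0 _]; apply: step_integrable; rewrite nrm_gt0.
move=> _ ->; rewrite n0 big_filter mulr_suml [RHS](bigID (fun a => a != 0))/=.
congr (_ + _).
  apply: eq_bigr => a a0; rewrite step_integral ?nrm_gt0// /nu.
  by rewrite (negbTE a0).
apply: eq_big => [a|a]; rewrite ?negbK//.
by move=> /eqP ->; rewrite /nu eqxx.
Qed.

Lemma nu_ge0 r a : 1 <= r -> 0 <= nu r a.
Proof.
move=> r1; rewrite /nu; case: eqP => [_|/eqP a0]; first exact: ln_ge0.
case: (leP (nrm a) r) => // ar; rewrite subr_ge0 ler_ln ?posrE ?nrm_gt0//.
exact: lt_le_trans r1.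
Qed.

Lemma nu_max r a : 0 < r -> a != 0 -> nu r a = ln (Num.max r (nrm a)) - ln (nrm a).
Proof.
move=> r0 a0; rewrite /nu (negbTE a0); case: (leP (nrm a) r) => // _.
by rewrite subrr.
Qed.

Lemma pole_mult0 f z : (\forall w \near z^', f w = 0) -> pole_mult f z = 0%N.
Proof.
move=> h; rewrite /pole_mult; apply: xgetPN => n /pole_of_multP [v hv].
have h2 := has_order_near_neq0 hv.
by have [w [h3 [_ /eqP h4]]] := punct_ex (filterI h h2).
Qed.

(** A representation with denominator (w - z)^n bounds the multiplicity even
    if the numerator vanishes at z. *)
Lemma pole_mult_le f z (n : nat) g : holomorphic_at g z ->
  (\forall w \near z^', f w = g w / (w - z) ^+ n) -> (pole_mult f z <= n)%N.
Proof.
move=> hg fE; have [g0|[k [v [g1 [h1 h2 h3 h4]]]]] := holat_order hg.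
  rewrite pole_mult0//; move/near_punct: g0 => g0; move: fE g0.
  by apply: filterS2 => w -> ->; rewrite mul0r.
have : has_order f z (k%:Z - n%:Z) v.
  exists g1; split; [exact: h1|exact: h2|exact: h3|].
  near=> w; have wz : w - z != 0 by rewrite subr_eq0; near: w; exact: near_punct_neq.
  by rewrite (near fE w)// (near h4 w)// expfzDr// exprnzE mulrA.
move=> /pole_multE ->; case: ifP => // h; rewrite -lez_nat.
by rewrite lez0_abs// opprB lerBlDr lerDl.
Unshelve. all: by end_near. Qed.

Lemma pole_mult_num f z : meromorphic f -> exists g, holomorphic_at g z /\
  \forall w \near z^', f w = g w / (w - z) ^+ (pole_mult f z).
Proof.
move=> mf; have [f0|[m [v hv]]] := mero_order z mf.
  exists (fun=> 0); split; first exact: holat_cst.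
  by apply: filterS f0 => w ->; rewrite mul0r.
rewrite (pole_multE hv); move: hv => [g [h1 h2 h3 h4]].
case: m h4 => n h4.
  exists (fun w => g w * (w - z) ^+ n); split.
    apply: (holatM h1).
    by apply: holat_all => w; exact: hol_subX.
  have -> : (if Posz n <= 0 then `|Posz n|%N else 0%N) = 0%N by case: n h4.
  by apply: filterS h4 => w ->; rewrite expr0 divr1.
by exists g; split; [exact: h1|apply: filterS h4 => w ->].
Qed.

Lemma pole_mult_sub f g z : meromorphic f -> meromorphic g ->
  (pole_mult (fun w => (f w - g w)%R) z <= pole_mult f z + pole_mult g z)%N.
Proof.
move=> mf mg; have [f1 [h1 h2]] := pole_mult_num z mf; have [g1 [k1 k2]] := pole_mult_num z mg.
by have [h [h3 h4]] := quotient_sub h1 k1 h2 k2; exact: pole_mult_le h3 h4.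
Qed.

Lemma mero_pole_generic f : meromorphic f -> generic (fun z => pole_mult f z = 0%N).
Proof.
move=> mf z; have [f0|[m [v hv]]] := mero_order z mf.
  by apply: filterS (near_punct_open f0) => w h; apply: pole_mult0; exact: near_punct.
by apply: filterS (has_order_near_neq0 hv) => w; exact: pole_mult_reg.
Qed.

Lemma generic_seq (P : C -> Prop) rho : generic P -> exists s : seq C, uniq s /\
  forall z, (z \in s) <-> (nrm z <= rho /\ ~ P z).
Proof.
move=> gP; have /finite_seqP [s sE] := generic_finite rho gP.
exists (undup s); split; first exact: undup_uniq.
move=> z; rewrite mem_undup; have : [set` s] z = (nrm z <= rho /\ ~ P z) by rewrite -sE.
by move=> /= ->.
Qed.

Lemma counting_ge0 f r : meromorphic f -> 1 <= r -> 0 <= integrated_counting f r.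
Proof.
move=> mf r1; have [s [us hs]] := generic_seq r (mero_pole_generic mf).
rewrite (@counting_sum f r s)//; last 2 first.
- exact: lt_le_trans r1.
- by move=> a ar /eqP pa; apply/hs.
by apply: sumr_ge0 => a _; rewrite mulr_ge0// nu_ge0.
Qed.

(** The multiplicity of a pole of f - g is at most the sum of the
    multiplicities, and nu is non-negative for r >= 1. *)
Lemma counting_sub f g r : meromorphic f -> meromorphic g -> 1 <= r ->
  integrated_counting (fun w => f w - g w) r <=
  integrated_counting f r + integrated_counting g r.
Proof.
move=> mf mg r1; have r0 : 0 < r by exact: lt_le_trans r1.
have gP := genericI (genericI (mero_pole_generic mf) (mero_pole_generic mg))
  (mero_pole_generic (mero_sub mf mg)).
have [s [us hs]] := generic_seq r gP.
rewrite !(@counting_sum _ r s)//; try by move=> a ar /eqP pa; apply/hs; split => // -[[]].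
rewrite -big_split/=; apply: ler_sum => a _; rewrite -mulrDl -natrD.
by rewrite ler_wpM2r ?nu_ge0// ler_nat; exact: pole_mult_sub.
Qed.

End Counting.

(** * Jensen's formula and the first main theorem *)

Section Factorization.
Context {R : realType}.
Local Notation C := (Cplane R).
Implicit Types (z w a : C) (r s rho : R) (f g : C -> C) (m : int).

(** The default values are taken when f has no order at z, for instance when
    it vanishes identically. *)
Definition ord f z : int := xget 0 [set m | exists v, has_order f z m v].
Definition lead f z : C := xget 0 [set v | has_order f z (ord f z) v].

Lemma has_order_ord f z m v : has_order f z m v -> ord f z = m /\ lead f z = v.
Proof.
move=> h; have oE : ord f z = m.
  have := @xgetPex _ (0 : int) [set m | exists v, has_order f z m v] (ex_intro _ m (ex_intro _ v h)).
  by move=> [u hu]; have [] := has_order_uniq hu h.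
split => //; rewrite /lead oE.
have := @xgetPex _ (0 : C) [set v | has_order f z m v] (ex_intro _ v h).
by move=> hu; have [] := has_order_uniq hu h.
Qed.

Lemma ordP f z : nzm f -> has_order f z (ord f z) (lead f z).
Proof. by move=> /(_ z) [m [v h]]; have [-> ->] := has_order_ord h. Qed.

Lemma lead_neq0 f z : nzm f -> lead f z != 0.
Proof. by move=> /(ordP z) [g [_ _ h _]]. Qed.

(** With o the order of f, the product of powers that carries the zeros and
    poles in s. *)
Definition divprod (o : C -> int) (s : seq C) z := \prod_(a <- s) (z - a) ^ (o a).

Lemma divprod_hol (o : C -> int) (s : seq C) z : z \notin s ->
  holomorphic_at (divprod o s) z /\ divprod o s z != 0.
Proof.
elim: s => [|a s IH].
  split; last by rewrite /divprod big_nil oner_neq0.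
  apply: (@holat_near _ (fun=> 1)); last exact: holat_cst.
  by apply: nearA => w; rewrite /divprod big_nil.
rewrite in_cons negb_or => /andP[za /IH[h1 h2]]; split.
  apply: (@holat_near _ (fun w => (w - a) ^ o a * divprod o s w)).
    by apply: nearA => w; rewrite /divprod big_cons.
  by apply: (holatM _ h1); exact: holat_subz.
by rewrite /divprod big_cons mulf_neq0// expfz_neq0// subr_eq0.
Qed.

Lemma near_notin (s : seq C) z : \forall w \near z^', w \notin s.
Proof.
elim: s => [|a s IH]; first exact: nearA'.
have [->|az] := eqVneq a z.
  have := near_punct_neq z; move: IH; apply: filterS2 => w h1 h2.
  by rewrite in_cons negb_or h2 h1.
have : \forall w \near z^', w != a.
  apply/nearC'P; exists (nrm (a - z)); first by rewrite nrm_gt0 subr_eq0.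
  by move=> w _; apply: contraTneq => ->; rewrite ltxx.
move: IH; apply: filterS2 => w h1 h2.
by rewrite in_cons negb_or h2 h1.
Qed.

(** Outside s define h as the quotient f / divprod. At a point of s the order
    of f cancels the corresponding factor and the leading coefficient gives
    the value of h that makes it holomorphic. The last clause is that value at
    z; it is applied to z = 0 in Jensen's formula. *)
Lemma disc_factor f rho (s : seq C) : nzm f -> uniq s ->
  (forall z, nrm z <= rho -> ~ reg f z -> z \in s) ->
  exists h : C -> C, [/\ forall z, nrm z < rho -> hol h z,
    forall z, nrm z < rho -> h z != 0,
    forall z, z \notin s -> f z = h z * divprod (ord f) s z &
    forall z, z \in s -> lead f z = h z * divprod (ord f) (rem z s) z].
Proof.
move=> nf us hs; set o := ord f.
have split_prod z w : z \in s -> divprod o s w = (w - z) ^ (o z) * divprod o (rem z s) w.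
  by move=> zs; rewrite /divprod (perm_big _ (perm_to_rem zs))/= big_cons.
have rem_notin z : z \notin rem z s by rewrite mem_rem_uniq// inE eqxx.
pose h z := if z \in s then lead f z / divprod o (rem z s) z else f z / divprod o s z.
have main z : nrm z < rho -> holomorphic_at h z /\ h z != 0.
  move=> zr; have [zs|zs] := boolP (z \in s).
    have [p1 p2] := divprod_hol o (rem_notin z).
    have [g [g1 g2 g3 g4]] := ordP z nf.
    split; last by rewrite /h zs mulf_neq0 ?invr_neq0//; exact: lead_neq0.
    apply: (@holat_near _ (fun w => g w / divprod o (rem z s) w)).
      apply: near_punct_pt; last by rewrite /h zs g2.
      near=> w; have ws : w \notin s by near: w; exact: near_notin.
      have wz : w - z != 0 by rewrite subr_eq0; near: w; exact: near_punct_neq.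
      rewrite /h (negbTE ws) (split_prod z w zs) (near g4 w)// invfM.
      have w2 : (w - z) ^ o z != 0 by rewrite expfz_neq0.
      by rewrite mulrA mulfK.
    apply: (holatM g1); exact: holatV.
  have rz : reg f z by apply: contrapT => /(hs _ (ltW zr)); rewrite (negbTE zs).
  have [r1 r2] := rz; have [p1 p2] := divprod_hol o zs.
  split; last by rewrite /h (negbTE zs) mulf_neq0 ?invr_neq0.
  apply: (@holat_near _ (fun w => f w / divprod o s w)).
    apply: near_punct_pt; last by rewrite /h (negbTE zs).
    by apply: filterS (near_notin s z) => w ws; rewrite /h (negbTE ws).
  by apply: (holatM r1); exact: holatV.
exists h; split.
- by move=> z /main [/holat_hol].
- by move=> z /main [].
- move=> z zs; rewrite /h (negbTE zs) divfK//.
  by have [] := divprod_hol o zs.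
- move=> z zs; rewrite /h zs divfK//.
  by have [] := divprod_hol o (rem_notin z).
Unshelve. all: by end_near. Qed.

Lemma ln_nrmXz (x : C) m : x != 0 -> ln (nrm (x ^ m)) = m%:~R * ln (nrm x).
Proof.
move=> x0; have n0 : 0 < nrm x by rewrite nrm_gt0.
case: m => n.
  by rewrite -exprnP nrmX lnXn// -mulr_natl.
rewrite NegzE -invr_expz -exprnP nrmV nrmX lnV ?posrE ?exprn_gt0// lnXn//.
by rewrite mulrNz mulNr -mulr_natl.
Qed.

Lemma ln_nrm_divprod o (s : seq C) z : z \notin s ->
  ln (nrm (divprod o s z)) = \sum_(a <- s) (o a)%:~R * ln (nrm (z - a)).
Proof.
elim: s => [|a s IH]; first by rewrite /divprod !big_nil nrm1 ln1.
rewrite in_cons negb_or => /andP[za zs].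
have za0 : z - a != 0 by rewrite subr_eq0.
rewrite /divprod !big_cons nrmM lnM ?posrE ?nrm_gt0.
- by rewrite ln_nrmXz// -/(divprod o s z) IH.
- by rewrite expfz_neq0.
- by have [] := divprod_hol o zs.
Qed.

(** If |a| > r the function z - a is zero-free on the disc. If |a| < r, then
    on the circle |z - a| is |r^2 - a^* z| / r, and r^2 - a^* z is zero-free
    on a larger disc. *)
Lemma avg_ln_sub r a : 0 < r -> nrm a != r ->
  avg (fun z => ln (nrm (z - a))) r = ln (Num.max r (nrm a)).
Proof.
move=> r0 ar; have [h|h|h] := ltgtP (nrm a) r; last by rewrite h eqxx in ar.
  (* any radius between r and r^2 / |a| would do *)
  pose rho := r * (2 * r / (nrm a + r)).
  have a0 := nrm_ge0 a; have ar0 : 0 < nrm a + r by lra.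
  have rr : r < rho.
    by rewrite /rho ltr_pMr// ltr_pdivlMr//; lra.
  have nz z : nrm z < rho -> (r ^+ 2)%:C%C - a^*%C * z != 0 :> C.
    move=> zr; rewrite -nrm_gt0; apply: lt_le_trans (nrm_lerB _ _).
    rewrite nrm_real nrmM nrmJ ger0_norm ?sqr_ge0// subr_gt0 expr2.
    apply: (@le_lt_trans _ _ (nrm a * rho)); first by rewrite ler_wpM2l// ltW.
    rewrite /rho mulrCA ltr_pM2l// mulrA ltr_pdivrMr//.
    have -> : nrm a * (2 * r) = r * (2 * nrm a) by ring.
    by rewrite ltr_pM2l//; lra.
  have hh z : nrm z < rho -> hol (fun z => (r ^+ 2)%:C%C - a^*%C * z : C) z.
    move=> _; apply: holB; first exact: hol_cst.
    by apply: holM; [exact: hol_cst|exact: hol_id].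
  have J := jensen_zerofree hh nz (ltW r0) rr.
  have -> : avg (fun z => ln (nrm (z - a))) r =
      avg (fun z => ln (nrm ((r ^+ 2)%:C%C - a^*%C * z)) - ln r) r.
    apply: eq_avg; first exact: ltW.
    move=> z zr; have -> : (r ^+ 2)%:C%C - a^*%C * z = z * (z - a)^*%C.
      rewrite -zr -conj_mul rmorphB/=; ring.
    rewrite nrmM nrmJ zr lnM ?posrE// ?nrm_gt0 ?(nrm_lt_neq zr)//; ring.
  rewrite avgB; [|exact: ltW| |exact: cont_circ_cst]; last first.
    move=> z zr; apply: cont_ln_nrm; last by apply: nz; rewrite zr.
    by apply: hol_cont; apply: hh; rewrite zr.
  rewrite J avg_cst mulr0 subr0 nrm_real ger0_norm ?sqr_ge0// lnXn// mulr2n addrK.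
  by [].
have hh z : nrm z < nrm a -> hol (fun z => z - a) z.
  by move=> _; exact: hol_sub.
have nz z : nrm z < nrm a -> z - a != 0.
  by move=> za; rewrite subr_eq0; apply: contraTneq za => ->; rewrite ltxx.
by rewrite (jensen_zerofree hh nz (ltW r0) h) sub0r nrmN.
Qed.

(** On the circle of radius r, f has neither zeros nor singularities, so that
    log |f| is continuous there. *)
Definition regcirc f r := forall z, nrm z = r -> reg f z.

Lemma regcirc_cont f r : regcirc f r -> cont_circ f r.
Proof. by move=> h z /h[/holat_hol/hol_cont]. Qed.

Lemma nonregular_seq f rho : nzm f -> exists s : seq C, uniq s /\
  forall z, (z \in s) <-> (nrm z <= rho /\ ~ reg f z).
Proof. by move=> /nzm_reg /generic_seq. Qed.

Lemma cont_ln_sub r a : nrm a != r -> cont_circ (fun z => ln (nrm (z - a))) r.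
Proof.
move=> ar z zr; apply: (@cont_ln_nrm _ (fun z => z - a)).
  by apply: hol_cont; exact: hol_sub.
by rewrite subr_eq0; apply: contraNneq ar => <-; rewrite zr.
Qed.

(** Factorize f on a slightly larger disc. The zero-free factor contributes
    its value at 0 and the factor z - a contributes log max(r, |a|), which is
    nu plus a constant. These constants combine with the value of the
    zero-free factor into the leading coefficient of f at 0, because divprod
    at 0 is the product of the (- a)^(ord a). *)
Lemma jensen f r : nzm f -> 0 < r -> regcirc f r ->
  avg (fun z => ln (nrm (f z))) r =
  ln (nrm (lead f 0)) + integrated_counting (fun z => (f z)^-1) r - integrated_counting f r.
Proof.
move=> nf r0 rf; have [s [us hs]] := nonregular_seq (r + 1) nf.
have rr : r < r + 1 by rewrite ltrDl.
have [h [h1 h2 h3 h4]] := disc_factor nf us (fun z zr nz => proj2 (hs z) (conj zr nz)).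
have circ a : a \in s -> nrm a != r.
  by move=> /hs[_ na]; apply/eqP => ar; apply: na; exact: rf.
have onc z : nrm z = r -> z \notin s.
  by move=> zr; apply/negP => /circ; rewrite zr eqxx.
have hc : cont_circ (fun z => ln (nrm (h z))) r.
  move=> z zr; apply: cont_ln_nrm; last by apply: h2; rewrite zr.
  by apply: hol_cont; apply: h1; rewrite zr.
have E : avg (fun z => ln (nrm (f z))) r =
    ln (nrm (h 0)) + \sum_(a <- s) (ord f a)%:~R * ln (Num.max r (nrm a)).
  have -> : avg (fun z => ln (nrm (f z))) r = avg (fun z => ln (nrm (h z)) +
      \sum_(a <- s) (if a \in s then (ord f a)%:~R * ln (nrm (z - a)) else 0)) r.
    apply: eq_avg; first exact: ltW.
    move=> z zr; rewrite h3 ?onc// nrmM lnM ?posrE ?nrm_gt0 ?h2 ?zr//; last first.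
      by have [] := divprod_hol (ord f) (onc z zr).
    rewrite ln_nrm_divprod ?onc//; congr (_ + _).
    by rewrite big_seq [RHS]big_seq; apply: eq_bigr => a ->.
  have cs a : cont_circ (fun z => if a \in s then (ord f a)%:~R * ln (nrm (z - a)) else 0) r.
    have [ain|_] := boolP (a \in s); last exact: cont_circ_cst.
    by move=> z zr; exact: (cvgM (cvg_cst _) (cont_ln_sub (circ a ain) zr)).
  rewrite avgD; [|exact: ltW|exact: hc|exact: cont_circ_sum].
  rewrite (jensen_zerofree h1 h2 (ltW r0) rr) avg_sum; [|exact: ltW|exact: cs].
  congr (_ + _); rewrite big_seq [RHS]big_seq; apply: eq_bigr => a as_.
  rewrite as_ avgZ; [|exact: ltW|exact: cont_ln_sub (circ a as_)].
  by rewrite avg_ln_sub// circ.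
have cnt g : (forall a, nrm a <= r -> pole_mult g a != 0%N -> a \in s) ->
    integrated_counting g r = \sum_(a <- s) (pole_mult g a)%:R * nu r a.
  exact: counting_sum.
have inS (g : C -> C) : (forall z, reg f z -> reg g z) ->
    forall a, nrm a <= r -> pole_mult g a != 0%N -> a \in s.
  move=> hg a ar pa; apply/hs; split; first by rewrite (le_trans ar)// ltW.
  by move=> /hg /pole_mult_reg pa0; rewrite pa0 in pa.
rewrite (cnt _ (inS _ (@reg_inv R f))) (cnt _ (inS _ (fun z h => h))) -addrA -sumrB.
have -> : \sum_(a <- s) ((pole_mult (fun z => (f z)^-1) a)%:R * nu r a -
    (pole_mult f a)%:R * nu r a) = \sum_(a <- s) (ord f a)%:~R * nu r a.
  by apply: eq_bigr => a _; rewrite -mulrBl (pole_multB (ordP a nf)).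
rewrite E; have [z0|z0] := boolP (0 \in s).
  rewrite (h4 _ z0) nrmM lnM ?posrE ?nrm_gt0 ?h2 ?nrm0 ?addr_gt0//; last first.
    have n0 : 0 \notin rem 0 s by rewrite mem_rem_uniq// inE eqxx.
    by have [] := divprod_hol (ord f) n0.
  rewrite ln_nrm_divprod; last by rewrite mem_rem_uniq// inE eqxx.
  rewrite !(perm_big _ (perm_to_rem z0))/= !big_cons nrm0 max_l ?(ltW r0)//.
  have nu0 : nu r (0 : C) = ln r by rewrite /nu eqxx.
  rewrite nu0 -addrA; congr (_ + _).
  rewrite addrCA -big_split/=; congr (_ + _); rewrite big_seq [RHS]big_seq.
  apply: eq_bigr => a; rewrite mem_rem_uniq// inE => /andP[a0 _].
  by rewrite nu_max// sub0r nrmN; ring.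
have -> : lead f 0 = f 0.
  have : reg f 0.
    apply: contrapT => nr; have : 0 \in s by apply/hs; rewrite nrm0 addr_ge0// ltW.
    by rewrite (negbTE z0).
  by move=> /reg_order /has_order_ord [].
rewrite h3// nrmM lnM ?posrE ?nrm_gt0 ?h2 ?nrm0 ?addr_gt0//; last first.
  by have [] := divprod_hol (ord f) z0.
rewrite ln_nrm_divprod// -addrA; congr (_ + _).
rewrite -big_split/= big_seq [RHS]big_seq; apply: eq_bigr => a as_.
have a0 : a != 0 by apply: contraNneq z0 => <-.
by rewrite nu_max// sub0r nrmN; ring.
Qed.

Lemma logpB (x : R) : 0 < x -> logp x - logp x^-1 = ln x.
Proof.
move=> x0; rewrite /logp lnV ?posrE//; case: (leP 0 (ln x)) => h.
  by rewrite max_l ?subr0// oppr_le0.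
by rewrite max_r ?oppr_ge0 ?ltW// sub0r opprK.
Qed.

Lemma logp_ge0 (x : R) : 0 <= logp x.
Proof. by rewrite /logp le_max lexx. Qed.

Lemma proximityE f r : proximity f r = avg (fun z => logp (nrm (f z))) r.
Proof. by []. Qed.

Lemma proximity_ge0 f r : 0 <= r -> 0 <= proximity f r.
Proof. by move=> r0; rewrite proximityE; apply: avg_ge0 => // z _; exact: logp_ge0. Qed.

(** In this form the function is continuous, increasing and visibly
    sub-additive up to a constant. *)
Lemma logpE (x : R) : logp x = ln (Num.max 1 x).
Proof.
rewrite /logp; case: (leP x 1) => x1; first by rewrite ln1 max_l// ln_le0.
by rewrite max_r// ln_ge0// ltW.
Qed.

Lemma cont_logp (x : R) : {for x, continuous (@logp R)}.
Proof.
rewrite (funext logpE); have c : {for x, continuous (fun y : R => Num.max 1 y)}.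
  have ci : {for x, continuous (fun y : R => y)} by exact: cvg_id.
  exact: (continuous_max (@cst_continuous R R 1 x) ci).
by apply: (continuous_comp c); apply: continuous_ln; rewrite lt_max ltr01.
Qed.

Lemma cont_circ_logp f r : cont_circ f r -> cont_circ (fun z => logp (nrm (f z))) r.
Proof.
move=> h z zr; have c : {for z, continuous (fun z => nrm (f z))} by exact: (cvgnrm (h z zr)).
by apply: (continuous_comp c); exact: cont_logp.
Qed.

Lemma regcirc_logp f r : regcirc f r -> cont_circ (fun z => logp (nrm (f z))) r.
Proof. by move=> h; apply: cont_circ_logp; exact: regcirc_cont. Qed.

Lemma regcirc_inv f r : regcirc f r -> regcirc (fun z => (f z)^-1) r.
Proof. by move=> h z /h; exact: reg_inv. Qed.

Lemma first_main_theorem f r : nzm f -> 0 < r -> regcirc f r ->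
  characteristic f r = characteristic (fun z => (f z)^-1) r + ln (nrm (lead f 0)).
Proof.
move=> nf r0 rf; have J := jensen nf r0 rf.
have rf' := regcirc_inv rf.
have E : proximity f r - proximity (fun z => (f z)^-1) r = avg (fun z => ln (nrm (f z))) r.
  rewrite !proximityE -avgB; [|exact: ltW|exact: regcirc_logp..].
  apply: eq_avg; first exact: ltW.
  by move=> z /rf[_ fz]; rewrite nrmV logpB// nrm_gt0.
rewrite /characteristic; move: E; rewrite J; lra.
Qed.

End Factorization.

(** * The difference quotient on a disc *)

Section Difference.
Context {R : realType}.
Local Notation C := (Cplane R).
Implicit Types (z w a c : C) (r s rho B : R) (f g : C -> C) (m : int).

Lemma nrm_sub_sq z a : nrm (z - a) ^+ 2 = nrm z ^+ 2 + nrm a ^+ 2 - 2 * Rp (a^*%C * z).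
Proof. rewrite !nrm_sqr !(RpB, IpB) RpM; case: z a => x y [b c] /=; ring. Qed.

Lemma cont_nrm_sub a z : {for z, continuous (fun z => nrm (z - a))}.
Proof.
have h : {for z, continuous (fun w => w - a)}.
  by apply: hol_cont; exact: hol_sub.
exact: (cvgnrm h).
Qed.

Lemma cont_ln1 r a (k : R) : nrm a != r -> 0 <= k ->
  cont_circ (fun z => ln (1 + k / nrm (z - a))) r.
Proof.
move=> ar k0 z zr; have p : 0 < nrm (z - a).
  by rewrite nrm_gt0 subr_eq0; apply: contraNneq ar => <-; rewrite zr.
have ci : {for z, continuous (fun z => (nrm (z - a))^-1)}.
  exact: (cvgV (lt0r_neq0 p) (@cont_nrm_sub a z)).
have cc : {for z, continuous (fun z => 1 + k / nrm (z - a))}.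
  exact: (cvgD (@cst_continuous C R 1 z) (cvgM (@cst_continuous C R k z) ci)).
apply: (continuous_comp cc); apply: continuous_ln.
by rewrite ltr_pwDl// divr_ge0// ltW.
Qed.

(** With M = max r |a| and p = M + B, the function h(z) = p - a^* z / p is
    zero-free on the disc of radius p, |h(0)| = p, and on the circle |h(z)|^2
    - |z - a|^2 is p^2 + |a|^2 r^2 / p^2 - r^2 - |a|^2, which is at least B^2.
    So |z - a|^2 + B^2 is bounded by a quantity whose logarithmic mean is
    known exactly. *)
Lemma disc_dominating r a B : 0 < r -> 0 < B ->
  exists h : C -> C, [/\ forall z, nrm z < Num.max r (nrm a) + B -> hol h z,
    forall z, nrm z < Num.max r (nrm a) + B -> h z != 0,
    nrm (h 0) = Num.max r (nrm a) + B &
    forall z, nrm z = r -> nrm (z - a) ^+ 2 + B ^+ 2 <= nrm (h z) ^+ 2].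
Proof.
move=> r0 B0; set M := Num.max r (nrm a); set p := M + B.
have M0 : 0 < M by rewrite lt_max r0.
have p0 : 0 < p by rewrite addr_gt0.
have aM : nrm a <= M by rewrite le_max lexx orbT.
have rM : r <= M by rewrite le_max lexx.
have a0 := nrm_ge0 a.
pose u : C := (p^-1)%:C%C * a^*%C.
have nu_ : nrm u = nrm a / p by rewrite nrmM nrm_real nrmJ ger0_norm ?invr_ge0 ?ltW// mulrC.
exists (fun z => p%:C%C - u * z); split.
- move=> z _; apply: holB; first exact: hol_cst.
  by apply: holM; [exact: hol_cst|exact: hol_id].
- move=> z zp; rewrite -nrm_gt0; apply: lt_le_trans (nrm_lerB _ _).
  rewrite nrm_real nrmM nu_ gtr0_norm// subr_gt0 -mulrAC ltr_pdivrMr//.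
  apply: (@le_lt_trans _ _ (p * nrm z)); last by rewrite ltr_pM2l.
  by rewrite ler_wpM2r ?nrm_ge0// (le_trans aM)// lerDl ltW.
- by rewrite mulr0 subr0 nrm_real gtr0_norm.
move=> z zr.
have e1 : nrm (z - a) ^+ 2 = r ^+ 2 + nrm a ^+ 2 - 2 * Rp (a^*%C * z).
  by rewrite nrm_sub_sq zr.
have e2 : nrm (p%:C%C - u * z) ^+ 2 = p ^+ 2 + nrm a ^+ 2 * r ^+ 2 / p ^+ 2 - 2 * Rp (a^*%C * z).
  have pz : p != 0 by rewrite gt_eqF.
  rewrite nrm_sub_sq nrm_real real_normK ?num_real// nrmM nu_ zr.
  have -> : Rp ((u * z)^*%C * p%:C%C) = Rp (a^*%C * z).
    have H (q : R) (v : C) : q != 0 -> Rp (((q^-1)%:C%C * v)^*%C * q%:C%C) = Rp v.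
      by move=> qz; case: v => x y /=; field.
    by rewrite /u -mulrA H.
  by field.
rewrite e1 e2.
pose A := nrm a.
have key : r ^+ 2 + A ^+ 2 + B ^+ 2 <= p ^+ 2 + A ^+ 2 * r ^+ 2 / p ^+ 2; last by rewrite -/A; lra.
(* the claim is symmetric in r and A, only their maximum M and minimum m matter *)
have [m [m0 mM [E1 E2]]] : exists m : R, [/\ 0 <= m, m <= M & r ^+ 2 + A ^+ 2 = M ^+ 2 + m ^+ 2 /\
    A ^+ 2 * r ^+ 2 = M ^+ 2 * m ^+ 2].
  rewrite /M -/A; case: (leP r A) => h.
    by exists r; split; [exact: ltW r0|exact: h|split; ring].
  by exists A; split; [exact: a0|exact: ltW h|split; ring].
rewrite E1 E2.
have -> : p ^+ 2 + M ^+ 2 * m ^+ 2 / p ^+ 2 =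
  M ^+ 2 + m ^+ 2 + B ^+ 2 + (2 * M * B - m ^+ 2 * (B * (2 * M + B)) / p ^+ 2).
  by rewrite /p; field; rewrite gt_eqF.
rewrite lerDl subr_ge0 ler_pdivrMr ?exprn_gt0//.
apply: (@le_trans _ _ (M ^+ 2 * (B * (2 * M + B)))).
  rewrite ler_wpM2r ?mulr_ge0//; [exact: ltW|by rewrite addr_ge0 ?mulr_ge0 ?ltW|].
  by rewrite lerXn2r ?nnegrE// ltW.
have -> : 2 * M * B * p ^+ 2 = M ^+ 2 * (B * (2 * M + B)) + M * B * (3 * M * B + 2 * B ^+ 2).
  by rewrite /p; ring.
by rewrite lerDl !(mulr_ge0, addr_ge0) ?exprn_ge0 ?ltW.
Qed.

Lemma ln1D_le (x : R) : 0 <= x -> ln (1 + x) <= x.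
Proof. by move=> x0; apply: le_ln1Dx; rewrite (lt_le_trans _ x0)// ltrN10. Qed.

Lemma halve_le (u1 u2 u3 u4 : R) : u1 *+ 2 <= u2 + u3 *+ 2 -> u2 <= u4 -> u1 <= u4 / 2 + u3.
Proof.
move=> h1 h2; rewrite -(ler_pM2r (ltr0n R 2)) mulrDl divfK ?pnatr_eq0//.
by rewrite !mulr_natr; apply: le_trans h1 _; rewrite lerD2r.
Qed.

(** Since (y + k)^2 <= (1 + k^2 / r) (y^2 + r), with y = |z - a| and B^2 = r,
    the mean of log(y + k) exceeds that of log y by at most k^2 / (2 r) +
    log(M + B) - log M, where M = max r |a|. The bound is uniform in a, even
    for a close to the circle. *)
Lemma avg_ln1 r a (k : R) : 0 < r -> nrm a != r -> 0 <= k ->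
  avg (fun z => ln (1 + k / nrm (z - a))) r <= k ^+ 2 / (2 * r) + (Num.sqrt r)^-1.
Proof.
move=> r0 ar k0; pose B := Num.sqrt r.
have B0 : 0 < B by rewrite sqrtr_gt0.
have B2 : B ^+ 2 = r by rewrite sqr_sqrtr// ltW.
have [h [h1 h2 h3 h4]] := disc_dominating a r0 B0.
set M := Num.max r (nrm a) in h1 h2 h3.
have rM : r <= M by rewrite le_max lexx.
have M0 : 0 < M by exact: lt_le_trans rM.
have rMB : r < M + B by apply: le_lt_trans rM _; rewrite ltrDl.
have ss := ltW r0.
have za z : nrm z = r -> 0 < nrm (z - a).
  by move=> zr; rewrite nrm_gt0 subr_eq0; apply: contraNneq ar => <-; rewrite zr.
have c1 := cont_ln_sub ar.
have c2 : cont_circ (fun z => ln (nrm (h z))) r.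
  move=> z zr; apply: cont_ln_nrm; last by apply: h2; rewrite zr.
  by apply: hol_cont; apply: h1; rewrite zr.
have c3 : cont_circ (fun z => k ^+ 2 / (2 * r) + ln (nrm (h z)) : R) r.
  by move=> z zr; exact: (cvgD (cvg_cst _) (c2 z zr)).
have c4 : cont_circ (fun z => k ^+ 2 / (2 * r) + ln (nrm (h z)) - ln (nrm (z - a)) : R) r.
  by move=> z zr; exact: (cvgB (c3 z zr) (c1 z zr)).
have c5 : cont_circ (fun z => ln (1 + k / nrm (z - a))) r.
  exact: cont_ln1.
apply: (@le_trans _ _ (avg (fun z => k ^+ 2 / (2 * r) + ln (nrm (h z)) - ln (nrm (z - a))) r)).
  apply: (avg_le ss c5 c4) => z zr; have p := za z zr.
  have hz : 0 < nrm (h z) by rewrite nrm_gt0 h2 ?zr.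
  set y := nrm (z - a) in p *.
  have -> : 1 + k / y = (y + k) / y by field; rewrite gt_eqF.
  have yk : 0 < y + k by rewrite ltr_pwDl.
  rewrite lnM ?posrE ?invr_gt0// lnV ?posrE// lerD2r.
  have q0 : 0 <= k ^+ 2 / r by rewrite divr_ge0// exprn_ge0.
  have E : (y + k) ^+ 2 <= (1 + k ^+ 2 / r) * nrm (h z) ^+ 2.
    apply: (@le_trans _ _ ((1 + k ^+ 2 / r) * (y ^+ 2 + r))).
      rewrite -subr_ge0.
      have -> : (1 + k ^+ 2 / r) * (y ^+ 2 + r) - (y + k) ^+ 2 = (r - k * y) ^+ 2 / r.
        by field; rewrite gt_eqF.
      by rewrite divr_ge0// sqr_ge0.
    by rewrite ler_wpM2l ?addr_ge0// -B2; exact: h4.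
  have {}E : ln ((y + k) ^+ 2) <= ln ((1 + k ^+ 2 / r) * nrm (h z) ^+ 2).
    by rewrite ler_ln ?posrE ?mulr_gt0 ?exprn_gt0// ltr_pwDl.
  rewrite lnM ?posrE ?exprn_gt0 ?ltr_pwDl// !lnXn// in E.
  have F := ln1D_le q0.
  have -> : k ^+ 2 / (2 * r) = (k ^+ 2 / r) / 2 by field; rewrite gt_eqF.
  exact: halve_le E F.
rewrite (avgB ss c3 c1) (avgD ss (cont_circ_cst _ _) c2) avg_cst avg_ln_sub// -/M.
rewrite (jensen_zerofree h1 h2 ss rMB) h3 -addrA lerD2l.
have -> : ln (M + B) - ln M = ln (1 + B / M).
  rewrite -[in RHS](divff (lt0r_neq0 M0)) -mulrDl lnM ?posrE ?invr_gt0 ?addr_gt0//.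
  by rewrite lnV ?posrE.
have BM : 0 <= B / M by rewrite divr_ge0// ltW.
apply: le_trans (ln1D_le BM) _.
apply: (@le_trans _ _ (B / r)).
  by rewrite ler_wpM2l ?(ltW B0)// lef_pV2 ?posrE.
by rewrite -{1}B2 expr2 invfM mulrA divff ?gt_eqF// mul1r.
Qed.

Lemma abs_ln (x : R) : 0 < x -> `|ln x| = logp x + logp x^-1.
Proof.
move=> x0; rewrite /logp lnV ?posrE//; case: (leP 0 (ln x)) => h.
  by rewrite max_l ?ger0_norm ?addr0// oppr_le0.
by rewrite max_r ?oppr_ge0 ?ltW// add0r ltr0_norm.
Qed.

Lemma ln_quot_le (x y k : R) : 0 < x -> 0 < y -> x <= y + k -> y <= x + k -> 0 <= k ->
  `|ln x - ln y| <= ln (1 + k / y) + ln (1 + k / x).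
Proof.
move=> x0 y0 xy yx k0.
have main u v : 0 < u -> 0 < v -> u <= v + k -> ln u - ln v <= ln (1 + k / v).
  move=> u0 v0 uv; have -> : 1 + k / v = (v + k) / v by field; rewrite gt_eqF.
  rewrite lnM ?posrE ?invr_gt0 ?ltr_pwDl// lnV ?posrE// lerD2r ler_ln ?posrE//.
  by rewrite ltr_pwDl.
have p u : 0 < u -> 0 <= ln (1 + k / u).
  by move=> u0; apply: ln_ge0; rewrite lerDl divr_ge0// ltW.
have := main _ _ x0 y0 xy; have := main _ _ y0 x0 yx; have := p _ x0; have := p _ y0.
move=> p1 p2 p3 p4; rewrite ler_norml; apply/andP; split; lra.
Qed.

Lemma ord_abs g a : nzm g ->
  `|(ord g a)%:~R| = (pole_mult g a)%:R + (pole_mult (fun z => (g z)^-1) a)%:R :> R.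
Proof.
move=> ng; have h := ordP a ng.
rewrite (pole_mult_real h) (pole_mult_real (has_orderV h)) opprK.
have [m0|m0] := leP 0 (ord g a).
  by rewrite [X in X + _]max_r ?lerz0 ?oppr_le0// max_l ?ler0z// add0r ger0_norm// ler0z.
rewrite [X in X + _]max_l ?ler0z ?oppr_ge0 ?(ltW m0)// max_r ?lerz0 ?(ltW m0)//.
by rewrite addr0 ler0_norm ?lerz0 ?(ltW m0)// mulrNz.
Qed.

(** Each point of s counts in one of the two counting functions, with a weight
    nu of at least log R1 - log rho. This is the usual passage from n to N at
    a larger radius. *)
Lemma ord_count g (s : seq C) rho R1 : nzm g -> uniq s -> 1 <= rho -> rho < R1 ->
  (forall a, a \in s -> nrm a <= rho) ->
  (\sum_(a <- s) `|(ord g a)%:~R|) * (ln R1 - ln rho) <=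
  integrated_counting g R1 + integrated_counting (fun z => (g z)^-1) R1.
Proof.
move=> ng us rho1 rR hs.
have R10 : 0 < R1 by lra.
have R11 : 1 <= R1 by lra.
have [t [ut ht]] := nonregular_seq R1 ng.
pose t' := undup (s ++ t).
have tin a : (a \in t') = (a \in s) || (a \in t) by rewrite mem_undup mem_cat.
have inT (f : C -> C) : (forall z, reg g z -> reg f z) ->
    forall a, nrm a <= R1 -> pole_mult f a != 0%N -> a \in t'.
  move=> hf a ar pa; rewrite tin; apply/orP; right; apply/ht; split => //.
  by move=> /hf /pole_mult_reg pa0; rewrite pa0 in pa.
rewrite !(@counting_sum _ _ R1 t')//; try exact: undup_uniq.
- rewrite -big_split/= mulr_suml.
  have -> : \sum_(a <- s) `|(ord g a)%:~R| * (ln R1 - ln rho) =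
      \sum_(a <- t' | a \in s) `|(ord g a)%:~R| * (ln R1 - ln rho).
    rewrite -[RHS]big_filter; apply: perm_big.
    apply: uniq_perm; [exact: us|by rewrite filter_uniq// undup_uniq|].
    by move=> a; rewrite mem_filter tin; case: (a \in s).
  rewrite [leRHS](bigID (fun a => a \in s))/=.
  have n0 a : 0 <= (pole_mult g a)%:R * nu R1 a +
      (pole_mult (fun z => (g z)^-1) a)%:R * nu R1 a.
    by rewrite addr_ge0// mulr_ge0// nu_ge0.
  rewrite -[leLHS]addr0; apply: lerD; last by apply: sumr_ge0.
  apply: ler_sum => a as_; rewrite -mulrDl -ord_abs//; apply: ler_wpM2l => //.
  have ar := hs a as_; rewrite /nu; case: eqP => [_|/eqP a0].
    by rewrite lerBlDr lerDl ln_ge0.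
  rewrite (le_trans ar (ltW rR)) lerD2l lerN2 ler_ln ?posrE ?nrm_gt0//; lra.
- by apply: inT => z; exact: reg_inv.
- by apply: inT.
Qed.

Lemma reg_shift g c z : reg (fun z => g (z + c)) z -> reg g (z + c).
Proof.
move=> [k1 k2]; split; last exact: k2.
move: k1 => /nearCP[d d0 hd]; apply/nearCP; exists d; first exact: d0.
move=> w wd.
have H : hol (fun z => g (z + c)) (w - c).
  by apply: hd; have -> : w - c - z = w - (z + c) by ring.
have hw : hol (fun w => w - c) w by exact: hol_sub.
have := hol_comp hw H; apply: hol_near; apply: nearA => v /=.
by rewrite subrK.
Qed.

(** The number n is the number of zeros and poles in the disc of radius rho +
    1, with multiplicity. The factorization of g on that disc splits log |g(z
    + c) / g(z)| into the variation of log |h|, which is estimated by the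
    Poisson formula, and one term for each point. The mean of |log |h|| over
    the circle of radius rho is bounded through h = g / divprod by the
    proximity functions of g and 1/g and by the terms log |z - a|, at most
    log(2 rho + 1). *)
Lemma difference_estimate g c r rho R1 : nzm g -> 1 <= r -> r + nrm c < rho -> rho + 1 < R1 ->
  regcirc g r -> regcirc (fun z => g (z + c)) r -> regcirc g rho ->
  exists2 n : R, 0 <= n /\ n * (ln R1 - ln (rho + 1)) <=
      integrated_counting g R1 + integrated_counting (fun z => (g z)^-1) R1 &
  proximity (fun z => g (z + c) / g z) r <=
    4 * rho * nrm c / (rho - (r + nrm c)) ^+ 2 *
      (proximity g rho + proximity (fun z => (g z)^-1) rho + n * (2 * ln (2 * rho + 1))) +
    n * (2 * (nrm c ^+ 2 / (2 * r) + (Num.sqrt r)^-1)).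
Proof.
move=> ng r1 rrho rhoR gr gcr grho.
have r0 : 0 < r by lra.
have c0 := nrm_ge0 c.
have rho0 : 0 < rho by lra.
have rho1 : 1 <= rho + 1 by lra.
have [s [us hs]] := nonregular_seq (rho + 1) ng.
have [h [h1 h2 h3 h4]] := disc_factor ng us (fun z zr nz => proj2 (hs z) (conj zr nz)).
pose o a : R := (ord g a)%:~R.
pose n := \sum_(a <- s) `|o a|.
have n0 : 0 <= n by apply: sumr_ge0.
exists n; first by split => //; apply: ord_count => // a /hs[].
have nreg a : a \in s -> ~ reg g a by move=> /hs[].
have nin z : reg g z -> z \notin s by move=> rz; apply/negP => /nreg.
have lng z : nrm z < rho + 1 -> reg g z ->
    ln (nrm (g z)) = ln (nrm (h z)) + \sum_(a <- s) o a * ln (nrm (z - a)).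
  move=> zr rz; have zs := nin z rz; rewrite h3// nrmM lnM ?posrE ?nrm_gt0 ?h2//.
    by rewrite ln_nrm_divprod.
  by have [] := divprod_hol (ord g) zs.
have Mrho : avg (fun z => `|ln (nrm (h z))|) rho <=
    proximity g rho + proximity (fun z => (g z)^-1) rho + n * (2 * ln (2 * rho + 1)).
  have rr := ltW rho0.
  have arho a : a \in s -> nrm a != rho by move=> /nreg na; apply/eqP => ar; apply: na; exact: grho.
  (* the test a \in s makes the summands continuous for all a *)
  pose F a z := if a \in s then `|o a| * (2 * ln (2 * rho + 1) - ln (nrm (z - a))) else 0.
  have cF a : cont_circ (F a) rho.
    rewrite /F; have [ain|_] := boolP (a \in s); last exact: cont_circ_cst.
    by move=> z zr; exact: (cvgM (cvg_cst _) (cvgB (cvg_cst _) (cont_ln_sub (arho a ain) zr))).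
  have cg := regcirc_logp grho; have cgi := regcirc_logp (regcirc_inv grho).
  have cs := cont_circ_sum (s := s) cF.
  have cgg : cont_circ (fun z => logp (nrm (g z)) + logp (nrm (g z)^-1)) rho.
    by move=> z zr; exact: (cvgD (cg z zr) (cgi z zr)).
  have call : cont_circ (fun z => logp (nrm (g z)) + logp (nrm (g z)^-1) + \sum_(a <- s) F a z) rho.
    by move=> z zr; exact: (cvgD (cgg z zr) (cs z zr)).
  have ch : cont_circ (fun z => `|ln (nrm (h z))|) rho.
    move=> z zr; have zr1 : nrm z < rho + 1 by rewrite zr ltrDl.
    have ch0 := cont_ln_nrm (hol_cont (h1 z zr1)) (h2 z zr1).
    exact: (cvg_norm ch0).
  apply: (@le_trans _ _ (avg (fun z => logp (nrm (g z)) + logp (nrm (g z)^-1) + \sum_(a <- s) F a z) rho)).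
    apply: (avg_le rr ch call) => z zr.
    have rz := grho z zr; have zr1 : nrm z < rho + 1 by rewrite zr ltrDl.
    have gz : 0 < nrm (g z) by rewrite nrm_gt0; case: rz.
    have E := lng z zr1 rz.
    have -> : ln (nrm (h z)) = ln (nrm (g z)) - \sum_(a <- s) o a * ln (nrm (z - a)) by rewrite E addrK.
    apply: le_trans (ler_normB _ _) _; rewrite abs_ln// nrmV lerD2l.
    apply: le_trans (ler_norm_sum _ _ _) _; rewrite big_seq [leRHS]big_seq.
    apply: ler_sum => a as_; rewrite /F as_ normrM ler_wpM2l//.
    have za : 0 < nrm (z - a).
      by rewrite nrm_gt0 subr_eq0; apply: contraTneq as_ => <-; exact: nin.
    have zle : nrm (z - a) <= 2 * rho + 1.
      by apply: le_trans (nrmB _ _) _; have [] := proj1 (hs a) as_; rewrite zr; lra.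
    have l1 : ln (nrm (z - a)) <= ln (2 * rho + 1) by rewrite ler_ln ?posrE//; lra.
    have l2 : 0 <= ln (2 * rho + 1) by apply: ln_ge0; lra.
    by rewrite ler_norml; apply/andP; split; lra.
  rewrite (avgD rr cgg cs) (avgD rr cg cgi) -!proximityE lerD2l (avg_sum rr _ cF).
  rewrite /n mulr_suml big_seq [leRHS]big_seq; apply: ler_sum => a as_.
  have ar := arho a as_.
  have cl := cont_ln_sub ar.
  have cl2 : cont_circ (fun z => 2 * ln (2 * rho + 1) - ln (nrm (z - a)) : R) rho.
    by move=> z zr; exact: (cvgB (cvg_cst _) (cl z zr)).
  rewrite /F as_ (avgZ rr _ cl2) ler_wpM2l//.
  rewrite (avgB rr (cont_circ_cst _ _) cl) avg_cst avg_ln_sub// lerBlDr lerDl.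
  by apply: ln_ge0; rewrite le_max; apply/orP; left; lra.
set K := 4 * rho * nrm c / (rho - (r + nrm c)) ^+ 2.
have K0 : 0 <= K by rewrite divr_ge0 ?exprn_ge0 ?subr_ge0 ?(ltW rrho)// !mulr_ge0// ltW.
have rr := ltW r0.
have ar a : a \in s -> nrm a != r by move=> /nreg na; apply/eqP => ar; apply: na; exact: gr.
have acr a : a \in s -> nrm (a - c) != r.
  move=> /nreg na; apply/eqP => ar'; apply: na.
  by have := reg_shift (gcr _ ar'); rewrite subrK.
pose G a z := if a \in s then `|o a| * (ln (1 + nrm c / nrm (z - a)) + ln (1 + nrm c / nrm (z - (a - c)))) else 0.
have cln a : nrm a != r -> cont_circ (fun z => ln (1 + nrm c / nrm (z - a))) r.
  by move=> ar'; apply: cont_ln1.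
have cG a : cont_circ (G a) r.
  rewrite /G; have [ain|_] := boolP (a \in s); last exact: cont_circ_cst.
  move=> z zr.
  exact: (cvgM (cvg_cst _) (cvgD (cln a (ar a ain) z zr) (cln (a - c) (acr a ain) z zr))).
set A := avg (fun z => `|ln (nrm (h z))|) rho in Mrho.
have regq : regcirc (fun z => g (z + c) / g z) r.
  move=> z zr; have [k1 k2] := gr z zr; have [k3 k4] := gcr z zr; split.
    by apply: (holatM k3); exact: holatV.
  by rewrite mulf_neq0// invr_neq0.
have cq := regcirc_logp regq.
have csG := cont_circ_sum (s := s) cG.
have call : cont_circ (fun z => K * A + \sum_(a <- s) G a z) r.
  by move=> z zr; exact: (cvgD (cvg_cst _) (csG z zr)).
rewrite proximityE.
apply: (@le_trans _ _ (avg (fun z => K * A + \sum_(a <- s) G a z) r)).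
  apply: (avg_le rr cq call) => z zr.
  have [k1 k2] := regq z zr.
  have rz := gr z zr.
  have rzc : reg g (z + c).
    exact: reg_shift (gcr z zr).
  have zcr : nrm (z + c) <= r + nrm c by apply: le_trans (nrmD _ _) _; rewrite zr.
  have g1 : 0 < nrm (g z) by rewrite nrm_gt0; case: rz.
  have g2 : 0 < nrm (g (z + c)) by rewrite nrm_gt0; case: rzc.
  apply: (@le_trans _ _ `|ln (nrm (g (z + c))) - ln (nrm (g z))|).
    rewrite nrmM nrmV /logp lnM ?posrE ?invr_gt0// lnV ?posrE//.
    by rewrite ge_max normr_ge0 ler_norm.
  rewrite !lng//; [|rewrite ?zr; lra..].
  have -> : ln (nrm (h (z + c))) + \sum_(a <- s) o a * ln (nrm (z + c - a)) -
      (ln (nrm (h z)) + \sum_(a <- s) o a * ln (nrm (z - a))) =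
      (ln (nrm (h (z + c))) - ln (nrm (h z))) +
      \sum_(a <- s) o a * (ln (nrm (z + c - a)) - ln (nrm (z - a))).
    under [X in _ = _ + X]eq_bigr do rewrite mulrBr.
    by rewrite sumrB; ring.
  apply: le_trans (ler_normD _ _) _; apply: lerD.
    have := @poisson_diff R h (rho + 1) h1 h2 rho (r + nrm c) (z + c) z rho0 _ rrho zcr _.
    have -> : z + c - z = c by ring.
    by apply; [rewrite ltrDl|rewrite zr lerDl].
  apply: le_trans (ler_norm_sum _ _ _) _; rewrite big_seq [leRHS]big_seq.
  apply: ler_sum => a as_; rewrite /G as_ normrM ler_wpM2l//.
  have ez : z - (a - c) = z + c - a by ring.
  rewrite ez; apply: ln_quot_le => //.
  - by rewrite nrm_gt0 subr_eq0; apply: contraTneq as_ => <-; exact: nin.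
  - by rewrite nrm_gt0 subr_eq0; apply: contraTneq as_ => <-; exact: nin.
  - by rewrite addrAC; exact: nrmD.
  - by have := nrmB (z + c - a) c; have -> : z + c - a - c = z - a :> C by rewrite addrAC addrK.
rewrite (avgD rr (cont_circ_cst _ _) csG) avg_cst (avg_sum rr _ cG).
apply: lerD; first by rewrite ler_wpM2l.
rewrite /n mulr_suml big_seq [leRHS]big_seq; apply: ler_sum => a as_.
have ca1 := cln a (ar a as_); have ca2 := cln (a - c) (acr a as_).
have ca3 : cont_circ (fun z => ln (1 + nrm c / nrm (z - a)) + ln (1 + nrm c / nrm (z - (a - c))) : R) r.
  by move=> z zr; exact: (cvgD (ca1 z zr) (ca2 z zr)).
rewrite /G as_ (avgZ rr _ ca3) ler_wpM2l// (avgD rr ca1 ca2) mulr2n mulrDl !mul1r.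
by apply: lerD; apply: avg_ln1 => //; [exact: ar|exact: acr].
Qed.

End Difference.

(** * Logarithmic measure and moderate growth *)

Section LogMeasure.
Context {R : realType}.
Local Notation mu := (@lebesgue_measure R).
Implicit Types (E F G B : set R) (T : R -> R) (r : R) (i j K : nat).

Lemma log_density_measurable E : E `<=` `]0, +oo[ -> measurable E ->
  measurable_fun E (fun t : R => (t^-1)%:E).
Proof.
move=> E0 mE; apply/measurable_EFinP.
have mI : measurable (`]0, +oo[%classic : set R) by exact: measurable_itv.
apply: (measurable_funS mI E0).
apply: open_continuous_measurable_fun; first exact: interval_open.
move=> t; rewrite inE /= in_itv/= andbT => t0.
by apply: inv_continuous; rewrite gt_eqF.
Qed.

Lemma log_density_ge0 E : E `<=` `]0, +oo[ -> forall t, E t -> (0 <= (t^-1)%:E)%E.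
Proof. by move=> E0 t /E0 /=; rewrite in_itv/= andbT lee_fin invr_ge0 => /ltW. Qed.

Lemma flm_setU E F : finite_log_measure E -> finite_log_measure F ->
  finite_log_measure (E `|` F).
Proof.
move=> [E0 mE iE] [F0 mF iF]; have EF0 : E `|` F `<=` `]0, +oo[ by rewrite subUset.
have mEF : measurable (E `|` F) by exact: measurableU.
have mFE : measurable (F `\` E) by exact: measurableD.
split => //; have eU : E `|` F = E `|` (F `\` E) by rewrite setDE setUIr setUv setIT.
rewrite eU ge0_integral_setU//; rewrite -?eU.
- apply: lte_add_pinfty => //; apply: le_lt_trans iF.
  apply: ge0_subset_integral => //; [exact: log_density_measurable|exact: log_density_ge0].
- exact: log_density_measurable.
- exact: log_density_ge0.
- by apply/disj_setPS => t [Et [_]].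
Qed.

Lemma flm_set0 : finite_log_measure (set0 : set R).
Proof. by split => //; rewrite integral_set0. Qed.

Lemma flm_bigcup (n : nat) (E : nat -> set R) :
  (forall i, (i < n)%N -> finite_log_measure (E i)) ->
  exists2 F, finite_log_measure F & forall i, (i < n)%N -> E i `<=` F.
Proof.
elim: n => [|n IH] h; first by exists set0; [exact: flm_set0|].
have [F fF hF] := IH (fun i ni => h i (ltnW ni)).
exists (F `|` E n); first by apply: flm_setU => //; exact: h.
move=> i; rewrite ltnS leq_eqVlt => /predU1P[->|ni] t Et; first by right.
by left; apply: (hF i).
Qed.

Lemma flm_countable E : countable E -> finite_log_measure (E `&` `]0, +oo[).
Proof.
move=> cE; have cE' : countable (E `&` `]0, +oo[).
  by apply: sub_countable cE; apply: subset_card_le => t [].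
have mE : measurable (E `&` `]0, +oo[) by apply: countable_measurable => // x; exact: measurable_set1.
have E0 : E `&` `]0, +oo[ `<=` `]0, +oo[ by move=> t [].
split; [exact: E0|exact: mE|].
rewrite null_set_integral//; last exact: countable_lebesgue_measure0.
exact: log_density_measurable.
Qed.

(** The radii whose sixteenth root lies between 2^j and 2^(j + 1). *)
Definition block j : set R := `[((2 ^+ j) ^+ 16), ((2 ^+ j.+1) ^+ 16)[%classic.

Lemma block_unique i j r : block i r -> block j r -> i = j.
Proof.
have main k l : block k r -> block l r -> (l <= k)%N.
  rewrite /block /= !in_itv/= => /andP[_ h1] /andP[h2 _].
  have := le_lt_trans h2 h1; rewrite ltr_pXn2r ?nnegrE ?exprn_ge0//.
  by rewrite ltr_eXn2l ?ltr1n// ltnS.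
by move=> h1 h2; apply/eqP; rewrite eqn_leq !main.
Qed.

Lemma block_cover r : 2 ^+ 16 <= r -> exists2 j, (0 < j)%N & block j r.
Proof.
move=> r2; have ex : exists n, r < (2 ^+ n.+1) ^+ 16.
  exists (Num.truncn r).+1; apply: (@lt_trans _ _ (Num.truncn r).+1%:R); first exact: truncnS_gt.
  apply: (@lt_le_trans _ _ (2 ^+ (Num.truncn r).+2)).
    by rewrite -natrX ltr_nat (ltn_trans (ltnSn _))// ltn_expl.
  by rewrite ler_eXnr// exprn_ege1// ler1n.
case: (ex_minnP ex) => j hj jmin; exists j; last first.
  rewrite /block /= in_itv/= hj andbT; case: j hj jmin => [|j] hj jmin.
    by rewrite expr0 expr1n (le_trans _ r2)// exprn_ege1// ler1n.
  by rewrite leNgt; apply/negP => /jmin; rewrite ltnn.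
case: j hj {jmin} => // hj.
by have := le_lt_trans r2 hj; rewrite expr1 ltxx.
Qed.

(** In block j the density 1/t is at most 2^(-16 j) and the interval has
    length 2 (2^(j + 1))^12. So its logarithmic measure is O(2^(-4 j)), and
    these numbers have a finite sum. *)
Lemma flm_blocks (p : nat -> R) : finite_log_measure
  (\bigcup_j (block j `&` `[p j - (2 ^+ j.+1) ^+ 12, p j + (2 ^+ j.+1) ^+ 12])).
Proof.
set F := fun j => _.
have F0 j : F j `<=` `]0, +oo[.
  move=> t [/=]; rewrite /block/= !in_itv/= andbT => /andP[h _] _.
  by apply: lt_le_trans h; rewrite !exprn_gt0.
have mF j : measurable (F j) by apply: measurableI; exact: measurable_itv.
have sF : \bigcup_j F j `<=` `]0, +oo[ by move=> t [j _]; exact: F0.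
have mU : measurable (\bigcup_j F j) by exact: bigcup_measurable.
split => //.
rewrite ge0_integral_bigcup//; first last.
- by move=> i j _ _ [t [[h1 _] [h2 _]]]; exact: block_unique h1 h2.
- exact: log_density_ge0.
- exact: log_density_measurable.
apply: (@le_lt_trans _ _ (2 ^+ 14)%:E); last exact: ltry.
have h0 : (0 : R) <= 2 ^+ 14 by exact: exprn_ge0.
apply: le_trans (epsilon_trick0 _ h0).
apply: lee_nneseries => [j _ _|j _].
  by apply: integral_ge0 => x; exact: (@log_density_ge0 (F j) (F0 j) x).
set X : R := 2 ^+ j; have X1 : 1 <= X by rewrite exprn_ege1// ler1n.
have X0 : 0 < X by exact: lt_le_trans X1.
apply: (@le_trans _ _ (\int[mu]_(x in F j) cst ((X ^+ 16)^-1)%:E x)%E).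
  apply: ge0_le_integral.
  - exact: mF j.
  - exact: (log_density_ge0 (@F0 j)).
  - exact: (log_density_measurable (@F0 j) (mF j)).
  - exact: measurable_cst.
  - move=> t [/=]; rewrite /block/= in_itv/= => /andP[h _] _.
    by rewrite lee_fin lef_pV2 ?posrE ?exprn_gt0//; apply: lt_le_trans h; rewrite exprn_gt0.
rewrite integral_cst; last exact: mF.
apply: (@le_trans _ _ (((X ^+ 16)^-1)%:E * (2 * (2 * X) ^+ 12)%:E)%E).
  apply: lee_wpmul2l; first by rewrite lee_fin invr_ge0 exprn_ge0// ltW.
  have -> : (2 * (2 * X) ^+ 12)%:E =
      mu `[p j - (2 ^+ j.+1) ^+ 12, p j + (2 ^+ j.+1) ^+ 12].
    have d0 : (0 : R) < (2 ^+ j.+1) ^+ 12 by rewrite !exprn_gt0.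
    rewrite lebesgue_measure_itv/= lte_fin.
    have -> : p j - (2 ^+ j.+1) ^+ 12 < p j + (2 ^+ j.+1) ^+ 12 by lra.
    by rewrite -EFinB /X -exprS; congr EFin; ring.
  apply: le_measure; last by move=> t [].
    by rewrite inE; exact: mF.
  by rewrite inE; exact: measurable_itv.
rewrite -EFinM lee_fin.
have -> : (2 ^ j.+1)%:R = 2 * X by rewrite natrX exprS.
have -> : (X ^+ 16)^-1 * (2 * (2 * X) ^+ 12) = 2 ^+ 14 / (2 * X) / X ^+ 3.
  by field; rewrite gt_eqF.
rewrite ler_pdivrMr ?exprn_gt0// ler_peMr ?exprn_ege1 ?ler1n//.
by rewrite divr_ge0// mulr_ge0// ltW.
Qed.

Definition root16 r : R := Num.sqrt (Num.sqrt (Num.sqrt (Num.sqrt r))).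

Lemma root16K r : 0 <= r -> root16 r ^+ 16 = r.
Proof.
move=> r0; rewrite /root16.
have E (x : R) : x ^+ 16 = (((x ^+ 2) ^+ 2) ^+ 2) ^+ 2 by rewrite -!exprM.
by rewrite E !sqr_sqrtr// !sqrtr_ge0.
Qed.

Lemma root16_ge0 r : 0 <= root16 r.
Proof. exact: sqrtr_ge0. Qed.

Lemma block_root16 j r : block j r -> 2 ^+ j <= root16 r < 2 ^+ j.+1.
Proof.
rewrite /block /= in_itv/= => /andP[h1 h2].
have r0 : 0 <= r by apply: le_trans h1; rewrite !exprn_ge0.
move: h1 h2; rewrite -{1 2}(root16K r0).
by rewrite ler_pXn2r ?ltr_pXn2r ?nnegrE ?root16_ge0 ?exprn_ge0// => -> ->.
Qed.

Lemma exists_power_level (X t : R) n : 1 <= t -> t < X ^+ n ->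
  exists2 i, (i < n)%N & X ^+ i <= t < X ^+ i.+1.
Proof.
move=> t1; elim: n => [|n IH]; first by rewrite expr0 ltNge t1.
move=> tX; case: (ltP t (X ^+ n)) => h; last by exists n => //; rewrite h tX.
by have [i ni hi] := IH h; exists i => //; exact: ltnW.
Qed.

(** Suppose that r is bad, that is, every admissible s in G has T(s) > root16
    r T(r), and let p < r be bad radii of the same block j with T(p) and T(r)
    between X^i and X^(i + 1), X = 2^j. If r exceeded p by (2 X)^12, then r
    would be an admissible s for p and T(r) > X T(p) >= X^(i + 1), a
    contradiction. So the bad radii of a given block and level lie in one
    interval of half-length (2 X)^12 around any of them. The levels are i <=
    32 K, since T <= r^K and r < (2 X)^16. *)
Lemma moderate_growth G T K r0 : (forall r, r0 <= r -> G r -> 1 <= T r <= r ^+ K) ->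
  exists2 E, finite_log_measure E & exists r1, forall r, r1 <= r -> G r -> ~ E r ->
  exists s, [/\ G s, r + root16 r ^+ 12 <= s, s <= 2 ^+ 16 * r & T s <= root16 r * T r].
Proof.
move=> hT; pose N := (32 * K).+1.
pose B r := G r /\ forall s, G s -> r + root16 r ^+ 12 <= s -> s <= 2 ^+ 16 * r ->
  root16 r * T r < T s.
pose Q i j r := [/\ B r, block j r & (2 ^+ j) ^+ i <= T r < (2 ^+ j) ^+ i.+1].
pose p i j := get (Q i j).
have [E fE hE] := @flm_bigcup N _ (fun i _ => flm_blocks (p i)).
exists E => //; exists (Num.max r0 (2 ^+ 16)) => r.
rewrite ge_max => /andP[rr0 r16] Gr nEr; apply: contrapT => nex.
have Br : B r.
  split => // s Gs h1 h2; rewrite ltNge; apply/negP => h3; apply: nex.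
  by exists s.
have [j j0 rj] := block_cover r16.
set X : R := 2 ^+ j.
have X2 : 2 <= X by rewrite -{1}(expr1 2) ler_weXn2l// ler1n.
have /andP[Tr1 TrK] := hT r rr0 Gr.
have TX : T r < X ^+ N.
  apply: le_lt_trans TrK _.
  apply: (@le_lt_trans _ _ (X ^+ (32 * K))); last first.
    by rewrite /N ltr_eXn2l// (lt_le_trans _ X2)// ltr1n.
  rewrite exprM lerXn2r ?nnegrE ?exprn_ge0 ?(le_trans _ r16) ?(le_trans _ X2)//.
  move: rj; rewrite /block/= in_itv/= => /andP[_ /ltW h]; apply: le_trans h _.
  have -> : X ^+ 32 = (X * X) ^+ 16 by rewrite -expr2 -exprM.
  by rewrite lerXn2r ?nnegrE ?exprn_ge0 ?mulr_ge0 ?(le_trans _ X2)// exprS ler_wpM2r ?(le_trans _ X2).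
have [i iN hi] := exists_power_level Tr1 TX.
have Qr : Q i j r by split.
have [Bp pj hp] : Q i j (p i j) by apply: getPex; exists r.
apply: nEr; apply: (hE i iN); exists j => //; split => //.
have main u v : Q i j u -> Q i j v -> v <= u + (2 ^+ j.+1) ^+ 12.
  move=> [[Gu Bu] uj /andP[hu _]] [[Gv _] vj /andP[_ hv]].
  rewrite leNgt; apply/negP => uv.
  have /andP[ru1 ru2] := block_root16 uj.
  have wu : root16 u ^+ 12 <= (2 ^+ j.+1) ^+ 12.
    by rewrite lerXn2r ?nnegrE ?root16_ge0 ?exprn_ge0// ltW.
  have h1 : u + root16 u ^+ 12 <= v by lra.
  have h2 : v <= 2 ^+ 16 * u.
    move: uj vj; rewrite /block/= !in_itv/= => /andP[k1 _] /andP[_ /ltW k2].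
    apply: le_trans k2 _; rewrite (exprS 2 j) exprMn.
    by rewrite ler_wpM2l ?exprn_ge0.
  have := Bu v Gv h1 h2; apply/negP; rewrite -leNgt.
  apply: (le_trans (ltW hv)); rewrite exprS.
  by apply: ler_pM => //; rewrite ?exprn_ge0.
have m1 := main _ _ Qr (And3 Bp pj hp).
have m2 := main _ _ (And3 Bp pj hp) Qr.
by rewrite /= in_itv/= m2 andbT lerBlDr.
Qed.

End LogMeasure.

(** * Proximity functions *)

Section Proximity.
Context {R : realType}.
Local Notation C := (Cplane R).
Implicit Types (f g : C -> C) (r x y : R) (z w a c : C).

Lemma logp_le x y : x <= y -> logp x <= logp y.
Proof.
move=> xy; rewrite !logpE ler_ln ?posrE ?lt_max ?ltr01//.
by rewrite ge_max !le_max lexx xy orbT.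
Qed.

Lemma logpM x y : 0 <= x -> 0 <= y -> logp (x * y) <= logp x + logp y.
Proof.
move=> x0 y0; rewrite !logpE -lnM ?posrE ?lt_max ?ltr01//.
have h1 : 1 <= Num.max 1 x by rewrite le_max lexx.
have h2 : 1 <= Num.max 1 y by rewrite le_max lexx.
have h : 1 <= Num.max 1 x * Num.max 1 y by exact: mulr_ege1.
rewrite ler_ln ?posrE ?(lt_le_trans _ h) ?lt_max ?ltr01// ge_max h/=.
by rewrite ler_pM// le_max lexx orbT.
Qed.

Lemma logpD x y : 0 <= x -> 0 <= y -> logp (x + y) <= logp x + logp y + ln 2.
Proof.
move=> x0 y0; rewrite !logpE -!lnM ?posrE ?mulr_gt0 ?lt_max ?ltr01//.
set u := Num.max 1 x; set v := Num.max 1 y.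
have [u1 v1] : 1 <= u /\ 1 <= v by rewrite !le_max lexx.
have [xu yv] : x <= u /\ y <= v by split; rewrite le_max lexx orbT.
have uv : (u - 1) * (v - 1) >= 0 by rewrite mulr_ge0 ?subr_ge0.
have uv1 : 1 <= u * v by rewrite mulr_ege1.
have h : Num.max 1 (x + y) <= u * v * 2 by rewrite ge_max; apply/andP; split; lra.
rewrite ler_ln ?posrE ?lt_max ?ltr01//.
by rewrite mulr_gt0// (lt_le_trans _ uv1).
Qed.

Definition holcirc f r := forall z, nrm z = r -> holomorphic_at f z.

Lemma holcirc_cont f r : holcirc f r -> cont_circ f r.
Proof. by move=> h; apply: cont_circ_hol => z zr; apply: holat_hol; exact: h. Qed.

Lemma holcirc_logp f r : holcirc f r -> cont_circ (fun z => logp (nrm (f z))) r.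
Proof. by move=> h; apply: cont_circ_logp; exact: holcirc_cont. Qed.

Lemma holcircB f g r : holcirc f r -> holcirc g r -> holcirc (fun z => f z - g z) r.
Proof. by move=> h1 h2 z zr; apply: holatB; [exact: h1|exact: h2]. Qed.

Lemma holcircM f g r : holcirc f r -> holcirc g r -> holcirc (fun z => f z * g z) r.
Proof. by move=> h1 h2 z zr; apply: holatM; [exact: h1|exact: h2]. Qed.

Lemma regcirc_hol f r : regcirc f r -> holcirc f r.
Proof. by move=> h z zr; have [] := h z zr. Qed.

Lemma proximityD_le f g h r : 0 <= r -> holcirc f r -> holcirc g r -> holcirc h r ->
  (forall z, nrm z = r -> nrm (h z) <= nrm (f z) + nrm (g z)) ->
  proximity h r <= proximity f r + proximity g r + ln 2.
Proof.
move=> r0 hf hg hh H; have cf := holcirc_logp hf; have cg := holcirc_logp hg.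
have cfg : cont_circ (fun z => logp (nrm (f z)) + logp (nrm (g z)) : R) r.
  by move=> z zr; exact: (cvgD (cf z zr) (cg z zr)).
have call : cont_circ (fun z => logp (nrm (f z)) + logp (nrm (g z)) + ln 2 : R) r.
  by move=> z zr; exact: (cvgD (cfg z zr) (cvg_cst _)).
rewrite !proximityE -(avgD r0 cf cg) -[X in _ + X](avg_cst r (ln 2)).
rewrite -(avgD r0 cfg (cont_circ_cst _ _)).
apply: (avg_le r0 (holcirc_logp hh) call) => z zr.
apply: le_trans (logp_le (H z zr)) _; apply: logpD; exact: nrm_ge0.
Qed.

Lemma proximityB f g r : 0 <= r -> holcirc f r -> holcirc g r ->
  proximity (fun z => f z - g z) r <= proximity f r + proximity g r + ln 2.
Proof.
move=> r0 hf hg; apply: proximityD_le; [exact: r0|exact: hf|exact: hg|exact: holcircB|].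
by move=> z _; exact: nrmB.
Qed.

Lemma proximityM f g r : 0 <= r -> holcirc f r -> holcirc g r ->
  proximity (fun z => f z * g z) r <= proximity f r + proximity g r.
Proof.
move=> r0 hf hg; have cf := holcirc_logp hf; have cg := holcirc_logp hg.
have cfg : cont_circ (fun z => logp (nrm (f z)) + logp (nrm (g z)) : R) r.
  by move=> z zr; exact: (cvgD (cf z zr) (cg z zr)).
rewrite !proximityE -(avgD r0 cf cg).
apply: (avg_le r0 (holcirc_logp (holcircM hf hg)) cfg) => z zr.
by rewrite nrmM; apply: logpM; exact: nrm_ge0.
Qed.

Lemma eq_proximity f g r : 0 <= r -> (forall z, nrm z = r -> f z = g z) -> proximity f r = proximity g r.
Proof. by move=> r0 h; rewrite !proximityE; apply: eq_avg => // z /h ->. Qed.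

Lemma characteristicB f g r : meromorphic f -> meromorphic g -> 1 <= r ->
  holcirc f r -> holcirc g r ->
  characteristic (fun z => f z - g z) r <= characteristic f r + characteristic g r + ln 2.
Proof.
move=> mf mg r1 hf hg; have := proximityB (le_trans ler01 r1) hf hg.
by have := counting_sub mf mg r1; rewrite /characteristic; lra.
Qed.

Lemma counting_cst (k : C) r : 0 < r -> integrated_counting (fun=> k) r = 0.
Proof.
move=> r0; rewrite (@counting_sum _ _ _ [::]) ?big_nil// => a _.
have -> : pole_mult (fun=> k : C) a = 0%N; last by [].
have [->|k0] := eqVneq k 0; first by apply: pole_mult0; apply: nearA'.
by apply: pole_mult_reg; split; [exact: holat_cst|exact: k0].
Qed.

Lemma proximity_cst (k : C) r : 0 < r -> proximity (fun=> k) r = logp (nrm k).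
Proof. by move=> r0; rewrite proximityE avg_cst. Qed.

Lemma proximity_le_char f r : meromorphic f -> 1 <= r -> proximity f r <= characteristic f r.
Proof. by move=> mf r1; rewrite /characteristic lerDl counting_ge0. Qed.

(** A zero z0 of f is a pole of 1/f, which contributes at least nu r z0. *)
Lemma char_zero f z0 r : nzm f -> holomorphic_at f z0 -> f z0 = 0 -> 1 <= r -> nrm z0 <= r ->
  nu r z0 <= integrated_counting (fun z => (f z)^-1) r.
Proof.
move=> nf hf f0 r1 z0r; have [m [v hm]] := nf z0.
have v0 : v != 0 by case: hm => g [].
have m0 : 0 < m.
  case: (holat_order hf) => [n0|[k [u hk]]].
    have [w [w1 [_ w2]]] := punct_ex (filterI (near_punct n0) (has_order_near_neq0 hm)).
    by rewrite w1 eqxx in w2.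
  have [-> _] := has_order_uniq hm hk; rewrite ltz_nat lt0n; apply/eqP => k0.
  move: hk; rewrite k0 => -[g [hg gv u0 n]].
  have := cont_punct_eq (hol_cont (holat_hol hf)) (hol_cont (holat_hol hg)).
  rewrite f0 gv => /(_ _)/esym E; move/eqP: u0; apply; apply: E.
  by move: n; apply: filterS => w ->; rewrite expr0z mulr1.
have mi := nzm_mero (nzm_inv nf).
have [s [us hs]] := generic_seq r (mero_pole_generic mi).
rewrite (@counting_sum _ _ _ s)//; first last.
- by move=> a ar pa; apply/hs; split=> // p0; rewrite p0 in pa.
- exact: lt_le_trans ltr01 r1.
have pm : (0 < pole_mult (fun z => (f z)^-1) z0)%N.
  by rewrite (pole_multE (has_orderV hm)) oppr_le0 (ltW m0) abszN absz_gt0 gt_eqF.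
have z0s : z0 \in s by apply/hs; split=> // p0; rewrite p0 in pm.
rewrite (big_rem z0)//= -[leLHS]addr0; apply: lerD.
  by rewrite ler_peMl ?nu_ge0// ler1n.
by apply: sumr_ge0 => a _; rewrite mulr_ge0 ?nu_ge0.
Qed.

(** Let k minimize |u k|. For j <> k one has |u j - u k| <= 2 |u j|, so that
    1/|u j| is controlled by 1/|u j - u k|. The remaining term is split as 1 /
    u k = (1 / d) (d / u k). The sum over all i on the right only serves to
    make the bound independent of k. *)
Lemma sum_logp_inv_le (q : nat) (u : 'I_q -> C) (d : C) : (0 < q)%N -> d != 0 ->
  (forall k, u k != 0) -> (forall i j, i != j -> u i != u j) ->
  \sum_(k < q) logp (nrm (u k)^-1) <= logp (nrm d^-1) + \sum_(k < q) logp (nrm (d / u k)) +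
   \sum_(i < q) \sum_(j < q | j != i) (logp (nrm (u j - u i)^-1) + ln 2).
Proof.
move=> q0 d0 u0 uij; pose i0 := Ordinal q0.
have ln20 : 0 <= ln 2 :> R by apply: ln_ge0; rewrite ler1n.
case: (@arg_minP _ _ _ i0 predT (fun k => nrm (u k)) isT) => k _ kmin.
rewrite (bigD1 k)//=.
have h1 : logp (nrm (u k)^-1) <= logp (nrm d^-1) + logp (nrm (d / u k)).
  have {1}-> : (u k)^-1 = d^-1 * (d / u k) by rewrite mulKf.
  by rewrite (nrmM d^-1); apply: logpM; exact: nrm_ge0.
have h2 : logp (nrm (d / u k)) <= \sum_(k < q) logp (nrm (d / u k)).
  by rewrite (bigD1 k)//= lerDl sumr_ge0// => i _; exact: logp_ge0.
have h3 : \sum_(j < q | j != k) logp (nrm (u j)^-1) <=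
    \sum_(j < q | j != k) (logp (nrm (u j - u k)^-1) + ln 2).
  apply: ler_sum => j jk; have l2 : logp (2 : R) = ln 2 by rewrite logpE max_r// ler1n.
  rewrite -l2; apply: (@le_trans _ _ (logp (nrm (u j - u k)^-1 * 2))); last first.
    by apply: logpM; [exact: nrm_ge0|].
  have p1 : 0 < nrm (u j) by rewrite nrm_gt0 u0.
  have p2 : 0 < nrm (u j - u k) by rewrite nrm_gt0 subr_eq0 uij.
  apply: logp_le; rewrite !nrmV ler_pdivlMl// ler_pdivrMr// mulrC.
  by apply: le_trans (nrmB _ _) _; have := kmin j isT; lra.
have h4 : \sum_(j < q | j != k) (logp (nrm (u j - u k)^-1) + ln 2) <=
    \sum_(i < q) \sum_(j < q | j != i) (logp (nrm (u j - u i)^-1) + ln 2).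
  rewrite [leRHS](bigD1 k)//= lerDl; apply: sumr_ge0 => i _; apply: sumr_ge0 => j _.
  by rewrite addr_ge0// logp_ge0.
lra.
Qed.

End Proximity.

(** * The difference quotient for finite order *)

Section Quotient.
Context {R : realType}.
Local Notation C := (Cplane R).
Implicit Types (f g : C -> C) (r : R) (G E : set R) (T h : R -> R).

Lemma ln_ge_1V (u : R) : 0 < u -> 1 - u^-1 <= ln u.
Proof.
move=> u0; have h : ln u^-1 <= u^-1 - 1.
  have -> : u^-1 = 1 + (u^-1 - 1) by ring.
  rewrite [in leRHS]addrAC subrr add0r; apply: le_ln1Dx.
  by have : 0 < u^-1; [rewrite invr_gt0|lra].
  
by move: h; rewrite lnV ?posrE//; lra.
Qed.

(** Use log u >= 1 - 1/u with u = S / (y^16 + 1). *)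
Lemma gap_ln (y S : R) : 2 <= y -> y ^+ 16 + y ^+ 12 <= S ->
  (4 * y ^+ 4)^-1 <= ln S - ln (y ^+ 16 + 1).
Proof.
move=> y2 hS; have y0 : 0 < y by lra.
have p16 : 0 < y ^+ 16 by rewrite exprn_gt0.
have p12 : 0 < y ^+ 12 by rewrite exprn_gt0.
have S0 : 0 < S by lra.
have y12 : 2 <= y ^+ 12.
  by apply: (le_trans y2); rewrite -{1}(expr1 y) ler_weXn2l//; lra.
have le1216 : y ^+ 12 <= y ^+ 16 by rewrite ler_weXn2l//; lra.
have q0 : 0 < y ^+ 16 + 1 by lra.
have -> : ln S - ln (y ^+ 16 + 1) = ln (S / (y ^+ 16 + 1)).
  by rewrite lnM ?posrE ?invr_gt0// lnV ?posrE.
apply: le_trans (ln_ge_1V _); last by rewrite divr_gt0.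
rewrite invf_div lerBrDr -lerBrDl.
rewrite ler_pdivrMr//; apply: (@le_trans _ _ ((1 - (4 * y ^+ 4)^-1) * (y ^+ 16 + y ^+ 12))); last first.
  rewrite ler_wpM2l// subr_ge0 invf_le1; last by rewrite mulr_gt0// exprn_gt0.
  have : 1 <= y ^+ 4 by rewrite exprn_ege1//; lra.
  by move: (y ^+ 4) => t; lra.
have -> : (1 - (4 * y ^+ 4)^-1) * (y ^+ 16 + y ^+ 12) = y ^+ 16 + (3 / 4) * y ^+ 12 - y ^+ 8 / 4.
  by field; rewrite gt_eqF.
have : y ^+ 8 <= y ^+ 12 by rewrite ler_weXn2l//; lra.
by move: y12; move: (y ^+ 12) (y ^+ 8) (y ^+ 16) => t u v; lra.
Qed.

(** Here x and y are the sixteenth roots of r and rho, and the step x^12 is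
    large compared with k. *)
Lemma gap_bounds (x y k r rho : R) : 2 <= x -> 0 <= k -> 2 * k <= x -> 0 <= y ->
  r = x ^+ 16 -> rho = y ^+ 16 -> r + x ^+ 12 <= rho -> rho <= 2 ^+ 16 * r ->
  [/\ x <= y, y <= 2 * x, x ^+ 12 / 2 <= rho - (r + k), r + k < rho & ln (2 * rho + 1) <= 64 * x].
Proof.
move=> x2 k0 kx y0 er ey h1 h2; have x0 : 0 < x by lra.
have p12 : x <= x ^+ 12 by rewrite -{1}(expr1 x) ler_weXn2l//; lra.
have p0 : 0 < x ^+ 12 by rewrite exprn_gt0.
have p16 : 1 <= x ^+ 16 by rewrite exprn_ege1//; lra.
split.
- by rewrite -(ler_pXn2r (n := 16)) ?nnegrE// ?(ltW x0)// -er -ey; lra.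
- rewrite -(ler_pXn2r (n := 16)) ?nnegrE//; last by rewrite mulr_ge0// ltW.
  by rewrite exprMn -ey -er.
- by move: p12 p0 h1; move: (x ^+ 12) => t; lra.
- by move: p12 p0 h1; move: (x ^+ 12) => t; lra.
have e : ln ((4 * x) ^+ 16) = 16 * ln (4 * x) by rewrite lnXn ?mulr_gt0// -(mulr_natl (ln (4 * x)) 16).
apply: (@le_trans _ _ (ln ((4 * x) ^+ 16))).
  rewrite ler_ln ?posrE ?exprn_gt0 ?mulr_gt0//; last first.
    by rewrite ltr_wpDl// mulr_ge0// ey exprn_ge0.
  have -> : (4 * x) ^+ 16 = 2 ^+ 32 * x ^+ 16 by ring.
  move: h2 p16; rewrite er; move: (x ^+ 16) => t h t1.
  apply: (@le_trans _ _ (2 * (2 ^+ 16 * t) + 1)); first by lra.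
  lra.
rewrite e; have : ln (4 * x) <= 4 * x.
  have h : ln (1 + (4 * x - 1)) <= 4 * x - 1 by apply: le_ln1Dx; lra.
  by move: h; rewrite addrC subrK; lra.
lra.
Qed.

(** Orders of magnitude: n is O(x^6 t) by gap_ln and y <= 2 x. In the first
    term the kernel is O(x^(-8)) and the bracket is O(x^7 t), the logarithm
    being O(x). The second term is n O(x^(-8)). Hence O(t / x). *)
Lemma quotient_numeric (x y k r rho M n p t : R) : 2 <= x -> 0 <= k -> 2 * k <= x -> 0 <= y ->
  r = x ^+ 16 -> rho = y ^+ 16 -> r + x ^+ 12 <= rho -> rho <= 2 ^+ 16 * r ->
  0 <= M -> 0 <= t -> 0 <= n -> n * (4 * y ^+ 4)^-1 <= M * (y * (x * t)) ->
  p <= M * (x * t) ->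
  4 * rho * k / (rho - (r + k)) ^+ 2 * (p + n * (2 * ln (2 * rho + 1))) +
    n * (2 * (k ^+ 2 / (2 * r) + (Num.sqrt r)^-1)) <=
  (2 ^+ 36 * M * k + 2 ^+ 9 * M * (k ^+ 2 + 1)) / x * t.
Proof.
move=> x2 k0 kx y0 er ey h1 h2 M0 t0 n0 hn hp.
have [xy yx hd hlt hl] := gap_bounds x2 k0 kx y0 er ey h1 h2.
have x0 : 0 < x by lra.
have y00 : 0 < y by lra.
have nb : n <= 2 ^+ 7 * M * x ^+ 6 * t.
  move: hn; rewrite ler_pdivrMr ?mulr_gt0 ?exprn_gt0// => h; apply: (le_trans h).
  have -> : M * (y * (x * t)) * (4 * y ^+ 4) = 4 * M * x * t * y ^+ 5 by ring.
  have -> : 2 ^+ 7 * M * x ^+ 6 * t = 4 * M * x * t * (2 * x) ^+ 5 by ring.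
  apply: ler_wpM2l; first by rewrite !mulr_ge0// ltW.
  by rewrite lerXn2r ?nnegrE// mulr_ge0// ltW.
have mt : 0 <= M * t by rewrite mulr_ge0.
have b1 : p + n * (2 * ln (2 * rho + 1)) <= 2 ^+ 15 * M * x ^+ 7 * t.
  have s1 : n * (2 * ln (2 * rho + 1)) <= 2 ^+ 7 * M * x ^+ 6 * t * (2 * (64 * x)).
    apply: ler_pM => //; last by rewrite ler_wpM2l.
    by rewrite mulr_ge0// ln_ge0// lerDr mulr_ge0// ey exprn_ge0.
  have s2 : x * (M * t) <= x ^+ 7 * (M * t).
    by apply: ler_wpM2r => //; rewrite -{1}(expr1 x) ler_weXn2l//; lra.
  have e1 : 2 ^+ 7 * M * x ^+ 6 * t * (2 * (64 * x)) = 2 ^+ 14 * (x ^+ 7 * (M * t)) by ring.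
  have e2 : 2 ^+ 15 * M * x ^+ 7 * t = 2 ^+ 15 * (x ^+ 7 * (M * t)) by ring.
  have e3 : M * (x * t) = x * (M * t) by ring.
  move: s1 hp; rewrite e1 e2 e3.
  have : 0 <= x ^+ 7 * (M * t) by rewrite mulr_ge0// exprn_ge0// ltW.
  move: s2; move: (x ^+ 7 * (M * t)) (x * (M * t)) (n * _) => u v w; lra.
have b2 : 4 * rho * k / (rho - (r + k)) ^+ 2 <= 2 ^+ 20 * k / x ^+ 8.
  have d0 : 0 < x ^+ 12 / 2 by rewrite divr_gt0// exprn_gt0.
  have dd : (x ^+ 12 / 2) ^+ 2 <= (rho - (r + k)) ^+ 2.
    by rewrite lerXn2r ?nnegrE//; [exact: ltW|rewrite subr_ge0 ltW].
  apply: (@le_trans _ _ (4 * (2 ^+ 16 * x ^+ 16) * k / (x ^+ 12 / 2) ^+ 2)); last first.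
    rewrite le_eqVlt; apply/orP; left; apply/eqP; field; rewrite gt_eqF//.
  apply: ler_pM.
  - by rewrite !mulr_ge0// ey exprn_ge0.
  - by rewrite invr_ge0 exprn_ge0// subr_ge0 ltW.
  - by apply: ler_wpM2r => //; apply: ler_wpM2l => //; rewrite -er.
  rewrite lef_pV2 ?posrE ?exprn_gt0//.
  by rewrite subr_gt0.
have b3 : k ^+ 2 / (2 * r) + (Num.sqrt r)^-1 <= (k ^+ 2 + 1) / x ^+ 8.
  have -> : Num.sqrt r = x ^+ 8.
    by rewrite er -[16%N]/(8 * 2)%N exprM sqrtr_sqr ger0_norm// exprn_ge0// ltW.
  rewrite [leRHS]mulrDl mul1r lerD2r; apply: ler_wpM2l; first by rewrite exprn_ge0.
  rewrite lef_pV2 ?posrE ?exprn_gt0//; last by rewrite er mulr_gt0// exprn_gt0.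
  have s : x ^+ 8 <= x ^+ 16 by rewrite ler_weXn2l//; lra.
  have s0 : 0 <= x ^+ 16 by rewrite exprn_ge0// ltW.
  by rewrite er; move: s s0; move: (x ^+ 8) (x ^+ 16) => u v; lra.
have A1 : 4 * rho * k / (rho - (r + k)) ^+ 2 * (p + n * (2 * ln (2 * rho + 1))) <=
    2 ^+ 20 * k / x ^+ 8 * (2 ^+ 15 * M * x ^+ 7 * t).
  apply: (@le_trans _ _ (4 * rho * k / (rho - (r + k)) ^+ 2 * (2 ^+ 15 * M * x ^+ 7 * t))).
    apply: ler_wpM2l => //.
    by rewrite mulr_ge0 ?invr_ge0 ?exprn_ge0 ?subr_ge0 ?(ltW hlt)// !mulr_ge0// ey exprn_ge0.
  by apply: ler_wpM2r => //; rewrite !mulr_ge0// ?exprn_ge0// ltW.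
have A2 : n * (2 * (k ^+ 2 / (2 * r) + (Num.sqrt r)^-1)) <=
    2 ^+ 7 * M * x ^+ 6 * t * (2 * ((k ^+ 2 + 1) / x ^+ 8)).
  apply: ler_pM => //; last by rewrite ler_wpM2l.
  by rewrite mulr_ge0// addr_ge0 ?invr_ge0 ?sqrtr_ge0// divr_ge0 ?exprn_ge0// er mulr_ge0// exprn_ge0// ltW.
apply: (le_trans (lerD A1 A2)).
have -> : 2 ^+ 20 * k / x ^+ 8 * (2 ^+ 15 * M * x ^+ 7 * t) = (2 ^+ 35 * M * k) / x * t.
  by field; rewrite gt_eqF.
have -> : 2 ^+ 7 * M * x ^+ 6 * t * (2 * ((k ^+ 2 + 1) / x ^+ 8)) =
   (2 ^+ 8 * M * (k ^+ 2 + 1)) / x * t / x by field; rewrite gt_eqF.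
have M1 : 0 <= M * k by rewrite mulr_ge0.
have M2 : 0 <= M * (k ^+ 2 + 1) by rewrite mulr_ge0// addr_ge0// exprn_ge0.
have tx : 0 <= t / x by rewrite divr_ge0// ltW.
have e1 : (2 ^+ 35 * M * k) / x * t = 2 ^+ 35 * (M * k * (t / x)) by field; rewrite gt_eqF.
have e2 : (2 ^+ 8 * M * (k ^+ 2 + 1)) / x * t / x = 2 ^+ 8 * (M * (k ^+ 2 + 1) * (t / x) / x) by field; rewrite gt_eqF.
have e3 : (2 ^+ 36 * M * k + 2 ^+ 9 * M * (k ^+ 2 + 1)) / x * t =
   2 ^+ 36 * (M * k * (t / x)) + 2 ^+ 9 * (M * (k ^+ 2 + 1) * (t / x)) by field; rewrite gt_eqF.
rewrite e1 e2 e3.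
have u0 : 0 <= M * k * (t / x) by rewrite mulr_ge0.
have v0 : 0 <= M * (k ^+ 2 + 1) * (t / x) by rewrite mulr_ge0.
have v1 : M * (k ^+ 2 + 1) * (t / x) / x <= M * (k ^+ 2 + 1) * (t / x).
  by rewrite ler_pdivrMr// ler_peMr//; lra.
move: u0 v0 v1; move: (M * k * (t / x)) (_ / x) (M * _ * _) => u w v; lra.
Qed.

(** A one-sided S(r, f), restricted to the radii of G; its exceptional set may
    depend on h. *)
Definition small_along T G h := exists2 E, finite_log_measure E &
  forall eps, 0 < eps -> exists M, forall r, M <= r -> G r -> ~ E r -> h r <= eps * T r.

Lemma sum_le_parts (p1 p2 n1 n2 B : R) : 0 <= p1 -> 0 <= p2 ->
  p1 + n1 + (p2 + n2) <= B -> n1 + n2 <= B.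
Proof. by move=> h1 h2 h3; lra. Qed.

(** The growth lemma is applied to the radii of G and then to those of G off
    the first exceptional set. The second application produces rho from r,
    still off the first exceptional set, and the first one produces S from
    rho. *)
Lemma quotient_small (c : C) g G T K (M : R) : nzm g ->
  (exists r0, forall r, r0 <= r -> G r -> 1 <= T r <= r ^+ K) ->
  (exists r0, forall r, r0 <= r -> G r ->
    characteristic g r + characteristic (fun z => (g z)^-1) r <= M * T r) ->
  (forall r, G r -> regcirc g r /\ regcirc (fun z => g (z + c)) r) ->
  0 <= M ->
  small_along T G (proximity (fun z => g (z + c) / g z)).
Proof.
move=> ng [r0 hT] [r0' hM] hG M0.
have [E1 fE1 [r1 h1]] := moderate_growth hT.
have hT2 : forall r, r0 <= r -> (G `\` E1) r -> 1 <= T r <= r ^+ K.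
  by move=> r rr [Gr _]; exact: hT.
have [E2 fE2 [r2 h2]] := moderate_growth hT2.
exists (E1 `|` E2); first exact: flm_setU.
move=> eps e0; pose k := nrm c; have k0 : 0 <= k by exact: nrm_ge0.
(* the threshold makes x exceed Q / eps, 2 and 2 |c| *)
pose Q := 2 ^+ 36 * M * k + 2 ^+ 9 * M * (k ^+ 2 + 1).
pose X := 2 + 2 * k + `|Q| / eps.
have X2 : 2 + 2 * k <= X by rewrite lerDl divr_ge0// ltW.
have XQ : Q / eps <= X.
  have : Q / eps <= `|Q| / eps by rewrite ler_pM2r ?invr_gt0// ler_norm.
  by rewrite /X; lra.
exists (Num.max (X ^+ 16) (Num.max (Num.max r0 r0') (Num.max r1 r2))) => r.
rewrite !ge_max => /andP[rX /andP[/andP[rr0 rr0'] /andP[rr1 rr2]]] Gr nE.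
pose x := root16 r.
have r00 : 0 <= r by apply: le_trans rX; rewrite exprn_ge0//; lra.
have er : r = x ^+ 16 by rewrite root16K.
have x0 := root16_ge0 r : 0 <= x.
have xX : X <= x by rewrite -(ler_pXn2r (n := 16)) ?nnegrE// -?er//; lra.
have x2 : 2 <= x by lra.
have kx : 2 * k <= x by lra.
have rpos : 2 <= r.
  by rewrite er; apply: (le_trans x2); rewrite -{1}(expr1 x) ler_weXn2l//; lra.
have r1' : 1 <= r by lra.
have nE1 : ~ E1 r by move=> e; apply: nE; left.
have nE2 : ~ E2 r by move=> e; apply: nE; right.
have /andP[Tr1 _] := hT r rr0 Gr.
have T0 : 0 <= T r := le_trans ler01 Tr1.
have [rho [[Grho nrho] a1 a2 a3]] := h2 r rr2 (conj Gr nE1) nE2.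
have p12 : 0 <= x ^+ 12 by rewrite exprn_ge0.
have rrho : r <= rho by rewrite -/x in a1; lra.
have [S [GS b1 b2 b3]] := h1 rho (le_trans rr1 rrho) Grho nrho.
pose y := root16 rho; have y0 := root16_ge0 rho : 0 <= y.
have ey : rho = y ^+ 16 by rewrite root16K// (le_trans r00).
rewrite -/x in a1 a3; rewrite -/y in b1 b3.
have [xy yx hd hlt hl] := gap_bounds x2 k0 kx y0 er ey a1 a2.
have rhoS : rho + 1 < S.
  have y12 : y <= y ^+ 12.
    by rewrite -{1}(expr1 y) ler_weXn2l// (le_trans _ (le_trans x2 xy))// ler1n.
  apply: lt_le_trans b1; rewrite ltrD2l (lt_le_trans _ y12)// (lt_le_trans _ (le_trans x2 xy))//.
  exact: ltr1n.
have [g1 g2] := hG r Gr; have [g3 _] := hG rho Grho.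
have [n [n0 hn] hq] := @difference_estimate R g c r rho S ng r1' hlt rhoS g1 g2 g3.
have ni := nzm_mero (nzm_inv ng); have mg := nzm_mero ng.
have rho1 := le_trans r1' rrho.
have rhoS' : rho <= S by apply: ltW; apply: lt_trans rhoS; rewrite ltrDl.
have S1 := le_trans rho1 rhoS'.
have prho := hM rho (le_trans rr0' rrho) Grho.
have pS := hM S (le_trans rr0' (le_trans rrho rhoS')) GS.
have nS1 := @proximity_ge0 R g S (le_trans ler01 S1).
have nS2 := @proximity_ge0 R (fun z => (g z)^-1) S (le_trans ler01 S1).
have nr1 := counting_ge0 mg rho1; have nr2 := counting_ge0 ni rho1.
rewrite /characteristic in pS prho.
apply: (le_trans hq).
have num := @quotient_numeric x y k r rho M n
  (proximity g rho + proximity (fun z => (g z)^-1) rho) (T r) x2 k0 kx y0 er ey a1 a2 M0 _ n0 _ _.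
apply: (le_trans (num _ _ _)).
- exact: T0.
- apply: (@le_trans _ _ (n * (ln S - ln (rho + 1)))).
    by apply: ler_wpM2l => //; rewrite ey; apply: gap_ln; [exact: le_trans xy|rewrite -ey].
  apply: (le_trans hn); apply: (@le_trans _ _ (M * T S)); first exact: sum_le_parts nS1 nS2 pS.
  apply: ler_wpM2l => //; apply: (le_trans b3); exact: ler_wpM2l.
- apply: (@le_trans _ _ (M * T rho)).
    by apply: (sum_le_parts nr1 nr2); rewrite (addrC _ (proximity g rho)) (addrC _ (proximity _ rho)).
  exact: ler_wpM2l.
apply: ler_wpM2r; first exact: T0.
rewrite -/Q ler_pdivrMr; last exact: lt_le_trans x2.
by rewrite -ler_pdivrMl// mulrC; exact: le_trans XQ xX.
Qed.

End Quotient.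

(** * Error terms and the main estimate *)

Section Small.
Context {R : realType}.
Local Notation C := (Cplane R).
Implicit Types (f g a : C -> C) (r : R) (G E : set R) (T h : R -> R).

Lemma small_along_le T G h1 h2 : (exists M, forall r, M <= r -> G r -> h1 r <= h2 r) ->
  small_along T G h2 -> small_along T G h1.
Proof.
move=> [M hM] [E fE H]; exists E => // eps e0; have [M' hM'] := H eps e0.
exists (Num.max M M') => r; rewrite ge_max => /andP[h1' h2'] Gr nE.
by apply: (le_trans (hM r h1' Gr)); exact: hM'.
Qed.

Lemma small_alongD T G h1 h2 : small_along T G h1 -> small_along T G h2 ->
  small_along T G (fun r => h1 r + h2 r).
Proof.
move=> [E fE H] [E' fE' H']; exists (E `|` E'); first exact: flm_setU.
move=> eps e0; have e2 : 0 < eps / 2 by rewrite divr_gt0.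
have [M hM] := H _ e2; have [M' hM'] := H' _ e2.
exists (Num.max M M') => r; rewrite ge_max => /andP[k1 k2] Gr nE.
have -> : eps * T r = eps / 2 * T r + eps / 2 * T r by field.
by apply: lerD; [apply: hM|apply: hM'] => // e; apply: nE; [left|right].
Qed.

Lemma small_along0 T G : (exists M, forall r, M <= r -> G r -> 0 <= T r) ->
  small_along T G (fun=> 0).
Proof.
move=> [M hM]; exists set0; first exact: flm_set0.
by move=> eps e0; exists M => r Mr Gr _; rewrite mulr_ge0 ?(ltW e0)// hM.
Qed.

Lemma small_along_cst T G k : (forall B, exists M, forall r, M <= r -> G r -> B <= T r) ->
  small_along T G (fun=> k).
Proof.
move=> hT; exists set0; first exact: flm_set0.
move=> eps e0; have [M hM] := hT (k / eps); exists M => r Mr Gr _.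
by rewrite mulrC -ler_pdivrMr//; exact: hM.
Qed.

Lemma small_along_sum T G (I : finType) (P : pred I) (h : I -> R -> R) :
  (exists M, forall r, M <= r -> G r -> 0 <= T r) ->
  (forall i, P i -> small_along T G (h i)) ->
  small_along T G (fun r => \sum_(i | P i) h i r).
Proof.
move=> T0 H; elim: (index_enum I) => [|i s IH].
  by apply: small_along_le (small_along0 T0); exists 0 => r _ _; rewrite big_nil.
have [Pi|nPi] := boolP (P i).
  apply: small_along_le (small_alongD (H i Pi) IH).
  by exists 0 => r _ _; rewrite big_cons Pi.
by apply: small_along_le IH; exists 0 => r _ _; rewrite big_cons (negbTE nPi).
Qed.

(** The limit superior is an infimum of suprema over neighbourhoods of
    infinity. One of these suprema is finite, which bounds log T by B log
    r. *)
Lemma finite_order_bound f : finite_order f ->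
  exists K r0, forall r, r0 <= r -> characteristic f r <= r ^+ K.
Proof.
move=> /ereal_inf_lt[_ [V [M [_ hM]] <-]] hV.
have [B hB] : exists B : nat, forall r, V r -> logp (characteristic f r) / ln r <= B%:R.
  have [B hB] : exists B : R, forall r, V r -> logp (characteristic f r) / ln r <= B.
    move: hV; case E : (ereal_sup _) => [B| |]// _.
      exists B => r Vr; rewrite -lee_fin -E; apply: ereal_sup_ubound.
      by exists r.
    exists 0 => r Vr; have : ((logp (characteristic f r) / ln r)%:E <= -oo)%E.
      by rewrite -E; apply: ereal_sup_ubound; exists r.
    by [].
  exists (Num.truncn B).+1 => r /hB h; apply: (le_trans h).
  by apply: ltW; exact: truncnS_gt.
exists B, (Num.max (M + 1) 2) => r; rewrite ge_max => /andP[Mr r2].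
have Vr : V r by apply: hM; lra.
have r0 : 0 < r by lra.
have lr : 0 < ln r by apply: ln_gt0; lra.
have := hB r Vr; rewrite ler_pdivrMr// => h.
have [T0|T0] := leP (characteristic f r) 0.
  by apply: (le_trans T0); rewrite exprn_ge0// ltW.
rewrite -ler_ln ?posrE ?exprn_gt0// lnXn// -(mulr_natl (ln r) B).
by apply: le_trans h; rewrite /logp le_max lexx orbT.
Qed.

(** If f coincided with the periodic function a, then the difference of f
    would vanish. *)
Lemma shift_sub_nzm c f a : meromorphic f -> meromorphic a -> mero_periodic c a ->
  ~ mero_eq (difference c f) (fun=> 0) -> nzm (fun z => f z - a z).
Proof.
move=> mf ma pa nd; apply: nzm_nz; first exact: mero_sub.
move=> h; apply: nd.
have h1 : generic (fun z => f z - a z = 0) by exact: h.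
have h2 := generic_shift c h1.
have h3 : generic (fun z => a (z + c) = a z) by exact: pa.
apply: (generic_sub _ (genericI h1 (genericI h2 h3))) => z [e1 [e2 e3]].
by rewrite /difference (subr0_eq e2) e3 (subr0_eq e1) subrr.
Qed.

Lemma nzm_near f g : (forall z, f z = g z) -> nzm f -> nzm g.
Proof.
move=> e h z; have [m [v hm]] := h z; exists m, v.
by apply: has_order_near hm; apply: nearA'.
Qed.

Lemma const_periodic c (k : C) : mero_periodic c (fun=> k).
Proof. by move=> z; apply: nearA'. Qed.

End Small.

Section Main.
Context {R : realType}.
Local Notation C := (Cplane R).
Implicit Types (a g : C -> C) (r : R).

Variables (c : C) (f : C -> C) (G : set R) (K : nat).
Hypothesis f_mero : meromorphic f.
Hypothesis f_diff : ~ mero_eq (difference c f) (fun=> 0).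
Local Notation T := (characteristic f).
Hypothesis T_large : forall B, exists M, forall r, M <= r -> G r -> B <= T r.
Hypothesis T_bound : exists r0, forall r, r0 <= r -> G r -> 1 <= T r <= r ^+ K.
Hypothesis G_f : forall r, G r -> regcirc f r.

(** Periodicity of a gives D / g = g(z + c) / g(z) - 1 with g = f - a, on the
    circles in question. The first main theorem bounds the characteristics of
    g and 1/g by multiples of T. *)
Lemma delta_quotient_small a : meromorphic a -> mero_periodic c a ->
  (exists M, forall r, M <= r -> G r -> characteristic a r <= T r) ->
  (forall r, G r -> [/\ holcirc a r, regcirc (fun z => f z - a z) r,
     regcirc (fun z => f (z + c) - a (z + c)) r & forall z, nrm z = r -> a (z + c) = a z]) ->
  small_along T G (proximity (fun z => difference c f z / (f z - a z))).
Proof.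
move=> ma pa [M hM] hG; pose g z := f z - a z.
have ng : nzm g by exact: shift_sub_nzm pa f_diff.
have H : small_along T G (proximity (fun z => g (z + c) / g z)).
  apply: (@quotient_small R c g G T K 7 ng T_bound); last exact: ler0n.
  - have [M' hM'] := T_large (ln 2); have [M2 hM2] := T_large `|ln (nrm (lead g 0))|.
    exists (Num.max (Num.max M 1) (Num.max M' M2)) => r.
    rewrite !ge_max => /andP[/andP[k1 r1] /andP[k2 k3]] Gr.
    have [ha gr _ _] := hG r Gr.
    have h1 := characteristicB f_mero ma r1 (regcirc_hol (G_f Gr)) ha.
    have h2 := first_main_theorem ng (lt_le_trans ltr01 r1) gr.
    have h3 := hM r k1 Gr; have h4 := hM' r k2 Gr; have h5 := hM2 r k3 Gr.
    have h6 : - ln (nrm (lead g 0)) <= `|ln (nrm (lead g 0))| by rewrite -normrN ler_norm.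
    move: h1 h2 h3 h4 h5 h6; rewrite -/g.
    move: (characteristic g r) (characteristic _ r) (characteristic a r) (T r) (ln 2) (ln (nrm _)) `|_|.
    move=> *; lra.
  - by move=> r Gr; have [_ g1 g2 _] := hG r Gr.
apply: small_along_le (small_alongD H (small_along_cst (ln 2) T_large)).
exists 1 => r r1 Gr; have [_ g1 g2 ap] := hG r Gr.
have r0 := le_trans ler01 r1.
have hq : holcirc (fun z => g (z + c) / g z) r.
  by apply: holcircM; [exact: regcirc_hol|apply: regcirc_hol; exact: regcirc_inv].
have h1 : holcirc (fun=> 1 : C) r by move=> z _; exact: holat_cst.
have := proximityB r0 hq h1; rewrite (proximity_cst _ (lt_le_trans ltr01 r1)) nrm1.
have -> : logp (1 : R) = 0 by rewrite /logp ln1 maxxx.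
rewrite addr0 => h; apply: le_trans h; rewrite le_eqVlt; apply/orP; left; apply/eqP.
apply: (eq_proximity r0) => z zr; have [_ gz] := g1 z zr.
by rewrite /difference /g ap//; field.
Qed.

Lemma inv_diff_small a1 a2 : meromorphic a1 -> meromorphic a2 -> nzm (fun z => a1 z - a2 z) ->
  small_along T G (characteristic a1) -> small_along T G (characteristic a2) ->
  (forall r, G r -> [/\ holcirc a1 r, holcirc a2 r & regcirc (fun z => a1 z - a2 z) r]) ->
  small_along T G (proximity (fun z => (a1 z - a2 z)^-1)).
Proof.
move=> m1 m2 n12 s1 s2 hG; pose k := ln 2 - ln (nrm (lead (fun z => a1 z - a2 z) 0)).
apply: small_along_le (small_alongD (small_alongD s1 s2) (small_along_cst k T_large)).
exists 1 => r r1 Gr; have [h1 h2 h12] := hG r Gr.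
apply: (le_trans (proximity_le_char (nzm_mero (nzm_inv n12)) r1)).
have := characteristicB m1 m2 r1 h1 h2.
by rewrite (first_main_theorem n12 (lt_le_trans ltr01 r1) h12) /k; lra.
Qed.

End Main.

Section Estimate.
Context {R : realType}.
Local Notation C := (Cplane R).
Implicit Types (r : R).

(** All error terms are kept explicit; the inequality holds on each single
    circle on which the functions involved are regular. *)
Lemma second_main_estimate (c : C) (f : C -> C) q (a : 'I_q -> C -> C) r :
  nzm (difference c f) -> (0 < q)%N -> 1 <= r ->
  regcirc f r -> regcirc (difference c f) r -> (forall k, regcirc (fun z => f z - a k z) r) ->
  (forall i j, i != j -> regcirc (fun z => a i z - a j z) r) ->
  proximity f r + \sum_(k < q) proximity (fun z => (f z - a k z)^-1) r <=
  2 * characteristic f r - N_pair c f r +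
  (proximity (fun z => difference c f z / f z) r - ln (nrm (lead (difference c f) 0)) +
   \sum_(k < q) proximity (fun z => difference c f z / (f z - a k z)) r +
   \sum_(i < q) \sum_(j < q | j != i) (proximity (fun z => (a i z - a j z)^-1) r + ln 2)).
Proof.
move=> nd q0 r1 gf gd gk gij; pose D := difference c f; rewrite -/D in nd gd *.
have r00 := lt_le_trans ltr01 r1; have r0 := ltW r00.
have hV g : regcirc g r -> holcirc (fun z => (g z)^-1) r.
  by move=> h; apply: regcirc_hol; exact: regcirc_inv.
have hD : proximity D r <= proximity f r + proximity (fun z => D z / f z) r.
  rewrite (@eq_proximity _ D (fun z => f z * (D z / f z)) r r0).
    by apply: (proximityM r0); [exact: regcirc_hol|apply: holcircM; [exact: regcirc_hol|exact: hV]].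
  by move=> z zr; have [_ fz] := gf z zr; rewrite mulrC divfK.
have FM := first_main_theorem nd r00 gd.
have cP : cont_circ (fun z => logp (nrm (D z)^-1)) r.
  by have := holcirc_logp (hV _ gd).
have cF k : cont_circ (fun z => logp (nrm (f z - a k z)^-1)) r.
  by have := holcirc_logp (hV _ (gk k)).
have cQ k : cont_circ (fun z => logp (nrm (D z / (f z - a k z)))) r.
  by apply: holcirc_logp; apply: holcircM; [exact: regcirc_hol|exact: (hV _ (gk k))].
pose W i j z : R := if j != i then logp (nrm (a i z - a j z)^-1) + ln 2 else 0.
have cij i j : i != j -> cont_circ (fun z => logp (nrm (a i z - a j z)^-1)) r.
  by move=> ij; have := holcirc_logp (hV _ (gij i j ij)).
have cW i j : cont_circ (W i j) r.
  rewrite /W; have [_|ij] := eqVneq j i; first exact: cont_circ_cst.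
  by move=> z zr; apply: (cvgD (cij i j _ z zr) (cvg_cst _)); rewrite eq_sym.
have cS1 := cont_circ_sum (s := index_enum 'I_q) cQ.
have cS2 i := cont_circ_sum (s := index_enum 'I_q) (cW i).
have cS3 := cont_circ_sum (s := index_enum 'I_q) cS2.
have c12 : cont_circ (fun z => logp (nrm (D z)^-1) + \sum_k logp (nrm (D z / (f z - a k z))) : R) r.
  by move=> z zr; exact: (cvgD (cP z zr) (cS1 z zr)).
have c123 : cont_circ (fun z => logp (nrm (D z)^-1) + \sum_k logp (nrm (D z / (f z - a k z))) +
    \sum_i \sum_j W i j z : R) r.
  by move=> z zr; exact: (cvgD (c12 z zr) (cS3 z zr)).
have main : \sum_(k < q) proximity (fun z => (f z - a k z)^-1) r <=
    proximity (fun z => (D z)^-1) r + \sum_(k < q) proximity (fun z => D z / (f z - a k z)) r +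
   \sum_(i < q) \sum_(j < q | j != i) (proximity (fun z => (a i z - a j z)^-1) r + ln 2).
  have e1 : \sum_(k < q) proximity (fun z => (f z - a k z)^-1) r =
      avg (fun z => \sum_(k < q) logp (nrm (f z - a k z)^-1)) r.
    by rewrite (avg_sum r0 _ cF).
  have e2 : proximity (fun z => (D z)^-1) r + \sum_(k < q) proximity (fun z => D z / (f z - a k z)) r +
   \sum_(i < q) \sum_(j < q | j != i) (proximity (fun z => (a i z - a j z)^-1) r + ln 2) =
     avg (fun z => logp (nrm (D z)^-1) + \sum_k logp (nrm (D z / (f z - a k z))) +
    \sum_i \sum_j W i j z) r.
    rewrite (avgD r0 c12 cS3) (avgD r0 cP cS1) (avg_sum r0 _ cQ) (avg_sum r0 _ cS2).
    congr (_ + _); apply: eq_bigr => i _; rewrite (avg_sum r0 _ (cW i)) big_mkcond/=.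
    apply: eq_bigr => j _; rewrite /W; case: ifPn => ij; last by rewrite avg_cst.
    by rewrite (avgD r0 (cij i j _) (cont_circ_cst _ _)) ?avg_cst// eq_sym.
  rewrite e1 e2; apply: (avg_le r0 (cont_circ_sum cF) c123) => z zr.
  have [_ dz] := gd z zr.
  have uz k : f z - a k z != 0 by have [] := gk k z zr.
  have uij i j : i != j -> f z - a i z != f z - a j z.
    move=> ij; have [_] := gij i j ij z zr; apply: contraNneq => /addrI/oppr_inj ->.
    by rewrite subrr.
  apply: (le_trans (sum_logp_inv_le q0 dz uz uij)); rewrite lerD2l.
  rewrite le_eqVlt; apply/orP; left; apply/eqP.
  apply: eq_bigr => i _; rewrite big_mkcond/=; apply: eq_bigr => j _.
  rewrite /W; case: ifP => // _; congr (logp (nrm _^-1) + _); ring.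
move: main hD FM; rewrite /N_pair /characteristic -/D.
move: (\sum_(k < q) proximity (fun z => (f z - _)^-1) r) => X1.
move: (\sum_(k < q) _) => X2; move: (\sum_(i < q) _) => X3.
move: (ln (nrm _)) (proximity (fun z => D z / f z) r) (proximity D r) (proximity f r) (proximity _ r).
move: (integrated_counting f r) (integrated_counting D r) (integrated_counting _ r).
move=> *; lra.
Qed.

End Estimate.

(** * The second main theorem for differences *)

Section Final.
Context {R : realType}.
Local Notation C := (Cplane R).
Implicit Types (f g : C -> C) (r : R).

(** The function f - f(z0) has a zero, hence its reciprocal has a counting
    function of size at least log r - O(1). The first main theorem carries
    this over to f - f(z0) and then to f. *)
Lemma char_lower f z0 : meromorphic f -> nzm (fun z => f z - f z0) -> holomorphic_at f z0 ->
  exists k, forall r, Num.max 1 (nrm z0) <= r -> holcirc f r ->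
  regcirc (fun z => f z - f z0) r -> ln r - k <= characteristic f r.
Proof.
move=> mf nf hf; set b := f z0 in nf *.
exists (`|ln (nrm z0)| + logp (nrm b) + ln 2 - ln (nrm (lead (fun z => f z - b) 0))) => r.
rewrite ge_max => /andP[r1 z0r] hr gr; have r0 := lt_le_trans ltr01 r1.
have hb : holomorphic_at (fun z => f z - b) z0.
  by apply: holatB; [exact: hf|exact: holat_cst].
have h1 := char_zero nf hb (subrr _) r1 z0r.
have h2 : ln r - `|ln (nrm z0)| <= nu r z0.
  rewrite /nu; case: ifP => _; first by rewrite lerBlDr lerDl.
  by rewrite z0r lerD2l lerN2 ler_norm.
have h3 := first_main_theorem nf r0 gr.
have h4 := @proximity_ge0 R (fun z => (f z - b)^-1) r (ltW r0).
have hcb : holcirc (fun=> b) r by move=> z _; exact: holat_cst.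
have h5 := characteristicB mf (mero_cst b) r1 hr hcb.
have h6 : characteristic (fun=> b) r = logp (nrm b).
  by rewrite /characteristic counting_cst// proximity_cst// addr0.
move: h1 h2 h3 h4 h5; rewrite h6 /characteristic.
move: (proximity f r) (proximity _ r) (proximity _ r) (integrated_counting f r).
move: (integrated_counting _ r) (integrated_counting _ r) (nu r z0) (logp _) `|_| (ln 2) (ln r) (ln _).
move=> *; lra.
Qed.

Lemma ln_large (B : R) : exists M, forall r, M <= r -> B <= ln r.
Proof.
exists (expR B) => r h; rewrite -(expRK B) ler_ln ?posrE ?expR_gt0//.
exact: lt_le_trans (expR_gt0 B) h.
Qed.

Lemma near_pinftyP (P : R -> Prop) : (\forall r \near +oo, P r) <-> exists M, forall r, M <= r -> P r.
Proof.
split=> [[M [_ h]]|[M h]].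
  by exists (M + 1) => r Mr; apply: h; apply: lt_le_trans Mr; rewrite ltrDl.
by exists M; split; [exact: num_real|move=> r /ltW; exact: h].
Qed.

End Final.

Theorem theorem2p4 (R : realType) (c : Cplane R) (f : Cplane R -> Cplane R)
  (f_mero : meromorphic f)
  (f_order : finite_order f)
  (f_diff : ~ mero_eq (difference c f) (fun=> 0))
  (q : nat) (q_ge2 : (2 <= q)%N)
  (a : 'I_q -> Cplane R -> Cplane R)
  (a_mero : forall k, meromorphic (a k))
  (a_distinct : forall j k, j != k -> ~ mero_eq (a j) (a k))
  (a_periodic : forall k, mero_periodic c (a k))
  (a_small : forall k, small_function f (a k)) :
  exists S : R -> R, small_quantity f S /\
    forall r : R, 0 < r ->
      proximity f r + \sum_(k < q) proximity (fun z => (f z - a k z)^-1) r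
      <= 2 * characteristic f r - N_pair c f r + S r.
Proof.
have q0 : (0 < q)%N by apply: leq_trans q_ge2.
(* a constant is periodic, hence f - b is not identically 0 for constant b *)
have nfb (b : Cplane R) : nzm (fun z => f z - b).
  exact: (shift_sub_nzm f_mero (mero_cst b) (@const_periodic R c b) f_diff).
have nf : nzm f by apply: nzm_near (nfb 0) => z; rewrite subr0.
have nd : nzm (difference c f).
  by apply: nzm_nz f_diff; apply: mero_sub; [exact: mero_shift|exact: f_mero].
have nfa k : nzm (fun z => f z - a k z).
  exact: (shift_sub_nzm f_mero (a_mero k) (a_periodic k) f_diff).
have naa i j : i != j -> nzm (fun z => a i z - a j z).
  move=> ij; apply: nzm_nz; first exact: mero_sub.
  move=> h; apply: (a_distinct _ _ ij) => z.
  by have := h z; apply: filterS => w; exact: subr0_eq.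
have [z0 [hz0 _]] := punct_ex (nzm_reg nf 0).
(* the circles on which every function in play is regular *)
pose ok z := [/\ reg f z, reg (difference c f) z & reg (fun z => f z - f z0) z] /\
  [/\ reg (fun z => f (z + c)) z,
      forall k, [/\ holomorphic_at (a k) z, reg (fun z => f z - a k z) z,
                    reg (fun z => f (z + c) - a k (z + c)) z & a k (z + c) = a k z] &
      forall i j, i != j -> reg (fun z => a i z - a j z) z].
have gok : generic ok.
  have g1 := nzm_reg nf; have g2 := nzm_reg nd; have g3 := nzm_reg (nfb (f z0)).
  have g4 := nzm_reg (nzm_shift c nf).
  have g5 : generic (fun z => forall k, (holomorphic_at (a k) z /\ reg (fun z => f z - a k z) z) /\
      (reg (fun z => f (z + c) - a k (z + c)) z /\ a k (z + c) = a k z)).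
    apply: generic_all => k; apply: genericI; apply: genericI.
    - exact: mero_hol.
    - exact: nzm_reg.
    - exact: (nzm_reg (nzm_shift c (nfa k))).
    - exact: a_periodic.
  have g6 : generic (fun z => forall i j, i != j -> reg (fun z => a i z - a j z) z).
    apply: generic_all => i; apply: generic_all => j.
    have [ij|ij] := eqVneq i j; first by move=> z; apply: nearA'.
    by apply: (generic_sub _ (nzm_reg (naa i j ij))) => z h _.
  apply: (generic_sub _ (genericI (genericI g1 (genericI g2 g3)) (genericI g4 (genericI g5 g6)))).
  move=> z [[k1 [k2 k3]] [k4 [k5 k6]]]; split; first exact: (And3 k1 k2 k3).
  by apply: (And3 k4 _ k6) => k; have [[l1 l2] [l3 l4]] := k5 k; exact: (And4 l1 l2 l3 l4).
have [E1 fE1 hE1] : exists2 E : set R, finite_log_measure E &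
    forall r, 0 < r -> ~ E r -> forall z, nrm z = r -> ok z.
  exists ([set r | exists z, nrm z = r /\ ~ ok z] `&` `]0, +oo[).
    by apply: flm_countable; exact: generic_radii.
  move=> r r0 nE z zr; apply: contrapT => nz; apply: nE; split; first by exists z.
  by rewrite /= in_itv/= r0.
have [E2 fE2 hE2] : exists2 E : set R, finite_log_measure E &
    forall k (eps : R), 0 < eps -> exists M, forall r, M <= r -> ~ E r ->
      `|characteristic (a k) r| <= eps * `|characteristic f r|.
  have [E hE] : {E : 'I_q -> set R & forall k, finite_log_measure (E k) /\
      forall eps : R, 0 < eps -> \forall r \near +oo, ~ E k r ->
      `|characteristic (a k) r| <= eps * `|characteristic f r|}.
    apply: (@choice _ _ (fun k (E : set R) => finite_log_measure E /\
      forall eps : R, 0 < eps -> \forall r \near +oo, ~ E r ->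
      `|characteristic (a k) r| <= eps * `|characteristic f r|)) => k.
    by have [_ [E fE h]] := a_small k; exists E.
  have [|F fF hF] := @flm_bigcup R q (fun i => if insub i is Some k then E k else set0).
    move=> i _; case: insubP => [k _ _|_]; [by have [] := hE k|exact: flm_set0].
  exists F => // k eps e0; have [_ h] := hE k.
  have /near_pinftyP[M hM] := h eps e0; exists M => r Mr nF; apply: hM => // Er.
  by apply: nF; apply: (hF k (ltn_ord k)); rewrite valK.
pose G r := [/\ 0 < r, ~ E2 r & forall z, nrm z = r -> ok z].
pose T := characteristic f.
have Gf r : G r -> regcirc f r by move=> [_ _ h] z /h[[]].
have T_large B : exists M, forall r, M <= r -> G r -> B <= T r.
  have [k hk] := char_lower f_mero (nfb (f z0)) hz0; have [M hM] := ln_large (B + k).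
  exists (Num.max M (Num.max 1 (nrm z0))) => r; rewrite ge_max => /andP[Mr zr] Gr.
  have gr : regcirc (fun z => f z - f z0) r by case: Gr => _ _ h z /h[[]].
  have := hk r zr (regcirc_hol (Gf r Gr)) gr; have := hM r Mr; rewrite /T.
  by move: (characteristic f r) (ln r) => *; lra.
have [K T_bound] : exists K, exists r0, forall r, r0 <= r -> G r -> 1 <= T r <= r ^+ K.
  have [K [r0 hK]] := finite_order_bound f_order; have [M hM] := T_large 1.
  exists K, (Num.max r0 M) => r; rewrite ge_max => /andP[h1 h2] Gr.
  by rewrite hM//= hK.
have T_pos : exists M, forall r, M <= r -> G r -> 0 <= T r by exact: T_large.
have sa k : small_along T G (characteristic (a k)).
  exists set0; first exact: flm_set0.
  move=> eps e0; have [M hM] := hE2 k eps e0; have [M' hM'] := T_pos.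
  exists (Num.max M M') => r; rewrite ge_max => /andP[h1 h2] Gr _.
  have nE : ~ E2 r by case: Gr.
  apply: (le_trans (ler_norm _)); apply: (le_trans (hM r h1 nE)).
  by rewrite ger0_norm//; exact: hM'.
have aT k : exists M, forall r, M <= r -> G r -> characteristic (a k) r <= T r.
  have [M hM] := hE2 k 1 ltr01; have [M' hM'] := T_pos.
  exists (Num.max M M') => r; rewrite ge_max => /andP[h1 h2] Gr.
  have nE : ~ E2 r by case: Gr.
  apply: (le_trans (ler_norm _)); apply: (le_trans (hM r h1 nE)).
  by rewrite mul1r ger0_norm//; exact: hM'.
have sQ k : small_along T G (proximity (fun z => difference c f z / (f z - a k z))).
  apply: (@delta_quotient_small R c f G K f_mero f_diff T_large T_bound Gf (a k)
    (a_mero k) (a_periodic k) (aT k)).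
  move=> r [_ _ h]; split=> z zr; have [_ [_ /(_ k)[h1 h2 h3 h4] _]] := h z zr;
    [exact: h1|exact: h2|exact: h3|exact: h4].
have sf : small_along T G (proximity (fun z => difference c f z / f z)).
  have := @delta_quotient_small R c f G K f_mero f_diff T_large T_bound Gf (fun=> 0)
    (mero_cst 0) (@const_periodic R c 0).
  have -> : (fun z => difference c f z / (f z - 0)) = (fun z => difference c f z / f z).
    by apply/funext => z; rewrite subr0.
  apply.
    have [M hM] := T_pos; exists (Num.max 1 M) => r; rewrite ge_max => /andP[r1 Mr] Gr.
    have r0 := lt_le_trans ltr01 r1.
    rewrite /characteristic counting_cst// proximity_cst// addr0 nrm0.
    by rewrite /logp ln0// maxxx hM.
  move=> r Gr; split.
  - by move=> z _; exact: holat_cst.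
  - have -> : (fun z => f z - 0) = f by apply/funext => z; rewrite subr0.
    exact: Gf.
  - have -> : (fun z => f (z + c) - 0) = (fun z => f (z + c)) by apply/funext => z; rewrite subr0.
    by move=> z zr; case: Gr => _ _ /(_ z zr)[_ []].
  - by [].
have sij i j : i != j -> small_along T G (proximity (fun z => (a i z - a j z)^-1)).
  move=> ij; apply: (inv_diff_small T_large (a_mero i) (a_mero j) (naa i j ij) (sa i) (sa j)).
  move=> r [_ _ h]; split=> z /h[_ [_ h1 h2]]; last exact: h2.
    by have [k1 _ _ _] := h1 i; exact: k1.
  by have [k1 _ _ _] := h1 j; exact: k1.
pose k0 := ln (nrm (lead (difference c f) 0)).
pose err r := proximity (fun z => difference c f z / f z) r - k0 +
   \sum_(k < q) proximity (fun z => difference c f z / (f z - a k z)) r +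
   \sum_(i < q) \sum_(j < q | j != i) (proximity (fun z => (a i z - a j z)^-1) r + ln 2).
have [E3 fE3 hE3] : small_along T G err.
  apply: small_alongD; first apply: small_alongD.
  - exact: (small_alongD sf (small_along_cst _ T_large)).
  - exact: (small_along_sum T_pos (fun k _ => sQ k)).
  apply: (small_along_sum T_pos) => i _; apply: (small_along_sum T_pos) => j ji.
  by apply: (small_alongD (sij i j _) (small_along_cst _ T_large)); rewrite eq_sym.
pose lhs r := proximity f r + \sum_(k < q) proximity (fun z => (f z - a k z)^-1) r.
pose rhs r := 2 * characteristic f r - N_pair c f r.
exists (fun r => Num.max 0 (lhs r - rhs r)); split; last first.
  by move=> r _; rewrite -lerBlDl le_max lexx orbT.
exists (E1 `|` (E2 `|` E3)); first by apply: flm_setU => //; exact: flm_setU.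
move=> eps e0; apply/near_pinftyP; have [M hM] := hE3 eps e0; have [M' hM'] := T_pos.
exists (Num.max 1 (Num.max M M')) => r; rewrite !ge_max => /andP[r1 /andP[Mr Mr']] nE.
have r0 := lt_le_trans ltr01 r1.
have n1 : ~ E1 r by move=> e; apply: nE; left.
have n2 : ~ E2 r by move=> e; apply: nE; right; left.
have n3 : ~ E3 r by move=> e; apply: nE; right; right.
have h := hE1 r r0 n1; have Gr : G r by [].
have T0 := hM' r Mr' Gr.
rewrite ger0_norm ?le_max ?lexx// (ger0_norm T0) ge_max mulr_ge0 ?(ltW e0)//=.
apply: le_trans (hM r Mr Gr n3); rewrite lerBlDl; apply: (second_main_estimate nd q0 r1 (Gf r Gr)).
- by move=> z /h[[_ h1 _] _]; exact: h1.
- by move=> k z /h[_ [_ /(_ k)[_ h1 _ _] _]]; exact: h1.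
- by move=> i j ij z /h[_ [_ _ h1]]; exact: h1.
Qed.
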